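(* Let $(\mathfrak a,\{\cdot_\lambda\cdot\}_{\mathfrak a})$ be a Lie conformal algebra and $(\mathfrak b;\varrho)$ an $\mathfrak a$-module. Then $\bigl(\bigoplus_{n\ge1}\mathscr C^n(\mathfrak b,\mathfrak a),\langle\cdot,\cdot\rangle\bigr)$ is a graded Lie algebra (with $\mathscr C^n(\mathfrak b,\mathfrak a)$ in degree $n$), where for $f_1\in\mathscr C^p(\mathfrak b,\mathfrak a)$, $f_2\in\mathscr C^q(\mathfrak b,\mathfrak a)$, $$\begin{aligned}\langle f_1,f_2\rangle_{\lambda_1,\dots,\lambda_{p+q-1}}(u_1,\dots,u_{p+q})=&-\sum_{\sigma\in\mathbb S_{(q,1,p-1)}}(-1)^\sigma f_1\bigl(\varrho(f_2(u_{\sigma(1)},\dots,u_{\sigma(q)}))_{\lambda_{\sigma(1)}+\cdots+\lambda_{\sigma(q)}}u_{\sigma(q+1)},u_{\sigma(q+2)},\dots,u_{\sigma(p+q)}\bigr)\big|_{\lambda_{p+q}\mapsto\lambda_{p+q}^\ddagger}\\&+(-1)^{pq}\sum_{\sigma\in\mathbb S_{(p,1,q-1)}}(-1)^\sigma f_2\bigl(\varrho(f_1(u_{\sigma(1)},\dots,u_{\sigma(p)}))_{\lambda_{\sigma(1)}+\cdots+\lambda_{\sigma(p)}}u_{\sigma(p+1)},u_{\sigma(p+2)},\dots,u_{\sigma(p+q)}\bigr)\big|_{\lambda_{p+q}\mapsto\lambda_{p+q}^\ddagger}\\&-(-1)^{pq}\sum_{\sigma\in\mathbb S_{(p,q)}}(-1)^\sigma\bigl\{f_1(u_{\sigma(1)},\dots,u_{\sigma(p)})_{\lambda_{\sigma(1)}+\cdots+\lambda_{\sigma(p)}}f_2(u_{\sigma(p+1)},\dots,u_{\sigma(p+q)})\bigr\}_{\mathfrak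 a}\big|_{\lambda_{p+q}\mapsto\lambda_{p+q}^\ddagger}.\end{aligned}$$ (This is called the controlling algebra for conformal $\mathcal O$-operators, i.e. for $\mathbb C[\partial]$-module homomorphisms $B:\mathfrak b\to\mathfrak a$ with $\{B(u)_\lambda B(v)\}_{\mathfrak a}=B(\varrho(B(u))_\lambda v-\varrho(B(v))_{-\lambda-\partial}u)$.)
   Context: All vector spaces and linear maps are over $\mathbb C$, and all $\mathbb C[\partial]$-modules are finitely generated. A Lie conformal algebra is a $\mathbb C[\partial]$-module $\mathfrak a$ with a $\mathbb C$-linear map $\mathfrak a\otimes\mathfrak a\to\mathfrak a[\lambda]$, $x\otimes y\mapsto\{x_\lambda y\}$, such that $\{\partial x_\lambda y\}=-\lambda\{x_\lambda y\}$, $\{x_\lambda\partial y\}=(\partial+\lambda)\{x_\lambda y\}$, $\{x_\lambda y\}=-\{y_{-\lambda-\partial}x\}$ and $\{x_\lambda\{y_\mu z\}\}=\{\{x_\lambda y\}_{\lambda+\mu}z\}+\{y_\mu\{x_\lambda z\}\}$ ($\partial$ in a subscript acts from the left on the coefficients). A module $(M;\varrho)$ over $\mathfrak a$ is a $\mathbb C[\partial]$-module with $\mathbb C$-linear maps $\varrho(a)_\lambda:M\to M[\lambda]$, linear in $a$, such that $\varrho(a)_\lambda(\partial m)=(\partial+\lambda)\varrho(a)_\lambda m$, $\varrho(\partial a)_\lambda=-\lambda\varrho(a)_\lambda$, $\varrho(a)_\lambda\varrho(b)_\mu-\varrho(b)_\mu\varrho(a)_\lambda=\varrho(\{a_\lambda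 b\}_{\mathfrak a})_{\lambda+\mu}$. Cochains: $\mathscr C^k(M,N)$, $k\ge1$, is the space of $\mathbb C$-linear maps $\varphi:M^{\otimes k}\to\mathbb C[\lambda_1,\dots,\lambda_{k-1}]\otimes N$ such that, with $\lambda_k^\ddagger:=-\sum_{j=1}^{k-1}\lambda_j-\partial$ ($\partial$ acting on $N$ from the left), (i) $\varphi(\dots,\partial a_i,\dots)=-\lambda_i\varphi(\dots,a_i,\dots)$ for $1\le i\le k-1$ and $\varphi(\dots,\partial a_k)=-\lambda_k^\ddagger\varphi(\dots,a_k)$; (ii) for every permutation $\sigma$, $\varphi_{\lambda_1,\dots,\lambda_{k-1}}(a_1,\dots,a_k)=(-1)^\sigma\varphi_{\lambda_{\sigma(1)},\dots,\lambda_{\sigma(k-1)}}(a_{\sigma(1)},\dots,a_{\sigma(k)})|_{\lambda_k\mapsto\lambda_k^\ddagger}$. Parameter convention: the variable $\lambda_i$ is attached to $u_i$, and to any expression built from $u_{i_1},\dots,u_{i_r}$ the sum $\lambda_{i_1}+\cdots+\lambda_{i_r}$; the (suppressed) subscripts of a cochain are the variables attached to all its arguments except the last, in order. $\mathbb S_{(i_1,\dots,i_r)}$ denotes the unshuffles (permutations increasing on each of the consecutive blocks of sizes $i_1,\dots,i_r$). *)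

(* Defs.v *)
From HB Require Import structures.
From mathcomp Require Import all_boot all_order all_algebra all_fingroup.
From mathcomp Require Import finmap.
From mathcomp Require Import boolp functions.
From mathcomp Require Import monalg.

Set Implicit Arguments.
Unset Strict Implicit.
Unset Printing Implicit Defensive.

Import GRing.Theory.
Local Open Scope ring_scope.

(* A C[d]-module is a vector space with a linear endomorphism. *)
HB.mixin Record isDerModule (F : fieldType) M of GRing.Lmodule F M := {
  partial : {linear M -> M}
}.

#[short(type="derModType")]
HB.structure Definition DerModule (F : fieldType) :=
  { M of GRing.Lmodule F M & isDerModule F M }.

Definition finitely_generated (F : fieldType) (M : derModType F) : Prop :=
  exists (n : nat) (g : 'I_n -> M), forall x : M, exists c : 'I_n -> {poly F},
    x = \sum_(i < n) \sum_(j < size (c i)) (c i)`_j *: iter j partial (g i).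

(* F[lambda_0, ..., lambda_(n-1)] (x) N: polynomials with coefficients in N.
   Variables and arguments are numbered from 0. *)
Definition lpoly (F : fieldType) (n : nat) (N : lmodType F) : Type :=
  {malg N[{cmonom 'I_n}]}.

HB.instance Definition _ (F : fieldType) (n : nat) (N : lmodType F) :=
  GRing.Zmodule.on (lpoly n N).

(* Locked because conversion on [<< x *g m >>] may fail to terminate in
   practice; see [lmonE]. *)
HB.lock Definition lmon (F : fieldType) (n : nat) (N : lmodType F)
  (m : {cmonom 'I_n}) (x : N) : lpoly n N := << x *g m >>.

Section Lpoly.
Context {F : fieldType} {n : nat} {N : lmodType F}.
Implicit Types (P Q : lpoly n N) (c : F) (x : N).

Definition lscale c P : lpoly n N := [malg m in msupp P => c *: P@_m].

Lemma lscaleE c P m : (lscale c P)@_m = c *: P@_m.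
Proof. by rewrite mcoeffE; case: msuppP; rewrite ?scaler0. Qed.

Fact lscaleA c1 c2 P : lscale c1 (lscale c2 P) = lscale (c1 * c2) P.
Proof. by apply/malgP=> m; rewrite !lscaleE scalerA. Qed.

Fact lscale1 : left_id 1 lscale.
Proof. by move=> P; apply/malgP=> m; rewrite lscaleE scale1r. Qed.

Fact lscaleDr : right_distributive lscale +%R.
Proof. by move=> c P Q; apply/malgP=> m; rewrite mcoeffD !lscaleE mcoeffD scalerDr. Qed.

Fact lscaleDl P : {morph lscale^~ P : c d / c + d}.
Proof. by move=> c d; apply/malgP=> m; rewrite mcoeffD !lscaleE scalerDl. Qed.

HB.instance Definition _ := GRing.Zmodule_isLmodule.Build F (lpoly n N)
  lscaleA lscale1 lscaleDr lscaleDl.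

Lemma mcoeff_lpolyZ c P m : (c *: P)@_m = c *: P@_m.
Proof. exact: lscaleE. Qed.

Lemma mcoeff_lpolyD P Q m : (P + Q)@_m = P@_m + Q@_m.
Proof. exact: mcoeffD. Qed.

Lemma lsum_linear (W : lmodType F) (h : {cmonom 'I_n} -> N -> W) :
  (forall m, linear (h m)) ->
  linear (fun P : lpoly n N => \sum_(m <- msupp P) h m P@_m).
Proof.
move=> hl c P Q /=.
have h0 m : h m 0 = 0.
  by have := hl m (-1) 0 0; rewrite scaleN1r addNr scaleN1r addNr.
have hw (d : {fset {cmonom 'I_n}}) (S : lpoly n N) : (msupp S `<=` d)%fset ->
    \sum_(m <- msupp S) h m S@_m = \sum_(m <- d) h m S@_m.
  by move=> le; apply: big_fset_incl => // m _ /mcoeff_outdom ->; exact: h0.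
pose d : {fset {cmonom 'I_n}} :=
  (msupp (c *: P + Q : lpoly n N) `|` (msupp P `|` msupp Q))%fset.
have [sPQ sP sQ] : [/\ (msupp (c *: P + Q : lpoly n N) `<=` d)%fset,
    (msupp P `<=` d)%fset & (msupp Q `<=` d)%fset].
  by split; apply/fsubsetP=> m; rewrite !in_fsetU => ->; rewrite ?orbT.
rewrite (hw d) // (hw d P) // (hw d Q) //.
rewrite scaler_sumr -big_split /=; apply: eq_bigr => m _.
by rewrite mcoeff_lpolyD mcoeff_lpolyZ hl.
Qed.

Lemma lmonE m x m' : (lmon m x : lpoly n N)@_m' = if m == m' then x else 0.
Proof. by rewrite lmon.unlock mcoeffU mulrb. Qed.

Definition lconst (x : N) : lpoly n N := lmon mone x.

(* multiplication by lambda_i *)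
Definition lvar (i : 'I_n) P : lpoly n N :=
  \sum_(m <- msupp P) lmon (mmul m (ucm i)) P@_m.

(* The value of [P] when lambda_i acts as the endomorphism [T i] of [W] and the
   coefficients are sent to [W] by [g].  Only used with commuting [T i], so that
   the order of composition does not matter.  All substitutions of the lambda_i,
   including those involving the derivation, are instances of this. *)
Definition leval (W : lmodType F) (T : 'I_n -> W -> W) (g : N -> W) P : W :=
  \sum_(m <- msupp P) foldr (fun i => iter (m i) (T i)) (g P@_m) (enum 'I_n).

Lemma lmon_linear m : linear (lmon m).
Proof.
move=> c x y; apply/malgP=> m'; rewrite mcoeff_lpolyD mcoeff_lpolyZ !lmonE.
by case: eqP => // _; rewrite scaler0 addr0.
Qed.

Lemma lvar_linear i : linear (lvar i).
Proof.
apply: (@lsum_linear _ (fun m x => lmon (mmul m (ucm i)) x)) => m.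
exact: lmon_linear.
Qed.

HB.instance Definition _ i :=
  GRing.isLinear.Build F (lpoly n N) (lpoly n N) _ (lvar i) (lvar_linear i).

HB.instance Definition _ :=
  GRing.isLinear.Build F N (lpoly n N) _ lconst (lmon_linear mone).

Lemma leval_linear (W : lmodType F) (T : 'I_n -> W -> W) (g : N -> W) :
  (forall i, linear (T i)) -> linear g -> linear (leval T g).
Proof.
move=> Tl gl; apply: (@lsum_linear _ (fun m x =>
  foldr (fun i => iter (m i) (T i)) (g x) (enum 'I_n))) => m c x y.
elim: (enum 'I_n) => [|i s IHs] /=; first exact: gl.
by rewrite IHs; elim: (m i) => [//|k IHk] /=; rewrite IHk Tl.
Qed.

End Lpoly.

(* The derivation acts on the coefficients. *)
Definition lpartial (F : fieldType) (n : nat) (N : derModType F)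
    (P : lpoly n N) : lpoly n N :=
  \sum_(m <- msupp P) lmon m (partial P@_m).

Fact lpartial_linear (F : fieldType) (n : nat) (N : derModType F) :
  linear (@lpartial F n N).
Proof.
apply: (@lsum_linear _ _ _ _ (fun m x => lmon m (partial x))) => m c x y.
by rewrite linearP; exact: lmon_linear.
Qed.

HB.instance Definition _ (F : fieldType) (n : nat) (N : derModType F) :=
  GRing.isLinear.Build F (lpoly n N) (lpoly n N) _ _ (@lpartial_linear F n N).

HB.instance Definition _ (F : fieldType) (n : nat) (N : derModType F) :=
  isDerModule.Build F (lpoly n N) (@lpartial F n N : {linear _ -> _}).

(* {x_T y}: the lambda-product [xy], with lambda replaced by the operator T *)
Definition lat (F : fieldType) (n : nat) (N : derModType F)
    (T : lpoly n N -> lpoly n N) (xy : lpoly 1 N) : lpoly n N :=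
  leval (fun=> T) lconst xy.

Local Notation "'lam" := (lvar (ord0 : 'I_2)) (at level 0).
Local Notation "'mu" := (lvar (ord_max : 'I_2)) (at level 0).
Local Notation "'lam_mu" := (fun P => 'lam P + 'mu P) (at level 0).

Record lieConformal (F : fieldType) (A : derModType F) := LieConformal {
  lbr :> A -> A -> lpoly 1 A;
  lbr_linearl : forall y, linear (lbr^~ y);
  lbr_linearr : forall x, linear (lbr x);
  lbr_partiall : forall x y, lbr (partial x) y = - lvar ord0 (lbr x y);
  lbr_partialr : forall x y,
    lbr x (partial y) = partial (lbr x y) + lvar ord0 (lbr x y);
  lbr_skew : forall x y,
    lbr x y = - lat (fun P => - lvar ord0 P - partial P) (lbr y x);
  lbr_jacobi : forall x y z,
    leval (fun=> 'mu) (fun c => lat 'lam (lbr x c)) (lbr y z) =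
    leval (fun=> 'lam) (fun c => lat 'lam_mu (lbr c z)) (lbr x y) +
    leval (fun=> 'lam) (fun c => lat 'mu (lbr y c)) (lbr x z)
}.

Record lcRep (F : fieldType) (A : derModType F) (brA : lieConformal A)
    (M : derModType F) := LcRep {
  lact :> A -> M -> lpoly 1 M;
  lact_linearl : forall m, linear (lact^~ m);
  lact_linearr : forall x, linear (lact x);
  lact_partiall : forall x m, lact (partial x) m = - lvar ord0 (lact x m);
  lact_partialr : forall x m,
    lact x (partial m) = partial (lact x m) + lvar ord0 (lact x m);
  lact_comm : forall x y m,
    leval (fun=> 'mu) (fun c => lat 'lam (lact x c)) (lact y m) -
    leval (fun=> 'lam) (fun c => lat 'mu (lact y c)) (lact x m) =
    leval (fun=> 'lam) (fun c => lat 'lam_mu (lact c m)) (brA x y)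
}.

Section Dagger.
Context {F : fieldType} {k : nat} {N : derModType F}.

(* lambda_i as an operator on F[lambda_0, ..., lambda_(k-2)] (x) N for i < k,
   where the last one stands for - lambda_0 - ... - lambda_(k-2) - d *)
Definition ldag (i : 'I_k) (P : lpoly k.-1 N) : lpoly k.-1 N :=
  if insub (val i) is Some j then lvar j P
  else - (\sum_(j < k.-1) lvar j P) - partial P.

Definition dagger : lpoly k N -> lpoly k.-1 N := leval ldag lconst.

Lemma ldag_linear i : linear (ldag i).
Proof.
move=> c P Q; rewrite /ldag; case: insub => [j|]; first exact: linearP.
rewrite linearP (eq_bigr (fun j => c *: lvar j P + lvar j Q)); last first.
  by move=> j _; rewrite linearP.
by rewrite big_split /= -scaler_sumr !opprD scalerBr scalerN addrACA.
Qed.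

Lemma dagger_linear : linear dagger.
Proof. by apply: leval_linear; [exact: ldag_linear|exact: linearP]. Qed.

HB.instance Definition _ :=
  GRing.isLinear.Build F (lpoly k N) (lpoly k.-1 N) _ dagger dagger_linear.

End Dagger.

Definition upd (k : nat) (T : Type) (a : {ffun 'I_k -> T}) (i : 'I_k) (x : T) :
  {ffun 'I_k -> T} := [ffun j => if j == i then x else a j].

(* the variables of a k-cochain: those attached to all its arguments but the
   last, when the operator [t i] is attached to its i-th argument *)
Definition butlast (k : nat) (T : Type) (t : 'I_k -> T) : 'I_k.-1 -> T :=
  fun i => t (widen_ord (leq_pred k) i).

Section Cochain.
Context {F : fieldType} (M N : derModType F).

(* Multilinear maps stand for linear maps on the k-th tensor power. *)
Definition is_cochain (k : nat)
    (phi : {ffun 'I_k -> M} -> lpoly k.-1 N) : Prop :=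
  [/\ forall i a, linear (fun x => phi (upd a i x)),
      forall i a, phi (upd a i (partial (a i))) = - ldag i (phi a)
    & forall (s : 'S_k) a,
        phi a = (-1) ^+ odd_perm s *:
          dagger (leval (butlast (fun i => lvar (s i))) lconst
                        (phi [ffun i => a (s i)]))].

Definition cochain_pred (k : nat) :
    {pred ({ffun 'I_k -> M} -> lpoly k.-1 N)} :=
  fun phi => `[< is_cochain phi >].

Record cochain (k : nat) := Cochain {
  cochain_fun :> {ffun 'I_k -> M} -> lpoly k.-1 N;
  _ : cochain_fun \in @cochain_pred k
}.

End Cochain.

Section CochainLmod.
Context {F : fieldType} {M N : derModType F} {k : nat}.

Fact cochain_submod : submod_closed (@cochain_pred F M N k).
Proof.
have E (s : 'S_k) : linear (leval (butlast (fun i => lvar (s i)))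
    (lconst : N -> lpoly k N)).
  by apply: leval_linear => [i|]; exact: linearP.
split.
  apply/asboolP; split => [i a c x y|i a|s a].
  - by rewrite /= scaler0 addr0.
  - have := ldag_linear i (-1) (0 : lpoly k.-1 N) 0.
    by rewrite /= !scaleN1r !addNr => ->; rewrite oppr0.
  - have := E s (-1) 0 0; rewrite /= !scaleN1r !addNr => ->.
    by rewrite linear0 scaler0.
move=> c f g /asboolP[f1 f2 f3] /asboolP[g1 g2 g3]; apply/asboolP.
have vE a : (c *: f + g) a = c *: f a + g a by [].
split => [i a d x y|i a|s a]; rewrite !vE.
- by rewrite f1 g1 !scalerDr !scalerA [c * d]mulrC addrACA.
- by rewrite f2 g2 ldag_linear opprD scalerN.
- rewrite E linearP scalerDr scalerA mulrC -scalerA.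
  by rewrite -f3 -g3.
Qed.

HB.instance Definition _ := GRing.isSubmodClosed.Build F _
  (@cochain_pred F M N k) cochain_submod.

HB.instance Definition _ := [isSub for @cochain_fun F M N k].
HB.instance Definition _ := [Choice of cochain M N k by <:].
HB.instance Definition _ := [SubChoice_isSubLmodule of cochain M N k by <:].

End CochainLmod.

(* Permutations of {0, ..., n-1} increasing on each of the consecutive blocks
   of sizes r_1, r_2, ...; [reshape_index r i] is the block containing i. *)
Definition unshuffle (r : seq nat) (n : nat) (s : 'S_n) : bool :=
  [forall i : 'I_n, forall j : 'I_n,
    (i < j) && (reshape_index r i == reshape_index r j) ==> (s i < s j)]%N.

Section ControllingBracket.
Context {F : fieldType} {A B : derModType F}.
Variables (brA : lieConformal A) (rho : lcRep brA B).

Section Terms.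
Context {m n k : nat} (e : (m + n = k)%N).
Variables (u : {ffun 'I_k -> B}) (s : 'S_k).

(* s(i) for i in the first block of size m *)
Definition sfst (i : 'I_m) : 'I_k := s (cast_ord e (lshift n i)).
(* s(m + i) *)
Definition ssnd (i : 'I_n) : 'I_k := s (cast_ord e (rshift m i)).

(* lambda_s(0) + ... + lambda_s(m-1) *)
Definition lfst {N : derModType F} (P : lpoly k N) : lpoly k N :=
  \sum_(i < m) lvar (sfst i) P.

(* g(u_s(0), ..., u_s(m-1)), with coefficients mapped by h *)
Definition at_fst (N : derModType F) (g : cochain B A m) (h : A -> lpoly k N) :
    lpoly k N :=
  leval (butlast (fun i => lvar (sfst i))) h (g [ffun i => u (sfst i)]).

(* g(u_s(m), ..., u_s(m+n-1)), with coefficients mapped by h *)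
Definition at_snd (N : derModType F) (g : cochain B A n) (h : A -> lpoly k N) :
    lpoly k N :=
  leval (butlast (fun i => lvar (ssnd i))) h (g [ffun i => u (ssnd i)]).

End Terms.

(* f(rho(g(u_s(0), ..., u_s(m-1)))_{lambda_s(0) + ... + lambda_s(m-1)} u_s(m),
     u_s(m+1), ..., u_s(m+n)) *)
Definition insert_term (m n k : nat) (e : (m + n.+1 = k)%N)
    (f : cochain B A n.+1) (g : cochain B A m)
    (u : {ffun 'I_k -> B}) (s : 'S_k) : lpoly k A :=
  let u_ i := u (ssnd e s i) in
  let lam_ (i : 'I_n.+1) (P : lpoly k A) :=
    if i == ord0 then lfst e s P + lvar (ssnd e s ord0) P
    else lvar (ssnd e s i) P in
  let f_at (y : B) : lpoly k A :=
    leval (butlast lam_) lconst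
          (f [ffun i => if i == ord0 then y else u_ i]) in
  at_fst e u s g (fun x => leval (fun=> lfst e s) f_at (rho x (u_ ord0))).

(* {f(u_s(0), ..., u_s(m-1))_{lambda_s(0) + ... + lambda_s(m-1)}
    g(u_s(m), ..., u_s(m+n-1))} *)
Definition bracket_term (m n k : nat) (e : (m + n = k)%N)
    (f : cochain B A m) (g : cochain B A n)
    (u : {ffun 'I_k -> B}) (s : 'S_k) : lpoly k A :=
  at_fst e u s f (fun x => at_snd e u s g (fun y => lat (lfst e s) (brA x y))).

(* <f1, f2> for f1 of degree p = p'.+1 and f2 of degree q = q'.+1 *)
Definition controlling_bracket (p' q' : nat) (p := p'.+1) (q := q'.+1)
    (f1 : cochain B A p) (f2 : cochain B A q) (u : {ffun 'I_(p + q) -> B}) :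
    lpoly (p + q).-1 A :=
  - (\sum_(s : 'S_(p + q) | unshuffle [:: q; 1; p.-1]%N s)
       (-1) ^+ odd_perm s *: dagger (insert_term (addnC q p) f1 f2 u s))
  + (-1) ^+ (p * q) *:
    (\sum_(s : 'S_(p + q) | unshuffle [:: p; 1; q.-1]%N s)
       (-1) ^+ odd_perm s *: dagger (insert_term (erefl (p + q)%N) f2 f1 u s))
  - (-1) ^+ (p * q) *:
    (\sum_(s : 'S_(p + q) | unshuffle [:: p; q] s)
       (-1) ^+ odd_perm s *: dagger (bracket_term (erefl (p + q)%N) f1 f2 u s)).

End ControllingBracket.

(* The direct sum of the [L n] over n >= 1, with [L n] in degree n, is a graded
   Lie algebra; [L 0] plays no role. *)
Record graded_lie (F : fieldType) (L : nat -> lmodType F)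
    (br : forall p q, L p -> L q -> L (p + q)%N) : Prop := GradedLie {
  graded_lie_linearl : forall p q (y : L q),
    (0 < p)%N -> (0 < q)%N -> linear (fun x : L p => br p q x y);
  graded_lie_linearr : forall p q (x : L p),
    (0 < p)%N -> (0 < q)%N -> linear (br p q x);
  graded_lie_skew : forall p q (x : L p) (y : L q),
    (0 < p)%N -> (0 < q)%N ->
    br p q x y = - ((-1) ^+ (p * q) *: ecast n (L n) (addnC q p) (br q p y x));
  graded_lie_jacobi : forall p q r (x : L p) (y : L q) (z : L r),
    (0 < p)%N -> (0 < q)%N -> (0 < r)%N ->
    br p (q + r)%N x (br q r y z) =
      ecast n (L n) (esym (addnA p q r)) (br (p + q)%N r (br p q x y) z) +
      (-1) ^+ (p * q) *:
        ecast n (L n) (addnCA q p r) (br q (p + r)%N y (br p r x z))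
}.

(* Main.v *)
Require Import Defs.
From mathcomp Require Import all_boot all_order all_algebra all_fingroup.
From mathcomp Require Import finmap boolp monalg zify ring.
From mathcomp Require Import reals complex.

Set Implicit Arguments.
Unset Strict Implicit.
Unset Printing Implicit Defensive.

Import GRing.Theory.
Local Open Scope ring_scope.

(** When a Lie algebra acts on a vector space, the functions on that space with
    values in the Lie algebra carry the bracket of the action Lie algebroid: the
    pointwise bracket, corrected by the derivative of each function along the
    vector field that the other one defines through the action.  For an odd
    space the functions are the alternating multilinear maps, and this is the
    bracket of the theorem without its lambdas.  The proof removes the lambdas,
    then organizes the signs, then checks the Jacobi identity.

    The lambdas.  An expression attached to the sum [l] of some variables
    lives in the polynomials with coefficients in the module, taken modulo the
    image of [partial + l].  Once this weight [l] is recorded, {x_l y} and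
    rho(x)_l m are bilinear over the polynomials and add the weights.  The
    Jacobi and representation identities hold for polynomials, before any
    quotient is taken, while skew-symmetry only holds in the quotient
    ([polyLie], an instance of the structure [weightedLie]).  A cochain extends
    to lists of weighted arguments with polynomial entries ([hat]), and its
    defining conditions say that the extension is skew and descends to the
    quotients ([hat_multimap]).  The substitution [dagger] of the last variable
    is the passage to the quotient ([dagger_null] and [dagger_nullp]).  So
    cochains are equal as soon as their extensions agree modulo the null
    submodules ([cochain_eq]).

    The signs.  A signed sum over unshuffles of the arguments is a component of
    an iterated coproduct of the exterior algebra: a signed sum over the
    splittings of a list into sublists, which [splitsum] defines by recursion on
    the list.  [unshuffle_sum] compares the two by removing the least value of
    an unshuffle, which stands at the beginning of a block.  In the recursive
    form an additional argument at the head of the list is distributed by a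
    Leibniz rule, which holds by computation; coassociativity [splitsumA] and
    graded commutativity [splitsumC] replace all other reindexing of
    permutations.

    The Jacobi identity.  The bracket is a combination of the insertions
    f(rho(g) x, ...), called [ins f g], and of the brackets {f, g}, called
    [brk f g].  Composites of these satisfy a pre-Lie type identity [ins_insl],
    whose defect is controlled by [insins_sym] and, through the representation
    identity, by [ins_brk_insact]; [brk_ins] says that insertion is a derivation
    of the bracket; [brk_jacobi] and [brk_skew] come from the Lie algebra.  The
    graded Jacobi identity [ctl_jacobi] is a linear combination of these.  By
    [controlling_bracket_ctl] the bracket of the theorem is computed by [ctl] on
    the extensions of the cochains, for arguments of arbitrary weights; taking
    the weights to be permuted variables shows that it is a cochain, and the
    graded Lie algebra identities follow from those of [ctl]. *)

(** * Linear maps and linear identities *)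

Section LinearFacts.
Variables (F : fieldType) (U V : lmodType F) (h : U -> V).
Hypothesis hl : linear h.

Lemma lin0 : h 0 = 0.
Proof. by have := hl (-1) 0 0; rewrite scaler0 addr0 scaleN1r addNr. Qed.

Lemma linZ c u : h (c *: u) = c *: h u.
Proof. by rewrite -[c *: u]addr0 hl lin0 addr0. Qed.

Lemma linD u v : h (u + v) = h u + h v.
Proof. by rewrite -[u]scale1r hl !scale1r. Qed.

Lemma linN u : h (- u) = - h u.
Proof. by rewrite -scaleN1r linZ scaleN1r. Qed.

Lemma linB u v : h (u - v) = h u - h v.
Proof. by rewrite linD linN. Qed.

Lemma lin_sum (I : Type) (r : seq I) (P : pred I) (f : I -> U) :
  h (\sum_(i <- r | P i) f i) = \sum_(i <- r | P i) h (f i).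
Proof. exact: (big_morph h linD lin0). Qed.

End LinearFacts.

Section LinearCombination.
Variables (F : fieldType) (V : lmodType F).

Inductive lcexpr :=
  | LCvar of nat
  | LCzero
  | LCadd of lcexpr & lcexpr
  | LCopp of lcexpr
  | LCscale of F & lcexpr.

Fixpoint lceval (env : seq V) e : V :=
  match e with
  | LCvar i => nth 0 env i
  | LCzero => 0
  | LCadd e1 e2 => lceval env e1 + lceval env e2
  | LCopp e1 => - lceval env e1
  | LCscale c e1 => c *: lceval env e1
  end.

Fixpoint lccoef e (i : nat) : F :=
  match e with
  | LCvar j => if eqn i j then 1 else 0
  | LCzero => 0
  | LCadd e1 e2 => lccoef e1 i + lccoef e2 i
  | LCopp e1 => - lccoef e1 i
  | LCscale c e1 => c * lccoef e1 i
  end.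

Lemma lcevalE env e : lceval env e = \sum_(i < size env) lccoef e i *: env`_i.
Proof.
elim: e => /= [j||e1 -> e2 ->|e1 ->|c e1 ->].
- have E (i : nat) : (if eqn i j then 1 else 0 : F) = (i == j)%:R by rewrite -[eqn i j]/(i == j); case: (i == j).
  case: (ltnP j (size env)) => [lt_j|le_j].
    rewrite (bigD1 (Ordinal lt_j)) //= E eqxx scale1r big1 ?addr0 // => i.
    by rewrite -val_eqE /= E => /negPf->; rewrite scale0r.
  rewrite nth_default // big1 // => i _; rewrite E ltn_eqF ?scale0r //.
  exact: leq_trans le_j.
- by rewrite big1 // => i _; rewrite scale0r.
- by rewrite -big_split; apply: eq_bigr => i _; rewrite scalerDl.
- by rewrite -sumrN; apply: eq_bigr => i _; rewrite scaleNr.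
- by rewrite scaler_sumr; apply: eq_bigr => i _; rewrite scalerA.
Qed.

Fixpoint lcagree k e1 e2 : Prop :=
  if k is k'.+1 then lccoef e1 k' = lccoef e2 k' /\ lcagree k' e1 e2 else True.

Lemma lcagreeP env e1 e2 :
  lcagree (size env) e1 e2 -> lceval env e1 = lceval env e2.
Proof.
rewrite !lcevalE => agr; apply: eq_bigr => i _; congr (_ *: _).
elim: (size env) i agr => [[]//|k IHk] i /= [e agr].
have [->//|ne] := eqVneq (i : nat) k.
have lt_i : (i < k)%N by rewrite ltn_neqAle ne -ltnS ltn_ord.
exact: IHk (Ordinal lt_i) agr.
Qed.

End LinearCombination.

Ltac lc_mem x env :=
  lazymatch env with
  | nil => false
  | cons ?y ?env' => lazymatch y with x => true | _ => lc_mem x env' end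
  end.

Ltac lc_index x env :=
  lazymatch env with
  | cons ?y ?env' =>
    lazymatch y with x => constr:(0%N) | _ => let i := lc_index x env' in constr:(S i) end
  end.

Ltac lc_atoms t env :=
  lazymatch t with
  | GRing.add ?a ?b => let env' := lc_atoms a env in lc_atoms b env'
  | GRing.opp ?a => lc_atoms a env
  | GRing.scale _ ?a => lc_atoms a env
  | GRing.zero => env
  | _ => lazymatch lc_mem t env with true => env | false => constr:(cons t env) end
  end.

Ltac lc_reify F t env :=
  lazymatch t with
  | GRing.add ?a ?b =>
    let e1 := lc_reify F a env in let e2 := lc_reify F b env in
    constr:(@LCadd F e1 e2)
  | GRing.opp ?a => let e := lc_reify F a env in constr:(@LCopp F e)
  | GRing.scale ?c ?a => let e := lc_reify F a env in constr:(@LCscale F c e)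
  | GRing.zero => constr:(@LCzero F)
  | _ => let i := lc_index t env in constr:(@LCvar F i)
  end.

(** Reduces an equality in the [F]-module [V] to the equality of the
    coefficients of each atom, proved by [ring]. *)
Ltac lincomb F V :=
  lazymatch goal with
  | |- ?a = ?b =>
    let env0 := lc_atoms a (@nil V) in
    let env := lc_atoms b env0 in
    let e1 := lc_reify F a env in
    let e2 := lc_reify F b env in
    apply: (@lcagreeP F V env e1 e2) => /=; repeat (split; first by ring); try exact: I
  end.

(** * Signed sums over the splittings of a list *)

Lemma sign_eq (R : pzRingType) (m n : nat) :
  odd m = odd n -> (-1) ^+ m = (-1) ^+ n :> R.
Proof. by move=> mn; rewrite -signr_odd mn signr_odd. Qed.

Section Split.
Variables (F : fieldType) (X : Type).

(** A component of the coproduct of the exterior algebra.  The sign of a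
    splitting is that of the permutation which lists the two blocks one after
    the other: [size a] counts the entries of the first block over which [x]
    jumps when it goes to the second one. *)
Fixpoint splitsum (V : lmodType F) (T : seq X -> seq X -> V) (s : seq X) : V :=
  if s is x :: s' then
    splitsum (fun a b => T (x :: a) b) s' +
    splitsum (fun a b => (-1) ^+ size a *: T a (x :: b)) s'
  else T [::] [::].

Lemma eq_splitsum (V : lmodType F) (T T' : seq X -> seq X -> V) s :
  (forall a b, (size a + size b)%N = size s -> T a b = T' a b) ->
  splitsum T s = splitsum T' s.
Proof.
elim: s T T' => [|x s IHs] T T' eqT /=; first exact: eqT.
by congr (_ + _); apply: IHs => a b ab; rewrite eqT //= ?addnS -ab.
Qed.

Lemma splitsum_linear (V W : lmodType F) (h : V -> W) T s :
  linear h -> h (splitsum T s) = splitsum (fun a b => h (T a b)) s.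
Proof.
move=> hl; elim: s T => [//|x s IHs] T /=.
by rewrite (linD hl) !IHs; congr (_ + _); apply: eq_splitsum => a b _; rewrite linZ.
Qed.

Lemma splitsum_lin (V : lmodType F) (c : F) (T T' : seq X -> seq X -> V) s :
  splitsum (fun a b => c *: T a b + T' a b) s =
  c *: splitsum T s + splitsum T' s.
Proof.
elim: s T T' => [//|x s IHs] T T' /=; rewrite !IHs scalerDr addrACA.
congr (_ + _); rewrite -IHs; apply: eq_splitsum => a b _.
by rewrite scalerDr !scalerA mulrC.
Qed.

Lemma splitsumZ (V : lmodType F) (c : F) (T : seq X -> seq X -> V) s :
  splitsum (fun a b => c *: T a b) s = c *: splitsum T s.
Proof.
rewrite (@splitsum_linear V V ( *:%R c)) // => d u v.
by rewrite scalerDr !scalerA mulrC.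
Qed.

Lemma splitsumD (V : lmodType F) (T T' : seq X -> seq X -> V) s :
  splitsum (fun a b => T a b + T' a b) s = splitsum T s + splitsum T' s.
Proof.
rewrite -[splitsum T s]scale1r -splitsum_lin.
by apply: eq_splitsum => a b _; rewrite scale1r.
Qed.

Lemma splitsum0 (V : lmodType F) (T : seq X -> seq X -> V) s :
  (forall a b, T a b = 0) -> splitsum T s = 0.
Proof.
move=> T0; transitivity (splitsum (fun a b => 0 *: T a b) s).
  by apply: eq_splitsum => a b _; rewrite T0 scaler0.
by rewrite splitsumZ scale0r.
Qed.

(** Coassociativity: both sides sum over the splittings in three blocks. *)
Lemma splitsumA (V : lmodType F) (T : seq X -> seq X -> seq X -> V) s :
  splitsum (fun d c => splitsum (fun a b => T a b c) d) s =
  splitsum (fun a d => splitsum (T a) d) s.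
Proof.
elim: s T => [//|x s IHs] T /=; rewrite splitsumD IHs -addrA; congr (_ + _).
transitivity (splitsum (fun d c =>
    splitsum (fun a b => (-1) ^+ size a *: T a (x :: b) c +
                         (-1) ^+ (size a + size b) *: T a b (x :: c)) d) s).
  rewrite -splitsumD; apply: eq_splitsum => d c _.
  rewrite splitsumD; congr (_ + _).
  rewrite -splitsumZ /=; apply: eq_splitsum => a b ab.
  by rewrite ab.
rewrite IHs; apply: eq_splitsum => a d _.
rewrite splitsumD scalerDr -!splitsumZ; congr (_ + _).
by apply: eq_splitsum => b c _; rewrite scalerA exprD.
Qed.

(** Graded commutativity: exchanging the blocks costs the sign of [size a]
    entries jumping over [size b] entries. *)
Lemma splitsumC (V : lmodType F) (T : seq X -> seq X -> V) s :
  splitsum T s = splitsum (fun a b => (-1) ^+ (size a * size b) *: T b a) s.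
Proof.
elim: s T => [|x s IHs] T /=; first by rewrite expr0 scale1r.
rewrite addrC; congr (_ + _); rewrite [LHS]IHs; apply: eq_splitsum => a b _;
  rewrite scalerA -exprD; congr (_ *: _); apply: sign_eq;
  by rewrite /= !(oddD, oddM, mulSn, mulnS) /=; case: (odd (size a)); case: (odd (size b)).
Qed.

(** A signed sum over splittings is skew when its summand is skew in both
    blocks: two adjacent entries either land in the same block, or are
    interchanged with a sign between the blocks.  Equality is taken modulo [Z],
    and the summand is only required to be skew on blocks whose total weight is
    that of the list. *)
Lemma splitsum_swap (V : lmodType F) (L : nmodType) (w : X -> L) (Z : V -> Prop)
    (T : seq X -> seq X -> V) (s1 : seq X) (x y : X) (s2 : seq X) :
    Z 0 -> (forall c u v, Z u -> Z v -> Z (c *: u + v)) ->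
    (forall a1 z t a2 b, \sum_(i <- a1 ++ z :: t :: a2) w i + \sum_(i <- b) w i =
        \sum_(i <- s1 ++ x :: y :: s2) w i ->
      Z (T (a1 ++ z :: t :: a2) b + T (a1 ++ t :: z :: a2) b)) ->
    (forall a b1 z t b2, \sum_(i <- a) w i + \sum_(i <- b1 ++ z :: t :: b2) w i =
        \sum_(i <- s1 ++ x :: y :: s2) w i ->
      Z (T a (b1 ++ z :: t :: b2) + T a (b1 ++ t :: z :: b2))) ->
  Z (splitsum T (s1 ++ x :: y :: s2) + splitsum T (s1 ++ y :: x :: s2)).
Proof.
move=> Z0 ZL.
have ZD u v : Z u -> Z v -> Z (u + v) by move=> *; rewrite -[u]scale1r; exact: ZL.
have ZZ c u : Z u -> Z (c *: u) by move=> Zu; rewrite -[_ *: _]addr0; exact: ZL.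
have Zsum T' s : (forall a b, \sum_(i <- a) w i + \sum_(i <- b) w i = \sum_(i <- s) w i ->
    Z (T' a b)) -> Z (splitsum T' s).
  elim: s T' => [|z s IHs] T' ZT /=; first by apply: ZT; rewrite !big_nil addr0.
  apply: ZD; apply: IHs => a b ab; last apply: ZZ.
    by apply: ZT; rewrite !big_cons -addrA ab.
  by apply: ZT; rewrite !big_cons addrCA ab.
elim: s1 T => [|z s1 IHs] T Tl Tr /=.
  set A := splitsum _ s2; set B := splitsum _ s2; set C := splitsum _ s2.
  set D := splitsum _ s2; set A' := splitsum _ s2; set B' := splitsum _ s2.
  set C' := splitsum _ s2; set D' := splitsum _ s2.
  (* x and y are in different blocks: exchanging them exchanges two terms. *)
  have BC : B + C' = 0.
    rewrite -splitsumD; apply: splitsum0 => a b /=.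
    by rewrite exprS mulN1r scaleNr subrr.
  have CB : C + B' = 0.
    rewrite -splitsumD; apply: splitsum0 => a b /=.
    by rewrite exprS mulN1r scaleNr addNr.
  have -> : A + B + (C + D) + (A' + B' + (C' + D')) =
      A + A' + (D + D') + ((B + C') + (C + B')) by lincomb F V.
  rewrite BC CB addr0 addr0.
  apply: ZD; rewrite -splitsumD; apply: Zsum => a b ab /=.
    by apply: (Tl [::]) => /=; rewrite !big_cons -!addrA ab.
  rewrite -scalerDr; apply: (ZZ); rewrite -scalerDr; apply: (ZZ).
  by apply: (Tr a [::]) => /=; rewrite !big_cons !(addrCA (\sum_(i <- a) _)) ab.
rewrite addrACA; apply: ZD; apply: IHs => /= [a1 z' t a2 b ab|a b1 z' t b2 ab].
- by apply: (Tl (z :: a1)); rewrite /= !big_cons -ab -!addrA.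
- by apply: Tr; rewrite /= !big_cons -ab -!addrA.
- rewrite !size_cat /= -scalerDr; apply: ZZ.
  by apply: Tl; rewrite /= !big_cons -ab addrCA.
- rewrite -scalerDr; apply: ZZ.
  by apply: (Tr a (z :: b1)); rewrite /= !big_cons -ab addrCA.
Qed.

Lemma splitsum_closed (V : lmodType F) (L : nmodType) (w : X -> L) (Z : V -> Prop)
    (T : seq X -> seq X -> V) (s : seq X) :
    (forall c u v, Z u -> Z v -> Z (c *: u + v)) -> Z 0 ->
    (forall a b, \sum_(i <- a) w i + \sum_(i <- b) w i = \sum_(i <- s) w i ->
      Z (T a b)) ->
  Z (splitsum T s).
Proof.
move=> ZL Z0.
elim: s T => [|z s IHs] T ZT /=; first by apply: ZT; rewrite !big_nil addr0.
rewrite -[X in X + _]scale1r; apply: (ZL); apply: IHs => a b ab.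
  by apply: ZT; rewrite !big_cons -addrA ab.
rewrite -[_ *: _]addr0; apply: (ZL) => //.
by apply: ZT; rewrite !big_cons addrCA ab.
Qed.

Lemma eq_splitsum_wt (V : lmodType F) (L : nmodType) (w : X -> L)
    (T T' : seq X -> seq X -> V) s :
  (forall a b, \sum_(i <- a) w i + \sum_(i <- b) w i = \sum_(i <- s) w i ->
    T a b = T' a b) ->
  splitsum T s = splitsum T' s.
Proof.
elim: s T T' => [|x s IHs] T T' eqT /=.
  by apply: eqT; rewrite !big_nil addr0.
congr (_ + _); apply: IHs => a b ab; rewrite eqT //.
  by rewrite !big_cons -ab addrA.
by rewrite !big_cons -ab addrCA.
Qed.

Lemma splitsumCA (V : lmodType F) (T : seq X -> seq X -> seq X -> V) s :
  splitsum (fun a => splitsum (T a)) s =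
  splitsum (fun b => splitsum (fun a c => (-1) ^+ (size a * size b) *: T a b c)) s.
Proof.
rewrite -splitsumA -[RHS]splitsumA; apply: eq_splitsum => d c _.
by rewrite splitsumC; apply: eq_splitsum => a b _; rewrite mulnC.
Qed.

(** Signed sum over the choices of one entry, which is moved to the front. *)
Definition picksum (V : lmodType F) (U : X -> seq X -> V) : seq X -> V :=
  splitsum (fun m c => if m is [:: x] then U x c else 0).

Lemma splitsum_nilL (V : lmodType F) (T : seq X -> V) s :
  splitsum (fun a b => if a is [::] then T b else 0) s = T s.
Proof.
elim: s T => [//|x s IHs] T /=.
rewrite splitsum0 // add0r -[RHS](IHs (fun b => T (x :: b))).
by apply: eq_splitsum => -[|y a] b _; rewrite ?scaler0 // expr0 scale1r.
Qed.

Lemma picksum_cons (V : lmodType F) (U : X -> seq X -> V) x s :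
  picksum U (x :: s) = U x s - picksum (fun y c => U y (x :: c)) s.
Proof.
rewrite /picksum /= -[U x s](splitsum_nilL (U x)) -scaleN1r -splitsumZ.
congr (_ + _); apply: eq_splitsum => -[|y [|z a]] b _ //; rewrite ?scaler0 //=.
Qed.

Lemma eq_picksum_wt (V : lmodType F) (L : nmodType) (w : X -> L)
    (U U' : X -> seq X -> V) s :
  (forall x c, w x + \sum_(i <- c) w i = \sum_(i <- s) w i -> U x c = U' x c) ->
  picksum U s = picksum U' s.
Proof.
move=> eqU; apply: (@eq_splitsum_wt V L w) => -[|x [|y a]] b //.
by rewrite big_seq1; exact: eqU.
Qed.

Lemma eq_picksum (V : lmodType F) (U U' : X -> seq X -> V) s :
  (forall x c, U x c = U' x c) -> picksum U s = picksum U' s.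
Proof. by move=> eqU; apply: eq_splitsum => -[|x [|y a]] b. Qed.

Lemma picksumZ (V : lmodType F) k (U : X -> seq X -> V) s :
  picksum (fun x c => k *: U x c) s = k *: picksum U s.
Proof.
by rewrite -splitsumZ; apply: eq_splitsum => -[|x [|y a]] b _; rewrite ?scaler0.
Qed.

Lemma picksumD (V : lmodType F) (U U' : X -> seq X -> V) s :
  picksum (fun x c => U x c + U' x c) s = picksum U s + picksum U' s.
Proof.
by rewrite -splitsumD; apply: eq_splitsum => -[|x [|y a]] b _; rewrite ?addr0.
Qed.

Lemma picksum_linear (V W : lmodType F) (h : V -> W) U s :
  linear h -> h (picksum U s) = picksum (fun x c => h (U x c)) s.
Proof.
move=> hl; rewrite (splitsum_linear _ _ hl).
by apply: eq_splitsum => -[|x [|y a]] b _ //; exact: lin0.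
Qed.

Lemma splitsum_picksum (V : lmodType F) (T : X -> seq X -> seq X -> V) s :
  splitsum (fun e d => picksum (fun x a => T x a d) e) s =
  picksum (fun x => splitsum (T x)) s.
Proof.
rewrite (splitsumA (fun m a d => if m is [:: x] then T x a d else 0)).
by apply: eq_splitsum => -[|x [|y a]] b _ //; exact: splitsum0.
Qed.

Lemma splitsum_picksumC (V : lmodType F) (T : seq X -> X -> seq X -> V) s :
  splitsum (fun a => picksum (T a)) s =
  picksum (fun x => splitsum (fun a c => (-1) ^+ size a *: T a x c)) s.
Proof.
rewrite splitsumCA; apply: eq_splitsum => -[|x [|y a]] b _.
- by apply: splitsum0 => *; rewrite scaler0.
- by apply: eq_splitsum => c d _; rewrite muln1.
- by apply: splitsum0 => *; rewrite scaler0.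
Qed.

Lemma picksumC (V : lmodType F) (U : X -> X -> seq X -> V) s :
  picksum (fun x => picksum (U x)) s =
  - picksum (fun y => picksum (fun x => U x y)) s.
Proof.
pose T m m' c := if m is [:: x] then if m' is [:: y] then U x y c else 0 else 0.
have E (U' : X -> X -> seq X -> V) : picksum (fun x => picksum (U' x)) s =
    splitsum (fun m => splitsum (fun m' c =>
      if m is [:: x] then if m' is [:: y] then U' x y c else 0 else 0)) s.
  by apply: eq_splitsum => -[|x [|y a]] b _ //; rewrite splitsum0.
rewrite !E splitsumCA -scaleN1r -splitsumZ; apply: eq_splitsum => b d _.
rewrite -splitsumZ; apply: eq_splitsum => a c _.
by case: a b => [|x [|? ?]] [|y [|? ?]]; rewrite ?scaler0 ?muln1 ?expr1.
Qed.

Lemma picksum_closed (V : lmodType F) (L : nmodType) (w : X -> L) (Z : V -> Prop)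
    (U : X -> seq X -> V) (s : seq X) :
    (forall c u v, Z u -> Z v -> Z (c *: u + v)) -> Z 0 ->
    (forall x c, w x + \sum_(i <- c) w i = \sum_(i <- s) w i -> Z (U x c)) ->
  Z (picksum U s).
Proof.
move=> ZL Z0 ZU; apply: (@splitsum_closed _ _ w) => // -[|x [|y a]] b //.
by rewrite big_seq1; exact: ZU.
Qed.

End Split.

Section Entries.
Variables (F : fieldType) (L : nmodType) (W V : lmodType F).
Implicit Type T : seq (L * W) -> seq (L * W) -> V.

Lemma splitsum_entry_linear T s1 l s2 :
    (forall a1 a2 b, linear (fun x => T (a1 ++ (l, x) :: a2) b)) ->
    (forall a b1 b2, linear (fun x => T a (b1 ++ (l, x) :: b2))) ->
  linear (fun x => splitsum T (s1 ++ (l, x) :: s2)).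
Proof.
elim: s1 T => [|z s1 IHs] T Tl Tr k x y /=.
  rewrite (eq_splitsum (T' := fun a b =>
    k *: T ((l, x) :: a) b + T ((l, y) :: a) b)); last first.
    by move=> a b _; apply: (Tl [::]).
  rewrite [X in _ + X](eq_splitsum (T' := fun a b =>
    k *: ((-1) ^+ size a *: T a ((l, x) :: b)) + (-1) ^+ size a *: T a ((l, y) :: b))).
    by rewrite !splitsum_lin scalerDr addrACA.
  by move=> a b _; rewrite (Tr a [::]) scalerDr !scalerA mulrC.
rewrite (IHs (fun a b => T (z :: a) b)) ?IHs; last first.
- by move=> a b1 b2; exact: Tr.
- by move=> a1 a2 b; exact: (Tl (z :: a1)).
- move=> a b1 b2 c u v.
  by rewrite (Tr a (z :: b1)) scalerDr !scalerA mulrC.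
- by move=> a1 a2 b c u v; rewrite !size_cat /= Tl scalerDr !scalerA mulrC.
by rewrite scalerDr addrACA.
Qed.

Lemma splitsum_entry_closed T (Z : V -> Prop) s1 l x s2 :
    (forall c u v, Z u -> Z v -> Z (c *: u + v)) -> Z 0 ->
    (forall a1 a2 b, \sum_(i <- a1 ++ (l, x) :: a2) i.1 + \sum_(i <- b) i.1 =
        \sum_(i <- s1 ++ (l, x) :: s2) i.1 -> Z (T (a1 ++ (l, x) :: a2) b)) ->
    (forall a b1 b2, \sum_(i <- a) i.1 + \sum_(i <- b1 ++ (l, x) :: b2) i.1 =
        \sum_(i <- s1 ++ (l, x) :: s2) i.1 -> Z (T a (b1 ++ (l, x) :: b2))) ->
  Z (splitsum T (s1 ++ (l, x) :: s2)).
Proof.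
move=> ZL Z0.
have ZD u v : Z u -> Z v -> Z (u + v) by move=> *; rewrite -[u]scale1r; exact: ZL.
have ZZ c u : Z u -> Z (c *: u) by move=> Zu; rewrite -[_ *: _]addr0; exact: ZL.
elim: s1 T => [|z s1 IHs] T Tl Tr /=.
  apply: ZD; apply: (@splitsum_closed _ _ _ L fst) => // a b ab; last apply: ZZ.
    by apply: (Tl [::]); rewrite /= !big_cons -addrA ab.
  by apply: (Tr _ [::]); rewrite /= !big_cons addrCA ab.
apply: ZD; apply: IHs => [a1 a2 b ab|a b1 b2 ab]; try apply: ZZ.
- by apply: (Tl (z :: a1)); rewrite /= !big_cons -ab addrA.
- by apply: Tr; rewrite /= !big_cons -ab addrA.
- by apply: Tl; rewrite /= !big_cons -ab addrCA.
- by apply: (Tr _ (z :: b1)); rewrite /= !big_cons -ab addrCA.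
Qed.

Lemma splitsum_entry_morph T (h : V -> V) (k : W -> W) s1 l x s2 : linear h ->
    (forall a1 a2 b, T (a1 ++ (l, k x) :: a2) b = h (T (a1 ++ (l, x) :: a2) b)) ->
    (forall a b1 b2, T a (b1 ++ (l, k x) :: b2) = h (T a (b1 ++ (l, x) :: b2))) ->
  splitsum T (s1 ++ (l, k x) :: s2) = h (splitsum T (s1 ++ (l, x) :: s2)).
Proof.
move=> hl; rewrite splitsum_linear //.
have hZ := linZ hl.
elim: s1 T => [|z s1 IHs] T Tl Tr /=.
  congr (_ + _); apply: eq_splitsum => a b _; first exact: (Tl [::]).
  by rewrite (Tr a [::]).
congr (_ + _); rewrite IHs //.
- by move=> a1 a2 b; exact: (Tl (z :: a1)).
- by apply: eq_splitsum => a b _; rewrite hZ.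
- by move=> a1 a2 b; rewrite !size_cat /= hZ Tl.
- by move=> a b1 b2; rewrite hZ (Tr a (z :: b1)).
Qed.

End Entries.

(** * The graded Lie algebra of a weighted Lie algebra and its module *)

(** Lie algebra and module graded by weights, presented before a quotient is
    taken: an element of weight [l] is meant modulo [wnulla l] (or [wnullb l]).
    The Jacobi and representation identities are strict, so that they apply
    inside any expression; skew-symmetry only holds up to null elements.  The
    operations [wmula] and [wmulb] stand for the multiplications by the
    variables. *)
Record weightedLie (F : fieldType) (L : nmodType) (Va Vb : lmodType F)
    (I : Type) := WeightedLie {
  wbr : L -> Va -> Va -> Va;
  wact : L -> Va -> Vb -> Vb;
  wnulla : L -> Va -> Prop;
  wnullb : L -> Vb -> Prop;
  wmula : I -> Va -> Va;
  wmulb : I -> Vb -> Vb;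
  wbr_linl : forall l y, linear (fun x => wbr l x y);
  wbr_linr : forall l x, linear (wbr l x);
  wact_linl : forall l m, linear (fun x => wact l x m);
  wact_linr : forall l x, linear (wact l x);
  wmula_lin : forall i, linear (wmula i);
  wbr_mull : forall i l x y, wbr l (wmula i x) y = wmula i (wbr l x y);
  wbr_mulr : forall i l x y, wbr l x (wmula i y) = wmula i (wbr l x y);
  wact_mull : forall i l x m, wact l (wmula i x) m = wmulb i (wact l x m);
  wact_mulr : forall i l x m, wact l x (wmulb i m) = wmulb i (wact l x m);
  wnull0 : forall l, wnulla l 0;
  wnullP : forall l c x y, wnulla l x -> wnulla l y -> wnulla l (c *: x + y);
  wbr_jacobi : forall l k x y z,
    wbr l x (wbr k y z) = wbr (l + k) (wbr l x y) z + wbr k y (wbr l x z);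
  wact_comm : forall l k x y m,
    wact (l + k) (wbr l x y) m = wact l x (wact k y m) - wact k y (wact l x m);
  wbr_skew : forall l k x y, wnulla (l + k) (wbr l x y + wbr k y x);
  wbr_nulll : forall l x y, wnulla l x -> wbr l x y = 0;
  wbr_nullr : forall l k x y, wnulla k y -> wnulla (l + k) (wbr l x y);
  wact_nulll : forall l x m, wnulla l x -> wact l x m = 0;
  wact_nullr : forall l k x m, wnullb k m -> wnullb (l + k) (wact l x m)
}.

Section Controlling.
Variables (F : fieldType) (L : nmodType) (Va Vb : lmodType F) (I : Type).
Variable S : weightedLie L Va Vb I.
Local Notation entry := (L * Vb)%type.
Implicit Types (s : seq entry) (x y : entry) (f g h : seq entry -> Va).

Definition weight s : L := \sum_(e <- s) e.1.

Lemma weight_cons x s : weight (x :: s) = x.1 + weight s.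
Proof. exact: big_cons. Qed.

Lemma weight_cat s1 s2 : weight (s1 ++ s2) = weight s1 + weight s2.
Proof. exact: big_cat. Qed.

Definition eqmod l (u v : Va) := wnulla S l (u - v).

Lemma eqmod_refl l u : eqmod l u u.
Proof. by rewrite /eqmod subrr; exact: wnull0. Qed.

Lemma eqmod_sym l u v : eqmod l u v -> eqmod l v u.
Proof.
move=> uv; rewrite /eqmod -opprB -scaleN1r -[_ *: _]addr0.
exact: wnullP (wnull0 _ _).
Qed.

Lemma eqmodP l c u v u' v' :
  eqmod l u v -> eqmod l u' v' -> eqmod l (c *: u + u') (c *: v + v').
Proof.
move=> uv uv'; rewrite /eqmod.
have -> : c *: u + u' - (c *: v + v') = c *: (u - v) + (u' - v') by lincomb F Va.
exact: wnullP.
Qed.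

Lemma eqmodD l u v u' v' :
  eqmod l u v -> eqmod l u' v' -> eqmod l (u + u') (v + v').
Proof. by move=> uv uv'; rewrite -[u]scale1r -[v]scale1r; exact: eqmodP. Qed.

Lemma eqmodZ l c u v : eqmod l u v -> eqmod l (c *: u) (c *: v).
Proof.
by move=> uv; rewrite -[c *: u]addr0 -[c *: v]addr0; apply: eqmodP (eqmod_refl _ _).
Qed.

Lemma eqmodN l u v : eqmod l u v -> eqmod l (- u) (- v).
Proof. by move=> uv; rewrite -!scaleN1r; exact: eqmodZ. Qed.

Lemma eqmod_trans l v u w : eqmod l u v -> eqmod l v w -> eqmod l u w.
Proof. by move=> uv vw; have := wnullP 1 uv vw; rewrite scale1r subrKA. Qed.

Lemma eqmod_splitsum l T T' s :
  (forall a b, weight a + weight b = weight s -> eqmod l (T a b) (T' a b)) ->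
  eqmod l (splitsum T s) (splitsum T' s).
Proof.
move=> TT'; rewrite /eqmod -scaleN1r -splitsumZ -splitsumD.
apply: (@splitsum_closed _ _ _ L fst) => [c u v||a b ab].
- exact: wnullP.
- exact: wnull0.
- by rewrite scaleN1r; exact: TT'.
Qed.

Lemma eqmod_picksum l U U' s :
  (forall x c, x.1 + weight c = weight s -> eqmod l (U x c) (U' x c)) ->
  eqmod l (picksum U s) (picksum U' s).
Proof.
move=> UU'; rewrite /eqmod -scaleN1r -picksumZ -picksumD.
apply: (@picksum_closed _ _ _ L fst) => [c u v||x c xc].
- exact: wnullP.
- exact: wnull0.
- by rewrite scaleN1r; exact: UU'.
Qed.

(** Alternating maps on weighted arguments.  The condition [mm_null], which says
    that the map descends to the quotients, together with [mm_mul], is the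
    sesquilinearity of cochains. *)
Record multimap (p : nat) f : Prop := MultiMap {
  mm_size : forall s, size s != p -> f s = 0;
  mm_linear : forall s1 l s2, linear (fun v => f (s1 ++ (l, v) :: s2));
  mm_swap : forall s1 x y s2,
    eqmod (weight (s1 ++ x :: y :: s2)) (f (s1 ++ x :: y :: s2))
          (- f (s1 ++ y :: x :: s2));
  mm_null : forall s1 l v s2, wnullb S l v ->
    wnulla S (weight (s1 ++ (l, v) :: s2)) (f (s1 ++ (l, v) :: s2));
  mm_mul : forall i s1 l v s2,
    f (s1 ++ (l, wmulb S i v) :: s2) = wmula S i (f (s1 ++ (l, v) :: s2))
}.

(** The argument rho(v)_l x, attached to the sum of the weights. *)
Definition actat (l : L) (v : Va) (x : entry) : entry := (l + x.1, wact S l v x.2).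

(** The first two sums of the bracket of the theorem have this form. *)
Definition ins f g : seq entry -> Va :=
  splitsum (fun a => picksum (fun x c => f (actat (weight a) (g a) x :: c))).

(** The third sum of the bracket of the theorem. *)
Definition brk f g : seq entry -> Va :=
  splitsum (fun a b => wbr S (weight a) (f a) (g b)).

Definition ctl (p q : nat) f g s : Va :=
  - ins f g s + (-1) ^+ (p * q) *: ins g f s - (-1) ^+ (p * q) *: brk f g s.

Lemma mm_actat p f l x c : multimap p f -> linear (fun v => f (actat l v x :: c)).
Proof.
move=> fm k u v; rewrite /actat wact_linl.
exact: (mm_linear fm [::]).
Qed.

Lemma mm_ins_lin p f l phi d : multimap p f ->
  linear (fun v => picksum (fun x c => f (actat l v (phi x) :: c)) d).
Proof.
move=> fm k u v; rewrite -picksumZ -picksumD; apply: eq_picksum => x c.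
exact: (mm_actat l _ c fm).
Qed.

Lemma mm_ins_lin2 p f l k u d : multimap p f ->
  linear (fun v => picksum (fun x c => f (actat l u (actat k v x) :: c)) d).
Proof.
move=> fm e v w; rewrite -picksumZ -picksumD; apply: eq_picksum => x c.
rewrite /actat /= wact_linl wact_linr; exact: (mm_linear fm [::]).
Qed.

Definition supported (p : nat) f := forall s, size s != p -> f s = 0.

(** The sign of the exchange of two blocks is constant where the term does not
    vanish, as [f] and [g] impose the sizes of the blocks. *)
Lemma sign_sizes p q f g (a b : seq entry) (V : lmodType F) (T : Va -> Va -> V) :
    supported p f -> supported q g -> T 0 (g b) = 0 -> T (f a) 0 = 0 ->
  (-1) ^+ (size a * size b) *: T (f a) (g b) = (-1) ^+ (p * q) *: T (f a) (g b).
Proof.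
move=> fs gs T0l T0r; have [->|np] := eqVneq (size a) p; last first.
  by rewrite fs // T0l !scaler0.
have [->//|nq] := eqVneq (size b) q.
by rewrite gs // T0r !scaler0.
Qed.

Section Identities.
Variables (p q r : nat) (f g h : seq entry -> Va).
Hypotheses (fm : multimap p f) (gm : multimap q g) (hm : multimap r h).

(** Two values act on the same argument: f(rho(g) rho(h) x, ...). *)
Definition insact : seq entry -> Va :=
  splitsum (fun a => splitsum (fun b => picksum (fun x c =>
    f (actat (weight a) (g a) (actat (weight b) (h b) x) :: c)))).

(** The values act on different arguments: f(rho(h) x, rho(g) y, ...). *)
Definition insins : seq entry -> Va :=
  splitsum (fun b => splitsum (fun a => picksum (fun x => picksum (fun y c =>
    f (actat (weight b) (h b) x :: actat (weight a) (g a) y :: c))))).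

(** Leibniz rule: the additional argument [X] becomes an argument of [g], or the
    argument on which [g] acts, or a later argument of [f]. *)
Lemma ins_cons X s :
  ins f g (X :: s) =
    splitsum (fun a => picksum (fun y c =>
      f (actat (X.1 + weight a) (g (X :: a)) y :: c))) s +
    splitsum (fun a c => (-1) ^+ size a *: f (actat (weight a) (g a) X :: c)) s -
    splitsum (fun a => picksum (fun y c =>
      (-1) ^+ size a *: f (actat (weight a) (g a) y :: X :: c))) s.
Proof.
rewrite /ins /= -addrA; congr (_ + _).
  by apply: eq_splitsum => a b _; rewrite weight_cons.
rewrite -[- splitsum _ _]scaleN1r -splitsumZ -splitsumD.
apply: eq_splitsum => a b _; rewrite picksum_cons scalerDr; congr (_ + _).
by rewrite scaleN1r scalerN -picksumZ.
Qed.

(** The pre-Lie type identity: a value of [h] that acts on the argument of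
    [ins f g] meets a later argument of [g], the argument on which [g] acts, or
    a later argument of [f]. *)
Lemma ins_insl s :
  eqmod (weight s) (ins (ins f g) h s)
    (ins f (ins g h) s + (-1) ^+ (q * r) *: insact s + insins s).
Proof.
pose Xh b x := actat (weight b) (h b) x.
have -> : ins f (ins g h) s = splitsum (fun b => picksum (fun x => splitsum (fun a =>
    picksum (fun y c => f (actat ((Xh b x).1 + weight a) (g (Xh b x :: a)) y :: c))))) s.
  transitivity (splitsum (fun A d => splitsum (fun b => picksum (fun x a =>
     picksum (fun y c => f (actat ((Xh b x).1 + weight a) (g (Xh b x :: a)) y :: c)) d)) A) s).
    apply: eq_splitsum => A d _.
    rewrite (splitsum_linear _ _ (mm_ins_lin (weight A) id d fm)).
    apply: (@eq_splitsum_wt _ _ _ L fst) => b e be.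
    rewrite (picksum_linear _ _ (mm_ins_lin (weight A) id d fm)).
    apply: (@eq_picksum_wt _ _ _ L fst) => x a xa.
    by rewrite /Xh /= /weight -be -xa addrA.
  rewrite splitsumA; apply: eq_splitsum => b D _.
  exact: splitsum_picksum.
have -> : (-1) ^+ (q * r) *: insact s = splitsum (fun b => picksum (fun x => splitsum
    (fun a c => (-1) ^+ size a *: f (actat (weight a) (g a) (Xh b x) :: c)))) s.
  rewrite /insact splitsumCA -splitsumZ; apply: eq_splitsum => b d _.
  rewrite -[RHS](splitsum_picksumC (fun a x c => f (actat (weight a) (g a) (Xh b x) :: c))).
  rewrite -splitsumZ; apply: eq_splitsum => a c _.
  pose T u v := picksum (fun x c => f (actat (weight a) u (actat (weight b) v x) :: c)) c.
  rewrite (@sign_sizes _ _ _ _ a b Va T (mm_size gm) (mm_size hm)).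
  - by rewrite signrZK.
  - exact: (lin0 (mm_ins_lin (weight a) (actat (weight b) (h b)) c fm)).
  - exact: (lin0 (mm_ins_lin2 (weight a) (weight b) (g a) c fm)).
have -> : insins s = splitsum (fun b => picksum (fun x => splitsum (fun a =>
    picksum (fun y c => (-1) ^+ size a *:
      f (Xh b x :: actat (weight a) (g a) y :: c))))) s.
  apply: eq_splitsum => b d _.
  rewrite (splitsum_picksumC (fun a x e => picksum (fun y c =>
    f (actat (weight b) (h b) x :: actat (weight a) (g a) y :: c)) e)).
  apply: eq_picksum => x e; apply: eq_splitsum => a d' _; exact/esym/picksumZ.
rewrite -!splitsumD; apply: eqmod_splitsum => b d bd.
rewrite -!picksumD; apply: eqmod_picksum => x d' xd.
rewrite ins_cons -[X in eqmod _ X _]addrA -[X in eqmod _ _ X]addrA.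
apply: eqmodD (eqmod_refl _ _) _; apply: eqmodD (eqmod_refl _ _) _.
rewrite -scaleN1r -splitsumZ; apply: eqmod_splitsum => a e ae.
rewrite -picksumZ; apply: eqmod_picksum => y c yc.
rewrite scaleN1r -scalerN; apply: eqmodZ.
have -> : weight s = weight (Xh b x :: actat (weight a) (g a) y :: c).
  by rewrite !weight_cons /= -bd -xd -ae -yc !addrA.
exact/eqmod_sym/(mm_swap fm [::]).
Qed.

(** The representation identity turns the action of a bracket of values into a
    commutator. *)
Lemma ins_brk s : ins f (brk g h) s = splitsum (fun a => splitsum (fun b =>
    picksum (fun x c => f (actat (weight a) (g a) (actat (weight b) (h b) x) :: c) -
      f (actat (weight b) (h b) (actat (weight a) (g a) x) :: c)))) s.
Proof.
transitivity (splitsum (fun A d => splitsum (fun a b => picksum (fun x c =>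
    f (actat (weight a + weight b) (wbr S (weight a) (g a) (h b)) x :: c)) d) A) s).
  apply: eq_splitsum => A d _.
  rewrite (splitsum_linear _ _ (mm_ins_lin (weight A) id d fm)).
  apply: (@eq_splitsum_wt _ _ _ L fst) => a b ab; apply: eq_picksum => x c.
  by rewrite /weight ab.
rewrite splitsumA; apply: eq_splitsum => a D _; apply: eq_splitsum => b d _.
apply: eq_picksum => x c.
rewrite /actat /= wact_comm addrA [weight b + _]addrCA addrA.
exact: (linB (mm_linear fm [::] (weight a + weight b + x.1) c)).
Qed.

End Identities.

Section MoreIdentities.
Variables (p q r : nat) (f g h : seq entry -> Va).
Hypotheses (fm : multimap p f) (gm : multimap q g) (hm : multimap r h).

(** Exchanging the blocks of [g] and [h] costs the sign of [q * r]; the signs of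
    the exchange of [x] with [y] and of the first two arguments of [f] cancel. *)
Lemma insins_sym s :
  eqmod (weight s) (insins f h g s) ((-1) ^+ (q * r) *: insins f g h s).
Proof.
rewrite {1}/insins splitsumCA -splitsumZ; apply: eqmod_splitsum => b d bd.
rewrite -splitsumZ; apply: eqmod_splitsum => a d' ad.
rewrite picksumC -scaleN1r -!picksumZ; apply: eqmod_picksum => x e xe.
rewrite -!picksumZ; apply: eqmod_picksum => y c yc.
pose T u v := f (actat (weight a) u y :: actat (weight b) v x :: c).
rewrite scalerA mulrC -scalerA (@sign_sizes _ _ _ _ a b Va T (mm_size gm) (mm_size hm)).
- rewrite scalerA mulrC -scalerA scaleN1r; apply: eqmodZ.
  have -> : weight s = weight (actat (weight b) (h b) x :: actat (weight a) (g a) y :: c).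
    by rewrite !weight_cons /= -bd -ad -xe -yc -!addrA; congr (_ + _); rewrite addrCA.
  apply/eqmod_sym; exact: (mm_swap fm [::]).
- exact: (lin0 (mm_actat (weight a) y (actat (weight b) (h b) x :: c) fm)).
- rewrite /T /actat (lin0 (wact_linl S _ _)).
  exact: (lin0 (mm_linear fm [:: _] (weight b + x.1) c)).
Qed.

(** The commutator of the two actions, where exchanging [g] and [h] costs the
    sign of the exchange of their blocks. *)
Lemma ins_brk_insact s :
  ins f (brk g h) s = insact f g h s - (-1) ^+ (q * r) *: insact f h g s.
Proof.
rewrite (ins_brk g h fm) /insact [in X in _ - X]splitsumCA -scaleN1r -!splitsumZ -splitsumD.
apply: eq_splitsum => a d _; rewrite -!splitsumZ -splitsumD.
apply: eq_splitsum => b e _; rewrite picksumD; congr (_ + _).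
pose T u v := picksum (fun x c => f (actat (weight b) v (actat (weight a) u x) :: c)) e.
rewrite [(size b * _)%N]mulnC (@sign_sizes _ _ _ _ a b Va T (mm_size gm) (mm_size hm)).
- rewrite signrZK /T -picksumZ.
  by apply: eq_picksum => x c; rewrite scaleN1r.
- exact: (lin0 (mm_ins_lin2 (weight b) (weight a) (h b) e fm)).
- exact: (lin0 (mm_ins_lin (weight b) (actat (weight a) (g a)) e fm)).
Qed.

(** Insertion is a graded derivation of the bracket of values. *)
Lemma brk_ins s :
  ins (brk g h) f s = brk (ins g f) h s + (-1) ^+ (p * q) *: brk g (ins h f) s.
Proof.
pose X a x := actat (weight a) (f a) x.
have -> : brk (ins g f) h s = splitsum (fun a => picksum (fun x => splitsum (fun b c =>
    wbr S ((X a x).1 + weight b) (g (X a x :: b)) (h c)))) s.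
  transitivity (splitsum (fun B c => splitsum (fun a => picksum (fun x b =>
      wbr S ((X a x).1 + weight b) (g (X a x :: b)) (h c))) B) s).
    apply: eq_splitsum => B c _.
    rewrite (splitsum_linear _ _ (wbr_linl S (weight B) (h c))).
    apply: (@eq_splitsum_wt _ _ _ L fst) => a e ae.
    rewrite (picksum_linear _ _ (wbr_linl S (weight B) (h c))).
    apply: (@eq_picksum_wt _ _ _ L fst) => x b xb.
    by rewrite /X /= /weight -ae -xb addrA.
  rewrite splitsumA; apply: eq_splitsum => a D _; exact: splitsum_picksum.
have -> : (-1) ^+ (p * q) *: brk g (ins h f) s =
    splitsum (fun a => picksum (fun x => splitsum (fun b c =>
      (-1) ^+ size b *: wbr S (weight b) (g b) (h (X a x :: c))))) s.
  transitivity ((-1) ^+ (p * q) *: splitsum (fun b => splitsum (fun a => picksum (fun x c =>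
      wbr S (weight b) (g b) (h (X a x :: c))))) s).
    congr (_ *: _); apply: eq_splitsum => b d _.
    rewrite (splitsum_linear _ _ (wbr_linr S (weight b) (g b))).
    apply: eq_splitsum => a e _.
    by rewrite (picksum_linear _ _ (wbr_linr S (weight b) (g b))).
  rewrite splitsumCA -splitsumZ; apply: eq_splitsum => a d _.
  rewrite -[RHS](splitsum_picksumC (fun b x c => wbr S (weight b) (g b) (h (X a x :: c)))).
  rewrite -splitsumZ; apply: eq_splitsum => b e _.
  pose T u v := picksum (fun x c => wbr S (weight b) v (h (actat (weight a) u x :: c))) e.
  rewrite [(size b * _)%N]mulnC (@sign_sizes _ _ _ _ a b Va T (mm_size fm) (mm_size gm)).
  - by rewrite signrZK.
  - apply: splitsum0 => -[|x [|? ?]] c //.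
    by rewrite (lin0 (mm_actat (weight a) x c hm)) (lin0 (wbr_linr S _ _)).
  - apply: splitsum0 => -[|x [|? ?]] c //.
    by rewrite (lin0 (wbr_linl S _ _)).
rewrite -splitsumD; apply: eq_splitsum => a d _; rewrite -picksumD.
apply: eq_picksum => x d'; rewrite {1}/brk /=; congr (_ + _).
by apply: eq_splitsum => b c _; rewrite weight_cons.
Qed.

Lemma brk_jacobi s :
  brk f (brk g h) s = brk (brk f g) h s + (-1) ^+ (p * q) *: brk g (brk f h) s.
Proof.
have -> : brk f (brk g h) s = splitsum (fun a => splitsum (fun b c =>
    wbr S (weight a) (f a) (wbr S (weight b) (g b) (h c)))) s.
  by apply: eq_splitsum => a d _; rewrite (splitsum_linear _ _ (wbr_linr S _ _)).
have -> : brk (brk f g) h s = splitsum (fun a => splitsum (fun b c =>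
    wbr S (weight a + weight b) (wbr S (weight a) (f a) (g b)) (h c))) s.
  rewrite -splitsumA; apply: eq_splitsum => d c _.
  rewrite (splitsum_linear _ _ (wbr_linl S (weight d) (h c))).
  by apply: (@eq_splitsum_wt _ _ _ L fst) => a b ab; rewrite /weight ab.
have -> : brk g (brk f h) s = splitsum (fun b => splitsum (fun a c =>
    wbr S (weight b) (g b) (wbr S (weight a) (f a) (h c)))) s.
  by apply: eq_splitsum => a d _; rewrite (splitsum_linear _ _ (wbr_linr S _ _)).
rewrite [in X in _ + X]splitsumCA -splitsumZ -splitsumD; apply: eq_splitsum => a d _.
rewrite -splitsumZ -splitsumD; apply: eq_splitsum => b c _.
rewrite wbr_jacobi; congr (_ + _).
pose T u v := wbr S (weight b) v (wbr S (weight a) u (h c)).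
rewrite [(size b * _)%N]mulnC (@sign_sizes _ _ _ _ a b Va T (mm_size fm) (mm_size gm)).
- by rewrite signrZK.
- by rewrite /T (lin0 (wbr_linl S _ _)) (lin0 (wbr_linr S _ _)).
- exact: (lin0 (wbr_linl S _ _)).
Qed.

End MoreIdentities.

Lemma brk_skew p q f g s : supported p f -> supported q g ->
  eqmod (weight s) (brk g f s) (- ((-1) ^+ (p * q) *: brk f g s)).
Proof.
move=> fs gs; rewrite /brk splitsumC -scalerN -scaleN1r -!splitsumZ.
apply: eqmod_splitsum => a b ab; pose T u v := wbr S (weight b) v u.
rewrite (@sign_sizes _ _ _ _ a b Va T fs gs).
- rewrite scaleN1r; apply: eqmodZ; rewrite /eqmod opprK -ab addrC; exact: wbr_skew.
- exact: (lin0 (wbr_linr S _ _)).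
- exact: (lin0 (wbr_linl S _ _)).
Qed.

Lemma supported_ins p q f g :
  supported p f -> supported q g -> (forall l x c, f (actat l 0 x :: c) = 0) ->
  supported (p + q) (ins f g).
Proof.
move=> fs gs f0 s; apply: contraNeq => nz; apply: contraR nz => ne; apply/eqP.
transitivity (splitsum (fun _ _ : seq entry => 0 : Va) s); last exact: splitsum0.
apply: eq_splitsum => a d ad.
transitivity (picksum (fun _ _ => 0 : Va) d); last by apply: splitsum0 => -[|? []].
have [aq|/gs->] := eqVneq (size a) q; last exact: eq_picksum.
apply: (@eq_picksum_wt _ _ _ nat (fun=> 1%N)) => x c xc.
apply: fs; apply: contraNneq ne => <-; rewrite -ad aq addnC eqn_add2r /=.
have : (1 + \sum_(i <- c) 1 = \sum_(i <- d) 1)%N := xc.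
by rewrite !sum1_size add1n => ->.
Qed.

Lemma supported_brk p q f g :
  supported p f -> supported q g -> supported (p + q) (brk f g).
Proof.
move=> fs gs s ne.
transitivity (splitsum (fun _ _ : seq entry => 0 : Va) s); last exact: splitsum0.
apply: eq_splitsum => a b ab.
have [ap|/fs->] := eqVneq (size a) p; last exact: (lin0 (wbr_linl S _ _)).
have [bq|/gs->] := eqVneq (size b) q; last exact: (lin0 (wbr_linr S _ _)).
by rewrite -ab ap bq eqxx in ne.
Qed.

Lemma multimap_lin p c f g :
  multimap p f -> multimap p g -> multimap p (fun s => c *: f s + g s).
Proof.
move=> fm gm; split=> [s ne|s1 l s2 k u v|s1 x y s2|s1 l v s2 Zv|i s1 l v s2].
- by rewrite (mm_size fm) // (mm_size gm) // scaler0 addr0.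
- by rewrite (mm_linear fm) (mm_linear gm); lincomb F Va.
- rewrite opprD -scalerN; apply: eqmodP; [exact: (mm_swap fm)|exact: (mm_swap gm)].
- by apply: wnullP; [exact: (mm_null fm)|exact: (mm_null gm)].
- by rewrite (mm_mul fm) (mm_mul gm) -(wmula_lin S).
Qed.

Lemma multimap0 p : multimap p (fun=> 0).
Proof.
split=> [//|s1 l s2 k u v|s1 x y s2|s1 l v s2 _|i s1 l v s2].
- by rewrite scaler0 addr0.
- by rewrite oppr0; exact: eqmod_refl.
- exact: wnull0.
- by rewrite (lin0 (wmula_lin S i)).
Qed.

Lemma eq_multimap p f g : f =1 g -> multimap p f -> multimap p g.
Proof.
move=> fg fm; split=> [s ne|s1 l s2 k u v|s1 x y s2|s1 l v s2 Zv|i s1 l v s2]; rewrite -!fg.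
- exact: (mm_size fm).
- exact: (mm_linear fm).
- exact: (mm_swap fm).
- exact: (mm_null fm).
- exact: (mm_mul fm).
Qed.

Lemma wnullZ l c u : wnulla S l u -> wnulla S l (c *: u).
Proof. by move=> uZ; rewrite -[c *: u]addr0; apply: wnullP (wnull0 _ _). Qed.

Lemma multimap_swapP f s1 x y s2 :
  wnulla S (weight (s1 ++ x :: y :: s2)) (f (s1 ++ x :: y :: s2) + f (s1 ++ y :: x :: s2)) <->
  eqmod (weight (s1 ++ x :: y :: s2)) (f (s1 ++ x :: y :: s2)) (- f (s1 ++ y :: x :: s2)).
Proof. by rewrite /eqmod opprK. Qed.

Lemma multimap_brk p q f g : multimap p f -> multimap q g -> multimap (p + q) (brk f g).
Proof.
move=> fm gm; split.
- exact: supported_brk (mm_size fm) (mm_size gm).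
- move=> s1 l s2; apply: splitsum_entry_linear => [a1 a2 b k u v|a b1 b2 k u v].
    by rewrite (mm_linear fm) !weight_cat !weight_cons; exact: wbr_linl.
  by rewrite (mm_linear gm); exact: wbr_linr.
- move=> s1 x y s2; apply/multimap_swapP; apply: (@splitsum_swap _ _ _ L fst).
  + exact: wnull0.
  + by move=> c u v; exact: wnullP.
  + move=> a1 z t a2 b ab; rewrite -/(weight _) in ab.
    have -> : weight (a1 ++ t :: z :: a2) = weight (a1 ++ z :: t :: a2).
      by rewrite !weight_cat !weight_cons [t.1 + _]addrCA.
    rewrite -[wbr S _ (f (a1 ++ z :: _)) _]scale1r -(wbr_linl S) wbr_nulll; first exact: wnull0.
    by rewrite scale1r; apply/multimap_swapP/(mm_swap fm).
  + move=> a b1 z t b2 ab; rewrite -[weight (s1 ++ _)]ab.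
    rewrite -[wbr S _ _ (g (b1 ++ z :: _))]scale1r -(wbr_linr S).
    by apply: wbr_nullr; rewrite scale1r; apply/multimap_swapP/(mm_swap gm).
- move=> s1 l v s2 Zv; apply: splitsum_entry_closed.
  + by move=> c u w; exact: wnullP.
  + exact: wnull0.
  + move=> a1 a2 b _; rewrite wbr_nulll; [exact: wnull0|exact: (mm_null fm)].
  + by move=> a b1 b2 ab; rewrite -[weight (s1 ++ _)]ab; apply/wbr_nullr/(mm_null gm).
- move=> i s1 l v s2.
  apply: (@splitsum_entry_morph _ _ _ _ _ (wmula S i) (wmulb S i)).
  + exact: wmula_lin.
  + by move=> a1 a2 b; rewrite (mm_mul fm) wbr_mull !weight_cat !weight_cons.
  + by move=> a b1 b2; rewrite (mm_mul gm) wbr_mulr.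
Qed.

(** A swap, or a null argument, inside a block of [g] makes the value of [g] null,
    and null values act by zero; elsewhere the corresponding property of [f]
    applies. *)
Lemma multimap_ins p q f g : multimap p f -> multimap q g -> multimap (p + q) (ins f g).
Proof.
move=> fm gm.
have f0 l x c : f (actat l 0 x :: c) = 0 by exact: (lin0 (mm_actat l x c fm)).
split.
- exact: supported_ins (mm_size fm) (mm_size gm) f0.
- move=> s1 l s2; apply: splitsum_entry_linear => [a1 a2 d k u v|a d1 d2].
    rewrite (mm_linear gm) !weight_cat !weight_cons.
    exact: (mm_ins_lin _ id d fm).
  apply: splitsum_entry_linear => [m1 m2 b k u v|m b1 b2 k u v].
    case: m1 => [|z [|z' m1]] /=; rewrite ?scaler0 ?addr0 //.
    case: m2 => [|z m2]; rewrite ?scaler0 ?addr0 //.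
    by rewrite /actat /= (wact_linr S); exact: (mm_linear fm [::]).
  case: m => [|z [|z' m]]; rewrite ?scaler0 ?addr0 //.
  exact: (mm_linear fm (_ :: b1)).
- move=> s1 x y s2; apply/multimap_swapP; apply: (@splitsum_swap _ _ _ L fst).
  + exact: wnull0.
  + by move=> c u v; exact: wnullP.
  + move=> a1 z t a2 d _.
    have -> : weight (a1 ++ t :: z :: a2) = weight (a1 ++ z :: t :: a2).
      by rewrite !weight_cat !weight_cons [t.1 + _]addrCA.
    rewrite -picksumD; apply: (@picksum_closed _ _ _ L fst) => [c u v||e c _].
    * exact: wnullP.
    * exact: wnull0.
    * have /= := mm_actat (weight (a1 ++ z :: t :: a2)) e c fm 1 => fl.
      rewrite -[f _]scale1r -fl scale1r /actat wact_nulll; last first.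
        exact/multimap_swapP/(mm_swap gm).
      by rewrite (lin0 (mm_linear fm [::] _ c)); exact: wnull0.
  + move=> a d1 z t d2 ad; rewrite -[weight (s1 ++ _)]ad.
    apply: (@splitsum_swap _ _ _ L fst).
    * exact: wnull0.
    * by move=> c u v; exact: wnullP.
    * move=> [|? [|? ?]] ? ? ? ? _; rewrite addr0; exact: wnull0.
    * move=> [|e [|? ?]] c1 z' t' c2 ec; rewrite ?addr0; try exact: wnull0.
      rewrite -ec big_seq1 addrA -/(weight a).
      rewrite -[weight a + e.1]/((actat (weight a) (g a) e).1) -/(weight _) -weight_cons.
      exact/(multimap_swapP f (_ :: c1))/(mm_swap fm).
- move=> s1 l v s2 Zv; apply: splitsum_entry_closed.
  + by move=> c u w; exact: wnullP.
  + exact: wnull0.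
  + move=> a1 a2 d _.
    apply: (@picksum_closed _ _ _ L fst) => [c u w||e c _].
    * exact: wnullP.
    * exact: wnull0.
    * rewrite /actat wact_nulll; last exact: (mm_null gm).
      by rewrite (lin0 (mm_linear fm [::] _ c)); exact: wnull0.
  + move=> a d1 d2 ad; rewrite -[weight (s1 ++ _)]ad.
    apply: splitsum_entry_closed.
    * by move=> c u w; exact: wnullP.
    * exact: wnull0.
    * move=> [|? [|? ?]] m2 c mc /=; try exact: wnull0.
      case: m2 mc => [|? ?] mc; last exact: wnull0.
      rewrite -mc big_seq1 addrA -/(weight c).
      rewrite -(weight_cons (actat (weight a) (g a) (l, v))).
      by apply: (mm_null fm [::]); exact: wact_nullr.
    * move=> [|e [|? ?]] c1 c2 ec; try exact: wnull0.
      rewrite -ec big_seq1 addrA -/(weight a).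
      rewrite -[weight a + e.1]/((actat (weight a) (g a) e).1) -/(weight _) -weight_cons.
      exact: (mm_null fm (_ :: c1)).
- move=> i s1 l v s2.
  have wl := wmula_lin S i.
  apply: (@splitsum_entry_morph _ _ _ _ _ (wmula S i) (wmulb S i)) => // [a1 a2 d|a d1 d2].
    rewrite (picksum_linear _ _ wl); rewrite !weight_cat !weight_cons /=.
    apply: eq_picksum => x c; rewrite (mm_mul gm) /actat wact_mull.
    exact: (mm_mul fm i [::]).
  apply: (@splitsum_entry_morph _ _ _ _ _ (wmula S i) (wmulb S i)) => // [m1 m2 c|m c1 c2].
    case: m1 => [|? [|? ?]]; rewrite ?(lin0 wl) //.
    case: m2 => [|? ?]; rewrite ?(lin0 wl) //.
    by rewrite /actat /= wact_mulr; exact: (mm_mul fm i [::]).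
  case: m => [|e [|? ?]]; rewrite ?(lin0 wl) //.
  exact: (mm_mul fm i (_ :: c1)).
Qed.

Lemma multimap_ctl p q f g :
  multimap p f -> multimap q g -> multimap (p + q) (ctl p q f g).
Proof.
move=> fm gm; have [[fg gf] b] := (multimap_ins fm gm, multimap_ins gm fm, multimap_brk fm gm).
rewrite addnC in gf.
have m0 := multimap0 (p + q).
have := multimap_lin (-1) fg (multimap_lin ((-1) ^+ (p * q)) gf
  (multimap_lin (- (-1) ^+ (p * q)) b m0)).
by apply: eq_multimap => s; rewrite /ctl; lincomb F Va.
Qed.

Lemma eqmod_ins p f f' g g' s : multimap p f ->
  (forall s, eqmod (weight s) (f s) (f' s)) ->
  (forall s, eqmod (weight s) (g s) (g' s)) ->
  eqmod (weight s) (ins f g s) (ins f' g' s).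
Proof.
move=> fm ff' gg'; apply: eqmod_splitsum => a d ad; apply: eqmod_picksum => x c xc.
have -> : actat (weight a) (g a) x = actat (weight a) (g' a) x.
  rewrite /actat; congr pair; apply/eqP.
  by rewrite -subr_eq0 -(linB (wact_linl S _ _)) wact_nulll //; exact: gg'.
have -> : weight s = weight (actat (weight a) (g' a) x :: c).
  by rewrite weight_cons -ad -xc addrA.
exact: ff'.
Qed.

Lemma eqmod_brk f f' g g' s :
  (forall s, eqmod (weight s) (f s) (f' s)) ->
  (forall s, eqmod (weight s) (g s) (g' s)) ->
  eqmod (weight s) (brk f g s) (brk f' g' s).
Proof.
move=> ff' gg'; apply: eqmod_splitsum => a b <-.
have -> : wbr S (weight a) (f a) (g b) = wbr S (weight a) (f' a) (g b).
  by apply/eqP; rewrite -subr_eq0 -(linB (wbr_linl S _ _)) wbr_nulll //; exact: ff'.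
by rewrite /eqmod -(linB (wbr_linr S _ _)); apply/wbr_nullr/gg'.
Qed.

Lemma eqmod_ctl p q f f' g g' s : multimap p f -> multimap q g ->
  (forall s, eqmod (weight s) (f s) (f' s)) ->
  (forall s, eqmod (weight s) (g s) (g' s)) ->
  eqmod (weight s) (ctl p q f g s) (ctl p q f' g' s).
Proof.
move=> fm gm ff' gg'; rewrite /ctl; apply: eqmodD; first apply: eqmodD.
- apply: eqmodN; exact: (eqmod_ins s fm ff' gg').
- apply: eqmodZ; exact: (eqmod_ins s gm gg' ff').
- apply/eqmodN/eqmodZ; exact: eqmod_brk.
Qed.

Lemma ctl_skew p q f g s : supported p f -> supported q g ->
  eqmod (weight s) (ctl p q f g s) (- ((-1) ^+ (p * q) *: ctl q p g f s)).
Proof.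
move=> fs gs; rewrite /ctl [(q * p)%N]mulnC.
have := brk_skew s fs gs; rewrite /eqmod => nl.
rewrite -signr_odd in nl *.
case: (odd _) nl => /=; rewrite ?expr0 ?expr1 => /(wnullZ (-1)).
  congr (wnulla _ _ _); lincomb F Va.
congr (wnulla _ _ _); lincomb F Va.
Qed.

Section CtlLinear.
Variables (p q r : nat) (f g h : seq entry -> Va).
Hypothesis fm : multimap p f.
Local Notation e := ((-1) ^+ (q * r) : F).

Lemma linear_ctl (U : lmodType F) (k : Va -> U) s : linear k ->
  k (ctl q r g h s) =
    -1 *: k (ins g h s) + (e *: k (ins h g s) + (- e) *: k (brk g h s)).
Proof.
move=> kl; rewrite /ctl (linB kl) -scaleN1r kl !(linZ kl).
lincomb F U.
Qed.

Lemma ins_ctlr s : ins f (ctl q r g h) s =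
  -1 *: ins f (ins g h) s + (e *: ins f (ins h g) s + (- e) *: ins f (brk g h) s).
Proof.
rewrite /ins -[X in _ + (_ + X)]splitsumZ -!splitsum_lin.
apply: eq_splitsum => a d _; exact: (@linear_ctl Va (fun v => picksum (fun x c => f (actat (weight a) v x :: c)) d)
  a (mm_ins_lin (weight a) id d fm)).
Qed.

Lemma ins_ctll s : ins (ctl q r g h) f s =
  -1 *: ins (ins g h) f s + (e *: ins (ins h g) f s + (- e) *: ins (brk g h) f s).
Proof.
rewrite {1}/ins -!splitsumZ -!splitsumD; apply: eq_splitsum => a d _.
rewrite -!picksumZ -!picksumD; apply: eq_picksum => x c.
by apply: (@linear_ctl _ idfun) => k u v.
Qed.

Lemma brk_ctlr s : brk f (ctl q r g h) s =
  -1 *: brk f (ins g h) s + (e *: brk f (ins h g) s + (- e) *: brk f (brk g h) s).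
Proof.
rewrite /brk -[X in _ + (_ + X)]splitsumZ -!splitsum_lin.
apply: eq_splitsum => a d _; exact: (@linear_ctl _ _ d (wbr_linr S (weight a) (f a))).
Qed.

Lemma brk_ctll s : brk (ctl q r g h) f s =
  -1 *: brk (ins g h) f s + (e *: brk (ins h g) f s + (- e) *: brk (brk g h) f s).
Proof.
rewrite /brk -[X in _ + (_ + X)]splitsumZ -!splitsum_lin.
apply: eq_splitsum => a d _; exact: (@linear_ctl _ (fun v => wbr S (weight a) v (f d)) a (wbr_linl S (weight a) (f d))).
Qed.

End CtlLinear.

(** All terms fall into three families according to the outermost cochain of an
    insertion, where the defects of [ins_insl] cancel by [insins_sym] and
    [ins_brk_insact], and into brackets of values, which cancel by
    [brk_ins], [brk_jacobi] and one use of [brk_skew]. *)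
Lemma ctl_jacobi p q r f g h s : multimap p f -> multimap q g -> multimap r h ->
  eqmod (weight s) (ctl p (q + r) f (ctl q r g h) s)
    (ctl (p + q) r (ctl p q f g) h s +
     (-1) ^+ (p * q) *: ctl q (p + r) g (ctl p r f h) s).
Proof.
move=> fm gm hm.
have nf1 := ins_insl fm gm hm s; have nf2 := ins_insl fm hm gm s.
have ng1 := ins_insl gm fm hm s; have ng2 := ins_insl gm hm fm s.
have nh1 := ins_insl hm fm gm s; have nh2 := ins_insl hm gm fm s.
have nfS := insins_sym fm gm hm s.
have ngS := insins_sym gm fm hm s.
have nhS := insins_sym hm fm gm s.
have nb := brk_skew s (mm_size (multimap_ins fm hm)) (mm_size gm).
rewrite {1}/ctl [X in eqmod _ _ (X + _)]/ctl [X in eqmod _ _ (_ + _ *: X)]/ctl.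
rewrite (ins_ctlr _ _ _ _ fm) (ins_ctlr _ _ _ _ gm) (ins_ctlr _ _ _ _ hm).
rewrite !ins_ctll !brk_ctll !brk_ctlr.
rewrite (ins_brk_insact fm gm hm) (ins_brk_insact gm fm hm) (ins_brk_insact hm fm gm).
rewrite (brk_ins fm gm hm) (brk_ins gm fm hm) (brk_ins hm fm gm) (brk_jacobi h fm gm).
move: nf1 nf2 ng1 ng2 nh1 nh2 nfS ngS nhS nb; rewrite /eqmod.
rewrite !(mulnDl, mulnDr, exprD) ![(q * p)%N]mulnC ![(r * p)%N]mulnC ![(r * q)%N]mulnC.
set e1 := (-1) ^+ (p * q); set e2 := (-1) ^+ (q * r); set e3 := (-1) ^+ (p * r).
move=> nf1 nf2 ng1 ng2 nh1 nh2 nfS ngS nhS nb.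
(* The difference of the two sides as a combination of null elements: the
   coefficients of the instances of [ins_insl] are those of the composites
   [ins (ins _ _) _] in the difference, and they dictate the others. *)
have := wnullP (-1) nf1 (wnullP e2 nf2 (wnullP e2 nfS
  (wnullP e1 ng1 (wnullP (- (e1 * e3)) ng2 (wnullP (- (e1 * e3)) ngS
  (wnullP (- (e2 * e3)) nh1 (wnullP (e1 * e2 * e3) nh2 (wnullP (e1 * e2 * e3) nhS
  (wnullP (- e2) nb (wnull0 _ _)))))))))).
congr (wnulla _ _ _).
have sg n : (-1) ^+ n = 1 :> F \/ (-1) ^+ n = -1 :> F.
  by rewrite -signr_odd; case: (odd n); [right|left].
have [E1|E1] : e1 = 1 \/ e1 = -1 := sg _; rewrite E1;
  have [E2|E2] : e2 = 1 \/ e2 = -1 := sg _; rewrite E2;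
  have [E3|E3] : e3 = 1 \/ e3 = -1 := sg _; rewrite E3; lincomb F Va.
Qed.

End Controlling.

(** * Evaluation of polynomials with coefficients in a module *)

Section Polynomials.
Variables (F : fieldType) (n : nat) (N : lmodType F).
Implicit Types (P Q : lpoly n N) (m : {cmonom 'I_n}).

Lemma big_lmon (W : lmodType F) (h : {cmonom 'I_n} -> N -> W) m x :
  (forall m, linear (h m)) ->
  \sum_(m' <- msupp (lmon m x : lpoly n N)) h m' (lmon m x : lpoly n N)@_m' = h m x.
Proof.
move=> hl; have [->|x0] := eqVneq x 0.
  rewrite (lin0 (hl m)) big1 // => m' _.
  by rewrite lmonE; case: ifP => _; rewrite lin0.
have -> : msupp (lmon m x : lpoly n N) = [fset m]%fset.
  by rewrite lmon.unlock msuppU (negPf x0).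
by rewrite big_seq_fset1 lmonE eqxx.
Qed.

Lemma lvar_lmon i m x : lvar i (lmon m x : lpoly n N) = lmon (mmul m (ucm i)) x.
Proof.
rewrite /lvar (big_lmon (h := fun m' y => lmon (mmul m' (ucm i)) y)) // => m'.
exact: lmon_linear.
Qed.

Lemma lpolyE P : P = \sum_(m <- msupp P) lmon m P@_m.
Proof.
apply/malgP=> m; rewrite (big_morph (fun Q : lpoly n N => Q@_m) (id1 := 0) (op1 := +%R)).
- have [mP|mP] := boolP (m \in msupp P).
    rewrite (big_fsetD1 m) //= lmonE eqxx big_seq big1 ?addr0 // => m'.
    by rewrite in_fsetD1 => /andP[/negPf ne _]; rewrite lmonE ne.
  rewrite mcoeff_outdom // big_seq big1 // => m' m'P; rewrite lmonE.
  by case: eqP => // mm'; rewrite -mm' m'P in mP.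
- by move=> x y; rewrite mcoeffD.
- by rewrite mcoeff0.
Qed.

Lemma lpoly_ind (K : lpoly n N -> Prop) :
    (forall x, K (lconst x)) -> (forall P Q, K P -> K Q -> K (P + Q)) ->
    (forall i P, K P -> K (lvar i P)) ->
  forall P, K P.
Proof.
move=> Kc KD Kv P.
have K0 : K 0 by have := Kc 0; rewrite linear0.
rewrite [P]lpolyE; elim/big_ind: _ => // m _; move: P@_m => {P} x.
have [k] := ubnP (mdeg m); elim: k m => // k IHk m.
have [->|m1] := eqVneq m mone; first by move=> _; exact: Kc.
have [i mi] : exists i, m i != 0%N.
  apply/existsP; apply: contraNT m1 => /existsPn m0; apply/cmP => i.
  by rewrite cm1; apply/eqP; rewrite -[_ == _]negbK.
have -> : m = mmul (divcm m (ucm i)) (ucm i).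
  apply/eqP/cmP => j; rewrite mulcmE divcmE ucmE subnK //.
  by case: eqP => // <-; rewrite lt0n.
by rewrite mdegM mdegU addn1 ltnS => lek; rewrite -lvar_lmon; exact/Kv/IHk.
Qed.

Lemma lvarC i j P : lvar i (lvar j P) = lvar j (lvar i P).
Proof.
rewrite [P]lpolyE !linear_sum /=; apply: eq_bigr => m _.
by rewrite !lvar_lmon; congr lmon; apply/eqP/cmP => k; rewrite !cmM addnAC.
Qed.

Section Leval.
Variables (W : lmodType F) (T : 'I_n -> W -> W) (g : N -> W).
Hypotheses (Tl : forall i, linear (T i)) (gl : linear g).

Lemma leval_lmon m x : leval T g (lmon m x) =
  foldr (fun i => iter (m i) (T i)) (g x) (enum 'I_n).
Proof.
rewrite /leval (big_lmon
  (h := fun m y => foldr (fun i => iter (m i) (T i)) (g y) (enum 'I_n))) //.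
move=> m' c y z; elim: (enum 'I_n) => [|i s IHs] /=; first exact: gl.
by rewrite IHs; elim: (m' i) => [//|k IHk] /=; rewrite IHk Tl.
Qed.

Lemma leval_lconst x : leval T g (lconst x) = g x.
Proof.
rewrite leval_lmon; elim: (enum 'I_n) => [//|i s /= ->].
by rewrite cm1.
Qed.

Lemma leval_lvar i P : (forall i j w, T i (T j w) = T j (T i w)) ->
  leval T g (lvar i P) = T i (leval T g P).
Proof.
move=> TC; have Tn j k w : iter k (T j) (T i w) = T i (iter k (T j) w).
  by elim: k => //= k ->.
have lT := leval_linear Tl gl.
rewrite [P]lpolyE linear_sum !(lin_sum lT) (lin_sum (Tl i)).
apply: eq_bigr => m _; rewrite /= lvar_lmon !leval_lmon.
have := mem_enum 'I_n i; have := enum_uniq 'I_n.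
move: (g _) => w; elim: (enum 'I_n) => [//|j s IHs] /= /andP[js us].
rewrite inE; have [ij _|ne /= is_] := eqVneq i j; last first.
  rewrite IHs // mulcmE ucmE (negPf ne) addn0; exact: Tn.
subst j; rewrite mulcmE ucmE eqxx addn1 iterS; congr (T _ _); congr (iter _ _ _).
elim: s {IHs us} js => //= j s IHs; rewrite inE negb_or => /andP[ij js].
by rewrite IHs // mulcmE ucmE (negPf ij) addn0.
Qed.

(** Linear maps that intertwine the variables commute with evaluation. *)
Lemma leval_morph (W' : lmodType F) (T' : 'I_n -> W' -> W') (h : W -> W') P :
    linear h -> (forall i w, h (T i w) = T' i (h w)) ->
  h (leval T g P) = leval T' (h \o g) P.
Proof.
move=> hl hT; rewrite /leval (lin_sum hl); apply: eq_bigr => m _.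
elim: (enum 'I_n) => [//|i s /= <-].
by elim: (m i) (foldr _ _ _) => [//|k IHk] w /=; rewrite hT IHk.
Qed.

(** Evaluation only depends on the operators modulo a subspace that they
    preserve. *)
Lemma leval_cong (Z : W -> Prop) (T' : 'I_n -> W -> W) P :
    Z 0 -> (forall c u v, Z u -> Z v -> Z (c *: u + v)) ->
    (forall i w, Z w -> Z (T i w)) ->
    (forall i w, Z (T i w - T' i w)) ->
  Z (leval T g P - leval T' g P).
Proof.
move=> Z0 ZL ZT ZTT'.
have ZD u v : Z u -> Z v -> Z (u + v) by move=> *; rewrite -[u]scale1r; exact: ZL.
rewrite /leval -sumrB; apply: big_ind => // m _.
elim: (enum 'I_n) => [|i s IHs] /=; first by rewrite subrr.
elim: (m i) => [//|k IHk] /=.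
move: (iter k _ _) (iter k _ _) IHk => v u uv.
rewrite -[X in Z X](subrKA (T i v)); apply: ZD; last exact: ZTT'.
by rewrite -(linB (Tl i)); exact: ZT.
Qed.

End Leval.

Lemma eq_leval (W : lmodType F) (T T' : 'I_n -> W -> W) (g g' : N -> W) P :
  (forall i, T i =1 T' i) -> g =1 g' -> leval T g P = leval T' g' P.
Proof.
move=> TT' gg'; apply: eq_bigr => m _; rewrite gg'.
elim: (enum 'I_n) => [//|i s /= ->]; exact: eq_iter.
Qed.

Lemma leval_id P : leval (fun i => lvar i) lconst P = P.
Proof.
elim/lpoly_ind: P => [x|P Q IP IQ|i P IP].
- by rewrite leval_lconst; [|move=> i; exact: linearP|exact: linearP].
- rewrite (linD (leval_linear _ _)) ?IP ?IQ //; [move=> i|]; exact: linearP.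
- rewrite leval_lvar ?IP //; [by move=> j; exact: linearP|exact: linearP|].
  by move=> *; exact: lvarC.
Qed.

End Polynomials.

(** * Polynomial-linear maps and null submodules *)

Section VLinear.
Variables (F : fieldType) (n : nat).
Local Notation lpoly := (@lpoly F n).

(** Linearity over the ring of polynomials in the variables. *)
Definition vlinear (N W : lmodType F) (h : lpoly N -> lpoly W) : Prop :=
  linear h /\ forall i P, h (lvar i P) = lvar i (h P).

Lemma lvar_lin (N : lmodType F) i : linear (@lvar F n N i).
Proof. exact: linearP. Qed.
Lemma lconst_lin (N : lmodType F) : linear (@lconst F n N).
Proof. exact: linearP. Qed.

Lemma vlinear_eq (N W : lmodType F) (h h' : lpoly N -> lpoly W) :
  vlinear h -> vlinear h' -> (forall x, h (lconst x) = h' (lconst x)) -> h =1 h'.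
Proof.
move=> [hl hv] [hl' hv'] E; elim/lpoly_ind=> [//|P Q IP IQ|i P IP].
  by rewrite (linD hl) (linD hl') IP IQ.
by rewrite hv hv' IP.
Qed.

Lemma vlinear_comp (N W U : lmodType F) (h : lpoly N -> lpoly W) (k : lpoly W -> lpoly U) :
  vlinear h -> vlinear k -> vlinear (fun P => k (h P)).
Proof.
by move=> [hl hv] [kl kv]; split=> [c u v|i P]; rewrite ?hl ?hv ?kl ?kv.
Qed.

Lemma vlinearP (N W : lmodType F) c (h k : lpoly N -> lpoly W) :
  vlinear h -> vlinear k -> vlinear (fun P => c *: h P + k P).
Proof.
move=> [hl hv] [kl kv]; split=> [d u v|i P].
  by rewrite hl kl; lincomb F (lpoly W).
by rewrite hv kv (lvar_lin i).
Qed.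

Lemma vlinearD (N W : lmodType F) (h k : lpoly N -> lpoly W) :
  vlinear h -> vlinear k -> vlinear (fun P => h P + k P).
Proof.
move=> hv kv; have [l v] := vlinearP 1 hv kv; split=> [c P Q|i P].
  by have := l c P Q; rewrite !scale1r.
by have := v i P; rewrite !scale1r.
Qed.

Lemma vlinearB (N W : lmodType F) (h k : lpoly N -> lpoly W) :
  vlinear h -> vlinear k -> vlinear (fun P => h P - k P).
Proof.
move=> hv kv; have [l v] := vlinearP (-1) kv hv; split=> [c P Q|i P].
  by have := l c P Q; rewrite !scaleN1r ![- k _ + _]addrC.
by have := v i P; rewrite !scaleN1r ![- k _ + _]addrC.
Qed.

Lemma vlinearN (N W : lmodType F) (h : lpoly N -> lpoly W) :
  vlinear h -> vlinear (fun P => - h P).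
Proof.
move=> [hl hv]; split=> [c P Q|i P]; first by rewrite hl; lincomb F (lpoly W).
by rewrite hv (linN (@lvar_lin W i)).
Qed.

(** The weights are the linear forms in the variables, given by their
    coefficients; this is the multiplication by such a form. *)
Definition lop (c : {ffun 'I_n -> F}) (N : lmodType F) (P : lpoly N) : lpoly N :=
  \sum_i c i *: lvar i P.
Arguments lop c {N} P.

Lemma lop_linear c (N : lmodType F) : linear (@lop c N).
Proof.
move=> d P Q; rewrite scaler_sumr -big_split; apply: eq_bigr => i _ /=.
by rewrite (lvar_lin i) scalerDr !scalerA mulrC.
Qed.

Lemma vlinear_lop (N W : lmodType F) (h : lpoly N -> lpoly W) c P :
  vlinear h -> h (lop c P) = lop c (h P).
Proof.
move=> [hl hv]; rewrite (lin_sum hl); apply: eq_bigr => i _.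
by rewrite (linZ hl) hv.
Qed.

Lemma vlinear_lvar (N : lmodType F) i : vlinear (@lvar F n N i).
Proof. by split=> [|j P]; [exact: lvar_lin|exact: lvarC]. Qed.

Lemma lop_vlinear (N : lmodType F) c : vlinear (@lop c N).
Proof.
split=> [|i P]; first exact: lop_linear.
by rewrite (vlinear_lop c P (vlinear_lvar N i)).
Qed.

Lemma lopC c d (N : lmodType F) (P : lpoly N) : lop c (lop d P) = lop d (lop c P).
Proof. exact: (vlinear_lop d P (lop_vlinear N c)). Qed.

Lemma lopD c d (N : lmodType F) (P : lpoly N) : lop (c + d) P = lop c P + lop d P.
Proof.
by rewrite -big_split; apply: eq_bigr => i _; rewrite ffunE scalerDl.
Qed.

Lemma lop0 (N : lmodType F) (P : lpoly N) : lop 0 P = 0.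
Proof. by apply: big1 => i _; rewrite ffunE scale0r. Qed.

Lemma lop_sum (I : Type) (r : seq I) (c : I -> {ffun 'I_n -> F}) (N : lmodType F) (P : lpoly N) :
  lop (\sum_(i <- r) c i) P = \sum_(i <- r) lop (c i) P.
Proof. exact: (big_morph (fun c => lop c P) (fun c d => lopD c d P) (lop0 P)). Qed.

(** The polynomial-linear map with a given restriction to the constants. *)
Definition ext (N W : lmodType F) (g : N -> lpoly W) (P : lpoly N) : lpoly W :=
  leval (fun i => lvar i) g P.

Lemma ext_vlinear (N W : lmodType F) (g : N -> lpoly W) : linear g -> vlinear (ext g).
Proof.
move=> gl; split=> [|i P]; first exact: leval_linear (@lvar_lin W) gl.
by rewrite /ext (leval_lvar (@lvar_lin W) gl) // => *; exact: lvarC.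
Qed.

Lemma ext_lconst (N W : lmodType F) (g : N -> lpoly W) x : linear g -> ext g (lconst x) = g x.
Proof. by move=> gl; exact: (leval_lconst (@lvar_lin W) gl). Qed.

Lemma ext_morph (N W U : lmodType F) (g : N -> lpoly W) (h : lpoly W -> lpoly U) P :
  vlinear h -> h (ext g P) = ext (h \o g) P.
Proof. by move=> [hl hv]; exact: leval_morph. Qed.

Lemma eq_ext (N W : lmodType F) (g g' : N -> lpoly W) P : g =1 g' -> ext g P = ext g' P.
Proof. by move=> gg'; exact: eq_leval. Qed.

(** Uniqueness of this map. *)
Lemma vlinearE (N W : lmodType F) (h : lpoly N -> lpoly W) P :
  vlinear h -> h P = ext (fun x => h (lconst x)) P.
Proof. by move=> hv; rewrite -{1}[P]leval_id; exact: (ext_morph lconst P hv). Qed.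

Lemma ext_param (N W : lmodType F) c (g g' : N -> lpoly W) P :
  ext (fun x => c *: g x + g' x) P = c *: ext g P + ext g' P.
Proof.
rewrite /ext /leval scaler_sumr -big_split; apply: eq_bigr => m _ /=.
elim: (enum 'I_n) => [//|i s /= ->].
by elim: (m i) => [//|k /= ->]; rewrite (lvar_lin i).
Qed.

Lemma ext_param_linear (U N W : lmodType F) (g : U -> N -> lpoly W) P :
  (forall x, linear (g^~ x)) -> linear (fun u => ext (g u) P).
Proof. by move=> gl c u v; rewrite -ext_param; apply: eq_ext => x; rewrite gl. Qed.

Lemma ext_param_vlinear (U N W : lmodType F) (g : lpoly U -> N -> lpoly W) P :
  (forall x, vlinear (g^~ x)) -> vlinear (fun u => ext (g u) P).
Proof.
move=> gv; split=> [|i Q]; first by apply: ext_param_linear => x; case: (gv x).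
rewrite (ext_morph _ _ (vlinear_lvar W i)); apply: eq_ext => x /=.
by case: (gv x).
Qed.

Lemma ext_swap (N U W : lmodType F) (g : N -> U -> lpoly W) P Q :
    (forall y, linear (g^~ y)) -> (forall x, linear (g x)) ->
  ext (fun x => ext (g x) Q) P = ext (fun y => ext (g^~ y) P) Q.
Proof.
move=> gl gr; apply: (vlinear_eq (h' := fun P => ext (fun y => ext (g^~ y) P) Q)).
- by apply: ext_vlinear; exact: ext_param_linear.
- by apply: ext_param_vlinear => y; exact: ext_vlinear.
- move=> x; rewrite ext_lconst; last exact: ext_param_linear.
  by apply: eq_ext => y; rewrite ext_lconst.
Qed.

Definition ext2 (N U W : lmodType F) (g : N -> U -> lpoly W) P Q : lpoly W :=
  ext (fun x => ext (g x) Q) P.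

Section Ext2.
Variables (N U W : lmodType F) (g : N -> U -> lpoly W).
Hypotheses (gl : forall y, linear (g^~ y)) (gr : forall x, linear (g x)).

Lemma ext2_vlinearl Q : vlinear (fun P => ext2 g P Q).
Proof. by apply: ext_vlinear; exact: ext_param_linear. Qed.

Lemma ext2_vlinearr P : vlinear (ext2 g P).
Proof. by apply: ext_param_vlinear => x; exact: ext_vlinear. Qed.

Lemma ext2_lconstl x Q : ext2 g (lconst x) Q = ext (g x) Q.
Proof. by rewrite /ext2 ext_lconst //; exact: ext_param_linear. Qed.

Lemma ext2_lconst x y : ext2 g (lconst x) (lconst y) = g x y.
Proof. by rewrite ext2_lconstl ext_lconst. Qed.

End Ext2.

(** The value of a lambda-product when lambda is a linear form. *)
Definition subst (c : {ffun 'I_n -> F}) (N : lmodType F) (P : Defs.lpoly 1 N) : lpoly N :=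
  leval (fun=> lop c) lconst P.

Lemma subst_linear c (N : lmodType F) : linear (@subst c N).
Proof. by apply: leval_linear => [i|]; [exact: lop_linear|exact: lconst_lin]. Qed.

Lemma subst_lvar c (N : lmodType F) i P : @subst c N (lvar i P) = lop c (subst c P).
Proof.
rewrite /subst leval_lvar // => [j|]; [exact: lop_linear|exact: lconst_lin].
Qed.

End VLinear.

Arguments lop {F n} c {N} P.

Section Partial.
Variables (F : fieldType) (n : nat) (N : derModType F).
Implicit Types (P Q : lpoly n N).

Lemma partial_lmon m (x : N) : partial (lmon m x : lpoly n N) = lmon m (partial x).
Proof.
rewrite [LHS]/(lpartial _) /lpartial (big_lmon (h := fun m y => lmon m (partial y))) //.
by move=> m' c y z; rewrite linearP lmon_linear.
Qed.

Lemma partial_lconst (x : N) : partial (lconst x : lpoly n N) = lconst (partial x).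
Proof. exact: partial_lmon. Qed.

Lemma partial_lvar i P : partial (lvar i P) = lvar i (partial P).
Proof.
rewrite [P]lpolyE !linear_sum /=; apply: eq_bigr => m _.
by rewrite -[LHS]/(partial (lmon _ _ : lpoly n N)) partial_lmon lvar_lmon.
Qed.

Lemma partial_vlinear : vlinear (partial : lpoly n N -> lpoly n N).
Proof. by split=> [|i P]; [exact: linearP|exact: partial_lvar]. Qed.

Lemma partial_lop c P : partial (lop c P) = lop c (partial P).
Proof. exact: (vlinear_lop c P partial_vlinear). Qed.

Lemma ext_partial (W : lmodType F) (g : N -> lpoly n W) P : linear g ->
  ext g (partial P) = ext (fun x => g (partial x)) P.
Proof.
move=> gl; have gpl : linear (fun x => g (partial x)) by move=> c x y; rewrite linearP gl.
apply: (vlinear_eq (h := fun P => ext g (partial P))) => [||x].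
- exact: vlinear_comp partial_vlinear (ext_vlinear gl).
- exact: ext_vlinear.
- by rewrite partial_lconst !ext_lconst.
Qed.

(** The image of [partial + c], by which the expressions of weight [c] are
    divided. *)
Definition nullp (c : {ffun 'I_n -> F}) P := exists Q, P = partial Q + lop c Q.

Lemma nullp0 c : nullp c 0.
Proof. by exists 0; rewrite linear0 (lin0 (@lop_linear _ _ c N)) addr0. Qed.

Lemma nullpP c k P Q : nullp c P -> nullp c Q -> nullp c (k *: P + Q).
Proof.
move=> [P' ->] [Q' ->]; exists (k *: P' + Q'); rewrite linearP lop_linear.
by rewrite scalerDr addrACA.
Qed.

Lemma nullpD c P Q : nullp c P -> nullp c Q -> nullp c (P + Q).
Proof. by move=> *; rewrite -[P]scale1r; exact: nullpP. Qed.

Lemma nullp_vlinear c (h : lpoly n N -> lpoly n N) P :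
  vlinear h -> (forall Q, h (partial Q) = partial (h Q)) -> nullp c P -> nullp c (h P).
Proof.
move=> hv hp [Q ->]; exists (h Q).
by rewrite (linD hv.1) hp (vlinear_lop c Q hv).
Qed.

Lemma nullp_lvar c i P : nullp c P -> nullp c (lvar i P).
Proof.
by apply: nullp_vlinear => [|Q]; [exact: vlinear_lvar|rewrite partial_lvar].
Qed.

Lemma nullp_ext c (U : lmodType F) (h : lpoly n U -> lpoly n N) (P : lpoly n U) :
  vlinear h -> (forall x, nullp c (h (lconst x))) -> nullp c (h P).
Proof.
move=> [hl hv] hn; elim/lpoly_ind: P => [//|P' Q' IP IQ|i P' IP].
  by rewrite (linD hl); exact: nullpD.
by rewrite hv; exact: nullp_lvar.
Qed.

End Partial.

Lemma leval_partial (F : fieldType) (n k : nat) (N : derModType F)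
    (T : 'I_k -> lpoly n N -> lpoly n N) (P : lpoly k N) :
    (forall i, linear (T i)) -> (forall i j w, T i (T j w) = T j (T i w)) ->
    (forall i w, T i (partial w) = partial (T i w)) ->
  leval T lconst (partial P) = partial (leval T lconst P).
Proof.
move=> Tl TC Tp; have ll := @lconst_lin F n N; have el := leval_linear Tl ll.
elim/lpoly_ind: P => [x|P Q IP IQ|i P IP].
- by rewrite partial_lconst !leval_lconst // partial_lconst.
- by rewrite linearD !(linD el) linearD IP IQ.
- by rewrite partial_lvar !leval_lvar // IP Tp.
Qed.

Lemma subst_partial (F : fieldType) (n : nat) (N : derModType F) c (P : lpoly 1 N) :
  subst c (partial P) = partial (subst c P : lpoly n N).
Proof.
apply: leval_partial => // [_|_ w]; first exact: lop_linear.
by rewrite partial_lop.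
Qed.

(** * The weighted Lie algebra of a Lie conformal algebra and its module *)

Section Substitution.
Variables (F : fieldType) (n : nat).
Local Notation label := {ffun 'I_n -> F}.
Implicit Types (l k : label).

Lemma ext_subst (N W : lmodType F) l (g : N -> lpoly n W) P : linear g ->
  ext g (subst l P) = leval (fun=> lop l) g P.
Proof.
move=> gl; have [el ev] := ext_vlinear gl.
rewrite /subst (leval_morph (T' := fun=> lop l) lconst P el); last first.
  by move=> _ w; exact: (vlinear_lop l w (ext_vlinear gl)).
by apply: eq_leval => // x /=; rewrite ext_lconst.
Qed.

Lemma ext2_substr (N U W : lmodType F) l (g : N -> U -> lpoly n W) x P :
    (forall y, linear (g^~ y)) -> (forall x, linear (g x)) ->
  ext2 g (lconst x) (subst l P) = leval (fun=> lop l) (g x) P.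
Proof. by move=> gl gr; rewrite ext2_lconstl // ext_subst. Qed.

Lemma ext2_substl (N U W : lmodType F) l (g : N -> U -> lpoly n W) y P :
    (forall y, linear (g^~ y)) -> (forall x, linear (g x)) ->
  ext2 g (subst l P) (lconst y) = leval (fun=> lop l) (g^~ y) P.
Proof.
move=> gl gr; rewrite /ext2 -ext_subst //.
by apply: eq_ext => x; rewrite ext_lconst.
Qed.

Definition subst2 l k (N : lmodType F) (P : lpoly 2 N) : lpoly n N :=
  leval (fun i => if i == ord0 then lop l else lop k) lconst P.

Section Subst2.
Variables (l k : label) (N : lmodType F).
Let T (i : 'I_2) (P : lpoly n N) := (if i == ord0 then lop l else lop k) P.

Let Tl i : linear (T i).
Proof. by rewrite /T; case: ifP => _; exact: lop_linear. Qed.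

Let TC i j P : T i (T j P) = T j (T i P).
Proof. by rewrite /T; case: ifP => _; case: ifP => _ //; exact: lopC. Qed.

Lemma subst2_linear : linear (@subst2 l k N).
Proof. exact: leval_linear Tl (@lconst_lin F n N). Qed.

Lemma subst2_lvar i P :
  @subst2 l k N (lvar i P) = (if i == ord0 then lop l else lop k) (subst2 l k P).
Proof. by rewrite /subst2 (leval_lvar (T := T) Tl (@lconst_lin F n N)). Qed.

Lemma subst2_lconst x : @subst2 l k N (lconst x) = lconst x.
Proof. exact: (leval_lconst Tl (@lconst_lin F n N)). Qed.

Lemma subst2_leval (U : lmodType F) (T' : lpoly 2 N -> lpoly 2 N) c
    (g : U -> lpoly 2 N) (P : lpoly 1 U) :
  (forall Q, subst2 l k (T' Q) = lop c (subst2 l k Q)) ->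
  subst2 l k (leval (fun=> T') g P) = leval (fun=> lop c) (fun x => subst2 l k (g x)) P.
Proof. by move=> TT'; rewrite (leval_morph (T' := fun=> lop c) _ _ subst2_linear). Qed.

End Subst2.

Lemma subst2_lat (N : derModType F) l k (T' : lpoly 2 N -> lpoly 2 N) c (P : lpoly 1 N) :
  (forall Q, subst2 l k (T' Q) = lop c (subst2 l k Q)) ->
  subst2 l k (lat T' P) = subst c P.
Proof.
move=> TT'; rewrite /lat (subst2_leval _ _ TT').
by apply: eq_leval => // x; rewrite subst2_lconst.
Qed.

Local Notation "'lam" := (lvar (ord0 : 'I_2)) (at level 0).
Local Notation "'mu" := (lvar (ord_max : 'I_2)) (at level 0).

Lemma subst2_lam l k (N : lmodType F) (Q : lpoly 2 N) : subst2 l k ('lam Q) = lop l (subst2 l k Q).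
Proof. exact: subst2_lvar. Qed.
Lemma subst2_mu l k (N : lmodType F) (Q : lpoly 2 N) : subst2 l k ('mu Q) = lop k (subst2 l k Q).
Proof. exact: subst2_lvar. Qed.
Lemma subst2_lam_mu l k (N : lmodType F) (Q : lpoly 2 N) :
  subst2 l k ('lam Q + 'mu Q) = lop (l + k) (subst2 l k Q).
Proof. by rewrite (linD (@subst2_linear l k N)) subst2_lam subst2_mu lopD. Qed.

(** Modulo [partial + l + k], the operator [- l - partial] that appears in the
    skew-symmetry of lambda-brackets is the multiplication by [k]. *)
Lemma subst_opp l k (N : derModType F) (Q : lpoly 1 N) :
  nullp (l + k) (subst k Q -
    subst l (lat (fun P : lpoly 1 N => - lvar ord0 P - partial P) Q) : lpoly n N).
Proof.
rewrite /lat {2}/subst -/(subst l _).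
rewrite (leval_morph (T' := fun _ (w : lpoly n N) => - lop l w - partial w) _ _ (@subst_linear F n l N)); last first.
  move=> _ w; rewrite (linB (@subst_linear F n l N)) (linN (@subst_linear F n l N)).
  by rewrite subst_lvar subst_partial.
rewrite (eq_leval (T' := fun _ (w : lpoly n N) => - lop l w - partial w) (g' := lconst) Q) //; last first.
  move=> x /=; rewrite /subst leval_lconst //; [by move=> _; exact: lop_linear|exact: lconst_lin].
apply: leval_cong => [_|||_ w [v ->]|_ w].
- exact: lop_linear.
- exact: nullp0.
- by move=> *; exact: nullpP.
- exists (lop k v).
  by rewrite (linD (@lop_linear _ _ k N)) partial_lop lopC.
- exists w; rewrite lopD; lincomb F (lpoly n N).
Qed.

Lemma vlinear_eq2 (N1 N2 W : lmodType F) (G H : lpoly n N1 -> lpoly n N2 -> lpoly n W) :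
    (forall y, vlinear (fun x => G x y)) -> (forall x, vlinear (G x)) ->
    (forall y, vlinear (fun x => H x y)) -> (forall x, vlinear (H x)) ->
    (forall x y, G (lconst x) (lconst y) = H (lconst x) (lconst y)) ->
  forall x y, G x y = H x y.
Proof.
move=> G1 G2 H1 H2 GH x y.
by apply: (vlinear_eq (G1 y) (H1 y)) => x'; exact: (vlinear_eq (G2 _) (H2 _)).
Qed.

Lemma vlinear_eq3 (N1 N2 N3 W : lmodType F)
    (G H : lpoly n N1 -> lpoly n N2 -> lpoly n N3 -> lpoly n W) :
    (forall y z, vlinear (fun x => G x y z)) -> (forall x z, vlinear (fun y => G x y z)) ->
    (forall x y, vlinear (fun z => G x y z)) ->
    (forall y z, vlinear (fun x => H x y z)) -> (forall x z, vlinear (fun y => H x y z)) ->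
    (forall x y, vlinear (fun z => H x y z)) ->
    (forall x y z, G (lconst x) (lconst y) (lconst z) = H (lconst x) (lconst y) (lconst z)) ->
  forall x y z, G x y z = H x y z.
Proof.
move=> G1 G2 G3 H1 H2 H3 GH x y z.
apply: (vlinear_eq (G1 y z) (H1 y z)) => x'.
apply: (vlinear_eq (G2 _ z) (H2 _ z)) => y'.
exact: (vlinear_eq (G3 _ _) (H3 _ _)).
Qed.

End Substitution.

Section Sesquilinear.
Variables (F : fieldType) (n : nat) (U N : derModType F) (b : U -> N -> lpoly 1 N).
Hypotheses (bl : forall y, linear (b^~ y)) (br : forall x, linear (b x)).
Hypothesis b_partiall : forall x y, b (partial x) y = - lvar ord0 (b x y).
Hypothesis b_partialr : forall x y, b x (partial y) = partial (b x y) + lvar ord0 (b x y).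
Variable l : {ffun 'I_n -> F}.

(** A lambda-product at [lambda = l], extended to polynomials. *)
Definition sprod : lpoly n U -> lpoly n N -> lpoly n N :=
  ext2 (fun x y => subst l (b x y)).

Lemma sprod_linl y : linear (fun x => subst l (b x y) : lpoly n N).
Proof. by move=> c u v; rewrite bl subst_linear. Qed.

Lemma sprod_linr x : linear (fun y => subst l (b x y) : lpoly n N).
Proof. by move=> c u v; rewrite br subst_linear. Qed.

Lemma sprod_vl y : vlinear (fun x => sprod x y).
Proof. exact: ext2_vlinearl sprod_linl _. Qed.

Lemma sprod_vr x : vlinear (sprod x).
Proof. exact: ext2_vlinearr sprod_linr _. Qed.

Lemma sprodE x y : sprod (lconst x) (lconst y) = subst l (b x y).
Proof. exact: ext2_lconst sprod_linl sprod_linr _ _. Qed.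

Lemma sprod_partiall x y : sprod (partial x) y = - lop l (sprod x y).
Proof.
move: x y; apply: vlinear_eq2 => [y|x|y|x|x y].
- exact: vlinear_comp (@partial_vlinear F n U) (sprod_vl y).
- exact: sprod_vr.
- exact: vlinearN (vlinear_comp (sprod_vl y) (@lop_vlinear F n N l)).
- exact: vlinearN (vlinear_comp (sprod_vr x) (@lop_vlinear F n N l)).
- rewrite partial_lconst !sprodE b_partiall (linN (@subst_linear F n l N)).
  by rewrite subst_lvar.
Qed.

Lemma sprod_partialr x y :
  sprod x (partial y) = partial (sprod x y) + lop l (sprod x y).
Proof.
move: x y; apply: vlinear_eq2 => [y|x|y|x|x y].
- exact: sprod_vl.
- exact: vlinear_comp (@partial_vlinear F n N) (sprod_vr x).
- exact: vlinearD (vlinear_comp (sprod_vl y) (@partial_vlinear F n N))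
    (vlinear_comp (sprod_vl y) (@lop_vlinear F n N l)).
- exact: vlinearD (vlinear_comp (sprod_vr x) (@partial_vlinear F n N))
    (vlinear_comp (sprod_vr x) (@lop_vlinear F n N l)).
- rewrite partial_lconst !sprodE b_partialr (linD (@subst_linear F n l N)).
  by rewrite subst_lvar subst_partial.
Qed.

(** Left sesquilinearity: [partial] acts on the left factor as [- l]. *)
Lemma sprod_nulll x y : nullp l x -> sprod x y = 0.
Proof.
move=> [z ->]; have vl := sprod_vl y.
by rewrite (linD vl.1) (vlinear_lop l z vl) sprod_partiall addNr.
Qed.

Lemma sprod_nullr k x y : nullp k y -> nullp (l + k) (sprod x y).
Proof.
move=> [z ->]; have vr := sprod_vr x; exists (sprod x z).
by rewrite (linD vr.1) (vlinear_lop k z vr) sprod_partialr lopD addrA.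
Qed.

End Sesquilinear.

Section Concrete.
Variables (F : fieldType) (A B : derModType F).
Variables (brA : lieConformal A) (rho : lcRep brA B) (n : nat).
Local Notation label := {ffun 'I_n -> F}.
Implicit Types (l k : label).
Local Notation pbr := (@sprod F n A A brA).
Local Notation pact := (@sprod F n A B rho).
Local Notation "'lam" := (lvar (ord0 : 'I_2)) (at level 0).
Local Notation "'mu" := (lvar (ord_max : 'I_2)) (at level 0).

Let pbr_vl l y := sprod_vl (lbr_linearl brA) l y.
Let pbr_vr l x := sprod_vr (lbr_linearr brA) l x.
Let pbrE l x y := sprodE (lbr_linearl brA) (lbr_linearr brA) l x y.
Let pact_vl l y := sprod_vl (lact_linearl rho) l y.
Let pact_vr l x := sprod_vr (lact_linearr rho) l x.
Let pactE l x y := sprodE (lact_linearl rho) (lact_linearr rho) l x y.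

Lemma pbr_jacobi l k x y z :
  pbr l x (pbr k y z) = pbr (l + k) (pbr l x y) z + pbr k y (pbr l x z).
Proof.
move: x y z; apply: vlinear_eq3 => [y z|x z|x y|y z|x z|x y|x y z].
- exact: pbr_vl.
- exact: (vlinear_comp (pbr_vl k z) (pbr_vr l x)).
- exact: (vlinear_comp (pbr_vr k y) (pbr_vr l x)).
- exact: (vlinearD (vlinear_comp (pbr_vl l y) (pbr_vl (l + k) z))
    (vlinear_comp (pbr_vl l z) (pbr_vr k y))).
- exact: (vlinearD (vlinear_comp (pbr_vr l x) (pbr_vl (l + k) z)) (pbr_vl k _)).
- exact: (vlinearD (pbr_vr (l + k) _) (vlinear_comp (pbr_vr l x) (pbr_vr k y))).
have bl c := sprod_linl (lbr_linearl brA) c; have br c := sprod_linr (lbr_linearr brA) c.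
rewrite !pbrE /sprod !ext2_substr // ext2_substl //.
have := congr1 (@subst2 F n l k A) (lbr_jacobi brA x y z).
rewrite (linD (@subst2_linear F n l k A)).
rewrite (subst2_leval _ _ (@subst2_mu F n l k A)) !(subst2_leval _ _ (@subst2_lam F n l k A)).
have -> : leval (fun=> lop k) (fun w => subst2 l k (lat 'lam (brA x w))) (brA y z) =
  leval (fun=> lop k) (fun w => subst l (brA x w)) (brA y z).
  by apply: eq_leval => // w; apply: subst2_lat => Q; exact: subst2_lam.
have -> : leval (fun=> lop l) (fun w => subst2 l k (lat (fun P => 'lam P + 'mu P) (brA w z))) (brA x y) =
  leval (fun=> lop l) (fun w => subst (l + k) (brA w z)) (brA x y).
  by apply: eq_leval => // w; apply: subst2_lat => Q; exact: subst2_lam_mu.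
have -> : leval (fun=> lop l) (fun w => subst2 l k (lat 'mu (brA y w))) (brA x z) =
  leval (fun=> lop l) (fun w => subst k (brA y w)) (brA x z).
  by apply: eq_leval => // w; apply: subst2_lat => Q; exact: subst2_mu.
by [].
Qed.

Lemma pact_comm l k x y m :
  pact (l + k) (pbr l x y) m = pact l x (pact k y m) - pact k y (pact l x m).
Proof.
move: x y m; apply: vlinear_eq3 => [y z|x z|x y|y z|x z|x y|x y z].
- exact: (vlinear_comp (pbr_vl l y) (pact_vl (l + k) z)).
- exact: (vlinear_comp (pbr_vr l x) (pact_vl (l + k) z)).
- exact: pact_vr.
- exact: (vlinearB (pact_vl l _) (vlinear_comp (pact_vl l z) (pact_vr k y))).
- exact: (vlinearB (vlinear_comp (pact_vl k z) (pact_vr l x)) (pact_vl k _)).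
- exact: (vlinearB (vlinear_comp (pact_vr k y) (pact_vr l x))
    (vlinear_comp (pact_vr l x) (pact_vr k y))).
have bl c := sprod_linl (lact_linearl rho) c; have br c := sprod_linr (lact_linearr rho) c.
rewrite !pactE !pbrE /sprod !ext2_substr // ext2_substl //.
have := congr1 (@subst2 F n l k B) (lact_comm rho x y z).
rewrite (linB (@subst2_linear F n l k B)).
rewrite (subst2_leval _ _ (@subst2_mu F n l k B)) !(subst2_leval _ _ (@subst2_lam F n l k B)).
have -> : leval (fun=> lop k) (fun w => subst2 l k (lat 'lam (rho x w))) (rho y z) =
  leval (fun=> lop k) (fun w => subst l (rho x w)) (rho y z).
  by apply: eq_leval => // w; apply: subst2_lat => Q; exact: subst2_lam.
have -> : leval (fun=> lop l) (fun w => subst2 l k (lat (fun P => 'lam P + 'mu P) (rho w z))) (brA x y) =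
  leval (fun=> lop l) (fun w => subst (l + k) (rho w z)) (brA x y).
  by apply: eq_leval => // w; apply: subst2_lat => Q; exact: subst2_lam_mu.
have -> : leval (fun=> lop l) (fun w => subst2 l k (lat 'mu (rho y w))) (rho x z) =
  leval (fun=> lop l) (fun w => subst k (rho y w)) (rho x z).
  by apply: eq_leval => // w; apply: subst2_lat => Q; exact: subst2_mu.
by [].
Qed.

Lemma pbr_skew l k x y : nullp (l + k) (pbr l x y + pbr k y x).
Proof.
apply: (nullp_ext (h := fun x => pbr l x y + pbr k y x) _ (vlinearD (pbr_vl l y) (pbr_vr k y))) => x'.
apply: (nullp_ext (h := fun y => pbr l (lconst x') y + pbr k y (lconst x')) _
  (vlinearD (pbr_vr l (lconst x')) (pbr_vl k (lconst x')))) => y'.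
rewrite !pbrE lbr_skew (linN (@subst_linear F n l A)) [- _ + _]addrC; exact: subst_opp.
Qed.

Definition polyLie : weightedLie label (lpoly n A) (lpoly n B) 'I_n.
Proof.
refine (@WeightedLie F label (lpoly n A) (lpoly n B) 'I_n pbr pact
  (@nullp F n A) (@nullp F n B) (fun i => lvar i) (fun i => lvar i)
  _ _ _ _ _ _ _ _ _ _ _ pbr_jacobi pact_comm pbr_skew _ _ _ _).
- by move=> l y; case: (pbr_vl l y).
- by move=> l x; case: (pbr_vr l x).
- by move=> l y; case: (pact_vl l y).
- by move=> l x; case: (pact_vr l x).
- by move=> i; exact: lvar_lin.
- by move=> i l x y; case: (pbr_vl l y) => _ /(_ i x).
- by move=> i l x y; case: (pbr_vr l x) => _ /(_ i y).
- by move=> i l x y; case: (pact_vl l y) => _ /(_ i x).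
- by move=> i l x y; case: (pact_vr l x) => _ /(_ i y).
- exact: nullp0.
- by move=> *; exact: nullpP.
- by move=> l x y; exact: (sprod_nulll (lbr_linearl brA) (lbr_linearr brA) (lbr_partiall brA)).
- by move=> l k x y; exact: (sprod_nullr (lbr_linearl brA) (lbr_linearr brA) (lbr_partialr brA)).
- by move=> l x y; exact: (sprod_nulll (lact_linearl rho) (lact_linearr rho) (lact_partiall rho)).
- by move=> l k x y; exact: (sprod_nullr (lact_linearl rho) (lact_linearr rho) (lact_partialr rho)).
Defined.

End Concrete.

(** * Cochains as multilinear maps of lists *)

Section Multilinear.
Variables (F : fieldType) (n : nat) (M N : derModType F).
Local Notation label := {ffun 'I_n -> F}.
Local Notation pentry := (label * M)%type.
Local Notation entry := (label * lpoly n M)%type.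
Implicit Types (phi psi : seq pentry -> lpoly n N) (s : seq entry) (t : seq pentry).

Definition multilin phi : Prop :=
  forall t1 c t2, linear (fun x => phi (t1 ++ (c, x) :: t2)).

(** Every cochain argument is replaced by a polynomial in turn, so that the
    values of compound arguments such as rho(x)_l m can be plugged in. *)
Fixpoint mlext phi s : lpoly n N :=
  if s is (c, P) :: s' then ext (fun x => mlext (fun t => phi ((c, x) :: t)) s') P
  else phi [::].

Lemma eq_mlext phi psi s :
  (forall t, map fst t = map fst s -> phi t = psi t) -> mlext phi s = mlext psi s.
Proof.
elim: s phi psi => [|[c P] s IHs] phi psi E /=; first exact: E.
by apply: eq_ext => x; apply: IHs => t ts; apply: E; rewrite /= ts.
Qed.

Lemma mlextP k phi psi s :
  mlext (fun t => k *: phi t + psi t) s = k *: mlext phi s + mlext psi s.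
Proof.
elim: s phi psi => [//|[c P] s IHs] phi psi /=.
by rewrite -ext_param; apply: eq_ext => x; exact: IHs.
Qed.

Lemma mlext0 s : mlext (fun=> 0) s = 0.
Proof.
rewrite (@eq_mlext _ (fun t => -1 *: 0 + 0)) => [|t _].
  by rewrite (mlextP (-1) (fun=> 0) (fun=> 0)) scaleN1r addNr.
by rewrite scaler0 addr0.
Qed.

Lemma mlext_linear (U : lmodType F) (Phi : U -> seq pentry -> lpoly n N) s :
  (forall t, linear (Phi^~ t)) -> linear (fun x => mlext (Phi x) s).
Proof.
move=> Pl k u v; rewrite -mlextP; apply: eq_mlext => t _; exact: Pl.
Qed.

Lemma multilin_cons phi c x : multilin phi -> multilin (fun t => phi ((c, x) :: t)).
Proof. by move=> pl t1; exact: (pl ((c, x) :: t1)). Qed.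

Lemma multilin_head phi c t : multilin phi -> linear (fun x => phi ((c, x) :: t)).
Proof. by move=> pl; exact: (pl [::]). Qed.

Lemma mlext_vlinear phi s1 c s2 : multilin phi ->
  vlinear (fun P => mlext phi (s1 ++ (c, P) :: s2)).
Proof.
elim: s1 phi => [|[d Q] s1 IHs] phi pl /=.
  by apply: ext_vlinear; apply: mlext_linear => t; exact: multilin_head.
by apply: ext_param_vlinear => x; apply: IHs; exact: multilin_cons.
Qed.

Definition pure (t : seq pentry) : seq entry := [seq (e.1, lconst e.2) | e <- t].

Lemma mlext_pure phi t : multilin phi -> mlext phi (pure t) = phi t.
Proof.
elim: t phi => [//|[c x] t IHt] phi pl /=.
rewrite ext_lconst; first by apply: IHt; exact: multilin_cons.
by apply: mlext_linear => t'; exact: multilin_head.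
Qed.

(** By uniqueness of the polynomial-linear extension, entry by entry. *)
Lemma mlext_unique (G : seq entry -> lpoly n N) s :
    (forall s1 c s2, vlinear (fun P => G (s1 ++ (c, P) :: s2))) ->
  G s = mlext (fun t => G (pure t)) s.
Proof.
elim: s G => [//|[c P] s IHs] G Gv.
rewrite (vlinearE P (Gv [::] c s)) /=; apply: eq_ext => x.
by apply: (IHs (fun s => G ((c, lconst x) :: s))) => s1; exact: (Gv (_ :: s1)).
Qed.

Lemma mlext_null l phi s :
  (forall t, map fst t = map fst s -> nullp l (phi t)) -> nullp l (mlext phi s).
Proof.
elim: s phi => [|[c P] s IHs] phi E /=; first exact: E.
rewrite /ext /leval; apply: big_ind => [||m _]; first exact: nullp0.
  by move=> *; exact: nullpD.
elim: (enum 'I_n) => [|i r IHr] /=.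
  by apply: IHs => t ts; apply: E; rewrite /= ts.
by elim: (m i) => [//|k IHk] /=; exact: nullp_lvar.
Qed.

Lemma mlext_morph (h : lpoly n N -> lpoly n N) phi s :
  vlinear h -> h (mlext phi s) = mlext (fun t => h (phi t)) s.
Proof.
move=> hv; elim: s phi => [//|[c P] s IHs] phi /=.
by rewrite (ext_morph _ _ hv); apply: eq_ext => x /=.
Qed.

Fixpoint swapat (T : Type) (i : nat) (s : seq T) : seq T :=
  match i, s with
  | 0, x :: y :: r => y :: x :: r
  | i'.+1, x :: r => x :: swapat i' r
  | _, _ => s
  end.

Lemma swapat_cat (T : Type) (r1 : seq T) x y (r2 : seq T) :
  swapat (size r1) (r1 ++ x :: y :: r2) = r1 ++ y :: x :: r2.
Proof. by elim: r1 => //= z r1 ->. Qed.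

Lemma mlext_swapat i phi s : multilin phi ->
  mlext phi (swapat i s) = mlext (fun t => phi (swapat i t)) s.
Proof.
elim: i s phi => [|i IHi] [|[c P] s] phi pl //=.
  case: s => [|[d Q] s] //=.
  rewrite ext_swap // => [x|y]; apply: mlext_linear => t.
    exact: multilin_head.
  exact: (pl [:: _]).
by apply: eq_ext => x; apply: IHi; exact: multilin_cons.
Qed.

Fixpoint partialat (U : derModType F) (i : nat) (s : seq (label * U)) : seq (label * U) :=
  match i, s with
  | 0, (c, x) :: r => (c, partial x) :: r
  | i'.+1, e :: r => e :: partialat i' r
  | _, _ => s
  end.

Lemma partialat_cat (U : derModType F) (r1 : seq (label * U)) c x (r2 : seq (label * U)) :
  partialat (size r1) (r1 ++ (c, x) :: r2) = r1 ++ (c, partial x) :: r2.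
Proof. by elim: r1 => //= z r1 ->. Qed.

Lemma mlext_partialat i phi s : multilin phi ->
  mlext phi (partialat i s) = mlext (fun t => phi (partialat i t)) s.
Proof.
elim: i s phi => [|i IHi] [|[c P] s] phi pl //=.
  by rewrite ext_partial //; apply: mlext_linear => t; exact: multilin_head.
by apply: eq_ext => x; apply: IHi; exact: multilin_cons.
Qed.

End Multilinear.

Section DaggerNull.
Variables (F : fieldType) (n k : nat) (N : derModType F).
Variable c : 'I_k -> {ffun 'I_n -> F}.

Lemma leval_butlast_linear :
  linear (leval (butlast (fun i => lop (c i))) (@lconst F n N)).
Proof. by apply: leval_linear => [i|]; [exact: lop_linear|exact: lconst_lin]. Qed.

(** What [ldag] becomes when the variables take the values [c]. *)
Definition dagop (i : 'I_k) (w : lpoly n N) : lpoly n N :=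
  if insub (val i) is Some j then butlast (fun i => lop (c i)) j w
  else - (\sum_(j < k.-1) butlast (fun i => lop (c i)) j w) - partial w.

Lemma leval_ldag i (P : lpoly k.-1 N) :
  leval (butlast (fun i => lop (c i))) lconst (ldag i P) =
  dagop i (leval (butlast (fun i => lop (c i))) lconst P).
Proof.
have hl := leval_butlast_linear.
have hv j Q : leval (butlast (fun i => lop (c i))) lconst (lvar j Q) =
    butlast (fun i => lop (c i)) j (leval (butlast (fun i => lop (c i))) (@lconst F n N) Q).
  rewrite leval_lvar // => [j'||i' j' w].
  - exact: lop_linear.
  - exact: lconst_lin.
  - exact: lopC.
rewrite /ldag /dagop; case: insub => [j|]; first exact: hv.
rewrite (linB hl) (linN hl) (lin_sum hl); congr (- _ - _).
  by apply: eq_bigr => j _; exact: hv.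
apply: leval_partial => [j|i' j' w|j w].
- exact: lop_linear.
- exact: lopC.
- by rewrite /butlast partial_lop.
Qed.

(** The last value is [- partial] minus the sum of the others, hence the last
    weight modulo the null submodule of the total weight. *)
Lemma dagop_null i w : nullp (\sum_i c i) (lop (c i) w - dagop i w).
Proof.
rewrite /dagop; case: insubP => [j _ ji|ik].
  rewrite /butlast (_ : widen_ord _ j = i) ?subrr; first exact: nullp0.
  exact: val_inj.
exists w; rewrite lop_sum.
case: k c i ik => [? [] //|k'] c' i ik.
rewrite big_ord_recr /= (_ : i = ord_max); last first.
  by apply: val_inj; apply/eqP; rewrite eqn_leq -ltnS ltn_ord leqNgt.
set S := (X in _ = _ + (X + _)).
have -> : \sum_(j < k') butlast (fun i => lop (c' i)) j w = S.
  by apply: eq_bigr => j _; congr (lop (c' _) w); exact: val_inj.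
lincomb F (lpoly n N).
Qed.

(** So eliminating the last variable before the specialization does not change
    the value modulo the null submodule. *)
Lemma dagger_null (P : lpoly k N) :
  nullp (\sum_i c i) (leval (fun i => lop (c i)) lconst P -
    leval (butlast (fun i => lop (c i))) lconst (dagger P)).
Proof.
rewrite /dagger (leval_morph (T' := dagop) _ _ leval_butlast_linear); last first.
  exact: leval_ldag.
rewrite [X in _ - X](eq_leval (T' := dagop) (g' := lconst) P) //; last first.
  move=> x /=; rewrite leval_lconst => [//|j|]; [exact: lop_linear|exact: lconst_lin].
apply: leval_cong => [i|||i w [v ->]|i w].
- exact: lop_linear.
- exact: nullp0.
- by move=> *; exact: nullpP.
- exists (lop (c i) v).
  by rewrite (linD (@lop_linear _ _ (c i) N)) partial_lop lopC.
- exact: dagop_null.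
Qed.

End DaggerNull.

Lemma cochainP (F : fieldType) (M N : derModType F) k (f : cochain M N k) : is_cochain f.
Proof. by case: f => f /= /asboolP. Qed.

Section Flat.
Variables (F : fieldType) (n : nat) (M N : derModType F).
Local Notation label := {ffun 'I_n -> F}.
Local Notation pentry := (label * M)%type.
Implicit Types (t : seq pentry).
Variables (k : nat) (f : {ffun 'I_k -> M} -> lpoly k.-1 N).

Definition lab t (j : 'I_k) : label := (nth 0 t j).1.
Definition arg t : {ffun 'I_k -> M} := [ffun j : 'I_k => (nth 0 t j).2].

(** A cochain at constant arguments of given weights.  It depends on all weights
    but the last one, which only matters for the quotient. *)
Definition flat t : lpoly n N :=
  if size t == k then leval (butlast (fun j => lop (lab t j))) lconst (f (arg t)) else 0.

Lemma flatE t : size t = k ->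
  flat t = leval (butlast (fun j => lop (lab t j))) lconst (f (arg t)).
Proof. by rewrite /flat => ->; rewrite eqxx. Qed.

Lemma nth_entry (t1 : seq pentry) c x y t2 j : nth 0 (t1 ++ (c, x) :: t2) j =
  if j == size t1 then (c, x) else nth 0 (t1 ++ (c, y) :: t2) j.
Proof.
rewrite !nth_cat; case: ltngtP => //= [lt|->]; last by rewrite subnn.
by rewrite -(subnSK lt).
Qed.

Lemma lab_entry (t1 : seq pentry) c x y t2 :
  lab (t1 ++ (c, x) :: t2) =1 lab (t1 ++ (c, y) :: t2).
Proof.
move=> j; rewrite /lab (nth_entry _ _ x y); case: eqP => // ->.
by rewrite nth_cat ltnn subnn.
Qed.

Lemma arg_entry (t1 : seq pentry) c x y t2 (i : 'I_k) : i = size t1 :> nat ->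
  arg (t1 ++ (c, x) :: t2) = upd (arg (t1 ++ (c, y) :: t2)) i x.
Proof.
move=> i1; apply/ffunP => j; rewrite !ffunE (nth_entry _ _ x y) -i1 -val_eqE.
by case: eqP.
Qed.

Lemma sum_lab t : size t = k -> \sum_(j < k) lab t j = \sum_(e <- t) e.1.
Proof. by move=> st; rewrite [RHS](big_nth 0) big_mkord st. Qed.

Hypothesis fc : is_cochain f.

Lemma flat_multilin : multilin flat.
Proof.
move=> t1 c t2 d x y; rewrite /flat !size_cat /=.
case: eqP => [sk|_]; last by rewrite scaler0 addr0.
have lt : (size t1 < k)%N by rewrite -sk addnS ltnS leq_addr.
have aE z := @arg_entry t1 c z 0 t2 (Ordinal lt) (erefl _).
rewrite (aE (d *: x + y)) (aE x) (aE y); case: fc => -> _ _.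
have E z P : leval (butlast (fun j => lop (lab (t1 ++ (c, z) :: t2) j))) lconst P =
    leval (butlast (fun j => lop (lab (t1 ++ (c, 0) :: t2) j))) (@lconst F n N) P.
  by apply: eq_leval => // j P'; rewrite /butlast (lab_entry _ _ z 0).
by rewrite !E; exact: leval_butlast_linear.
Qed.

(** The symmetry of cochains under a transposition.  The variable eliminated by
    [dagger] in that condition may be kept, by [dagger_null]. *)
Lemma flat_swap t1 x y t2 : nullp (\sum_(e <- t1 ++ x :: y :: t2) e.1)
  (flat (t1 ++ x :: y :: t2) + flat (t1 ++ y :: x :: t2)).
Proof.
rewrite /flat !size_cat /=; case: eqP => [sk|_]; last by rewrite addr0; exact: nullp0.
have lt1 : ((size t1).+1 < k)%N by rewrite -sk !addnS !ltnS leq_addr.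
have lt0 := ltnW lt1.
pose i := Ordinal lt0; pose i' := Ordinal lt1.
have ii' : i != i' by rewrite -val_eqE /= neq_ltn ltnSn.
set t := t1 ++ x :: y :: t2; set t' := t1 ++ y :: x :: t2.
have tt' j : nth 0 t' (j : 'I_k) = nth 0 t (tperm i i' j).
  have [->|ji] := eqVneq j i; first by rewrite tpermL /t /t' !nth_cat /= ltnn ltnNge leqnSn subnn subSnn.
  have [->|ji'] := eqVneq j i'; first by rewrite tpermR /t /t' !nth_cat /= ltnn ltnNge leqnSn subnn subSnn.
  rewrite tpermD 1?eq_sym // /t /t' !nth_cat; case: ltnP => // le1.
  case e: (j - size t1)%N => [|[|m]] //=.
    by case/eqP: ji; apply: val_inj; apply/eqP; rewrite eqn_leq le1 -subn_eq0 e.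
  case/eqP: ji'; apply: val_inj => /=.
  by rewrite -[LHS](subnK le1) e add1n.
have st : size t = k by rewrite size_cat.
rewrite -(sum_lab st).
have -> : f (arg t) = - dagger (leval (butlast (fun j => lvar (tperm i i' j))) lconst (f (arg t'))).
  case: fc => _ _ /(_ (tperm i i') (arg t)) ->.
  rewrite odd_tperm ii' expr1 scaleN1r; congr (- dagger (leval _ _ (f _))).
  by apply/ffunP => j; rewrite !ffunE tt'.
rewrite (linN (@leval_butlast_linear F n k N (lab t))) addrC.
have -> : leval (butlast (fun j => lop (lab t' j))) lconst (f (arg t')) =
  leval (fun j => lop (lab t j)) lconst
    (leval (butlast (fun j => lvar (tperm i i' j))) lconst (f (arg t'))) :> lpoly n N.
  have Tl (j : 'I_k) : linear (@lop F n (lab t j) N) by exact: lop_linear.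
  have el := leval_linear Tl (@lconst_lin F n N).
  rewrite (leval_morph (T' := butlast (fun j => lop (lab t' j))) _ _ el); last first.
    move=> j w; rewrite /butlast leval_lvar //; last by move=> *; exact: lopC.
      by rewrite /lab tt'.
    exact: lconst_lin.
  by apply: eq_leval => // z /=; rewrite leval_lconst //; exact: lconst_lin.
exact: dagger_null.
Qed.

Lemma flat_partial t1 c x t2 : nullp (\sum_(e <- t1 ++ (c, x) :: t2) e.1)
  (flat (t1 ++ (c, partial x) :: t2) + lop c (flat (t1 ++ (c, x) :: t2))).
Proof.
rewrite /flat !size_cat /=; case: eqP => [sk|_]; last first.
  by rewrite (lin0 (@lop_linear F n c N)) addr0; exact: nullp0.
have lt : (size t1 < k)%N by rewrite -sk addnS ltnS leq_addr.
pose i := Ordinal lt; set t := t1 ++ (c, x) :: t2.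
have ax : arg t i = x by rewrite ffunE /t nth_cat ltnn subnn.
have fp : f (upd (arg t) i (partial x)) = - ldag i (f (arg t)).
  by case: fc => _ /(_ i (arg t)); rewrite ax.
rewrite (@arg_entry t1 c _ x t2 i) // -/t fp.
rewrite (eq_leval (T' := butlast (fun j => lop (lab t j))) (g' := lconst)) //; last first.
  by move=> j P; rewrite /butlast (lab_entry _ _ _ x).
rewrite (linN (@leval_butlast_linear F n k N (lab t))) leval_ldag addrC.
have st : size t = k by rewrite size_cat.
have {1}-> : c = lab t i by rewrite /lab /t nth_cat ltnn subnn.
by rewrite -(sum_lab st); exact: dagop_null.
Qed.

End Flat.

Section Hat.
Variables (F : fieldType) (A B : derModType F).
Variables (brA : lieConformal A) (rho : lcRep brA B) (n k : nat).
Local Notation S := (polyLie rho n).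
Variable f : cochain B A k.

Definition hat : seq ({ffun 'I_n -> F} * lpoly n B) -> lpoly n A := mlext (flat f).

Lemma hat_vlinear s1 c s2 : vlinear (fun P => hat (s1 ++ (c, P) :: s2)).
Proof. exact/mlext_vlinear/flat_multilin/cochainP. Qed.

Lemma hat_pure t : hat (pure t) = flat f t.
Proof. exact/mlext_pure/flat_multilin/cochainP. Qed.

(** Each property only involves two lists that differ by an operation on entries
    of fixed positions, which commutes with the polynomial extension; this
    reduces it to constant arguments. *)
Lemma hat_multimap : multimap S k hat.
Proof.
have fm : multilin (flat (n := n) f) by exact/flat_multilin/cochainP.
split=> [s ne|s1 l s2|s1 x y s2|s1 l v s2 [Q ->]|i s1 l v s2].
- transitivity (mlext (fun _ : seq ({ffun 'I_n -> F} * B) => 0 : lpoly n A) s).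
    apply: eq_mlext => t ts; rewrite /flat ifN //.
    by rewrite -(size_map fst) ts size_map.
  exact: mlext0.
- by case: (hat_vlinear s1 l s2).
- apply/multimap_swapP; set s := s1 ++ _.
  rewrite -(swapat_cat s1 x y s2) -/s /hat mlext_swapat // -[X in X + _]scale1r -mlextP.
  apply: mlext_null => t ts; rewrite scale1r.
  have -> : weight s = \sum_(e <- t) e.1.
    by rewrite /weight -!(big_map fst xpredT id) /= ts.
  have : (size s1 + 2 <= size t)%N.
    by rewrite -(size_map fst t) ts size_map size_cat /= leq_add2l.
  move: (size s1) => m le_m; rewrite -(cat_take_drop m t).
  have [x' [y' [t2 ->]]] : exists x' y' t2, drop m t = x' :: y' :: t2.
    have le2 : (2 <= size (drop m t))%N.
      by rewrite size_drop leq_subRL // (leq_trans (leq_addr 2 m) le_m).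
    by case: (drop m t) le2 => [|x' [|y' t2]] // _; exists x', y', t2.
  have sm : size (take m t) = m by rewrite size_takel // (leq_trans (leq_addr 2 m) le_m).
  have := swapat_cat (take m t) x' y' t2; rewrite sm => ->.
  exact/flat_swap/cochainP.
- have hv := hat_vlinear s1 l s2.
  rewrite (linD hv.1) (vlinear_lop l Q hv) -(partialat_cat s1 l Q s2).
  set s := s1 ++ (l, Q) :: s2.
  have -> : weight (s1 ++ (l, partial Q + lop l Q) :: s2) = weight s.
    by rewrite /s !weight_cat !weight_cons.
  rewrite /hat mlext_partialat // (mlext_morph _ _ (@lop_vlinear F n A l)).
  rewrite -[X in X + _]scale1r -mlextP.
  apply: mlext_null => t ts; rewrite scale1r.
  have -> : weight s = \sum_(e <- t) e.1.
    by rewrite /weight -!(big_map fst xpredT id) /= ts.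
  have lt : (size s1 < size t)%N.
    by rewrite -(size_map fst t) ts size_map size_cat /= addnS ltnS leq_addr.
  have nl : nth 0 (map fst t) (size s1) = l.
    by rewrite ts map_cat nth_cat size_map ltnn subnn.
  move: (size s1) lt nl => m lt nl.
  have [t1 [x [t2 [-> <-]]]] : exists t1 x t2, t = t1 ++ (l, x) :: t2 /\ size t1 = m.
    exists (take m t), (nth 0 t m).2, (drop m.+1 t).
    rewrite size_takel 1?ltnW //; split=> //; rewrite -[t in LHS](cat_take_drop m).
    rewrite (drop_nth 0 lt); congr (_ ++ _ :: _).
    by rewrite (nth_map 0) // in nl; rewrite -nl; case: (nth 0 t m).
  rewrite partialat_cat; exact/flat_partial/cochainP.
- by case: (hat_vlinear s1 l s2) => _ /(_ i v).
Qed.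

End Hat.

(** * Sums over unshuffles *)

Section Unshuffles.

Definition permlist (X : Type) k (u : 'I_k -> X) (s : 'S_k) : seq X :=
  [seq u (s i) | i <- enum 'I_k].

Lemma size_permlist (X : Type) k (u : 'I_k -> X) s : size (permlist u s) = k.
Proof. by rewrite size_map size_enum_ord. Qed.

Lemma enum_ord_lift k (i : 'I_k.+1) : enum 'I_k.+1 =
  take i [seq lift i j | j <- enum 'I_k] ++ i :: drop i [seq lift i j | j <- enum 'I_k].
Proof.
apply: (inj_map val_inj); rewrite map_cat /= map_take map_drop !val_enum_ord.
have -> : [seq \val j | j <- [seq lift i j | j <- enum 'I_k]] = [seq bump i j | j <- iota 0 k].
  by rewrite -val_enum_ord -!map_comp; exact: eq_map.
have le_i : (i <= k)%N by rewrite -ltnS.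
have -> : iota 0 k = iota 0 i ++ iota i (k - i) by rewrite -[iota i _]/(iota (0 + i) _) -iotaD subnKC.
have -> : iota 0 k.+1 = iota 0 i ++ (i : nat) :: iota i.+1 (k - i).
  by rewrite -[_ :: _]/(iota (0 + i) (k - i).+1) -iotaD addnS subnKC.
rewrite map_cat take_size_cat ?size_map ?size_iota // drop_size_cat ?size_map ?size_iota //.
congr (_ ++ _ :: _).
  rewrite -[LHS]map_id; apply/eq_in_map => j; rewrite mem_iota add0n /= => lt_j.
  by rewrite /bump leqNgt lt_j.
rewrite -addn1 addnC iotaDl; apply/eq_in_map => j; rewrite mem_iota => /andP[le_j _].
by rewrite /bump le_j.
Qed.

Lemma permlist_lift (X : Type) k (u : 'I_k.+1 -> X) i (s : 'S_k) :
  permlist u (lift_perm i ord0 s) =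
  take i (permlist (fun j => u (lift ord0 j)) s) ++ u ord0 ::
  drop i (permlist (fun j => u (lift ord0 j)) s).
Proof.
rewrite /permlist (enum_ord_lift i) map_cat /= map_take map_drop lift_perm_id -map_comp.
have -> // : [seq (fun j => u (lift_perm i ord0 s j)) (lift i j) | j <- enum 'I_k] =
  [seq u (lift ord0 (s j)) | j <- enum 'I_k].
by apply: eq_map => j; rewrite lift_perm_lift.
Qed.

Lemma lift_perm_bij k :
  bijective (fun x : 'I_k.+1 * 'S_k => lift_perm x.1 ord0 x.2).
Proof.
apply: inj_card_bij; last by rewrite card_prod card_ord !card_Sn factS.
move=> [i s] [j t] /= E.
have ij : i = j.
  by apply: (@perm_inj _ (lift_perm j ord0 t)); rewrite lift_perm_id -E lift_perm_id.
subst j; congr pair; apply/permP => x; apply: (@lift_inj _ ord0).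
by rewrite -!(lift_perm_lift i) E.
Qed.

Lemma sum_perm_lift (V : zmodType) k (P : pred 'S_k.+1) (G : 'S_k.+1 -> V) :
  \sum_(s | P s) G s =
  \sum_(i : 'I_k.+1) \sum_(s : 'S_k | P (lift_perm i ord0 s)) G (lift_perm i ord0 s).
Proof.
rewrite pair_big_dep /= (reindex (fun x : 'I_k.+1 * 'S_k => lift_perm x.1 ord0 x.2)) //.
exact/onW_bij/lift_perm_bij.
Qed.

(** Unshuffles are the case where [c] numbers the blocks; arbitrary [c] are
    stable under the removal of a position. *)
Definition blockwise (c : nat -> nat) k (s : 'S_k) : bool :=
  [forall i : 'I_k, forall j : 'I_k, (i < j)%N && (c i == c j) ==> (s i < s j)%N].

Lemma blockwiseP (c : nat -> nat) k (s : 'S_k) :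
  reflect (forall i j : 'I_k, (i < j)%N -> c i = c j -> (s i < s j)%N) (blockwise c s).
Proof.
apply: (iffP forallP) => H i.
  by move=> j ij cij; have /forallP/(_ j) := H i; rewrite ij cij eqxx.
by apply/forallP => j; apply/implyP => /andP[ij /eqP]; exact: H.
Qed.

Lemma eq_blockwise (c c' : nat -> nat) k (s : 'S_k) :
  (forall i : 'I_k, c i = c' i) -> blockwise c s = blockwise c' s.
Proof.
by move=> cc'; apply: eq_forallb => i; apply: eq_forallb => j; rewrite !cc'.
Qed.

(** The least value is the first one of its block, as no smaller value may come
    before it; on the other positions the values keep their order when it is
    removed. *)
Lemma blockwise_lift c k (i : 'I_k.+1) (s : 'S_k) : blockwise c (lift_perm i ord0 s) =
  [forall j : 'I_k.+1, (j < i)%N ==> (c j != c i)] && blockwise (fun j => c (bump i j)) s.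
Proof.
apply/blockwiseP/andP => [H|[/forallP Hi /blockwiseP Hs] j j'].
  split.
    apply/forallP => j; apply/implyP => ji; apply/eqP => cji.
    by have := H _ _ ji cji; rewrite lift_perm_id ltn0.
  apply/blockwiseP => j j' jj' cjj'.
  have := H (lift i j) (lift i j'); rewrite !lift_perm_lift /= /bump !add1n ltnS; apply=> //.
  by move: jj'; rewrite !ltnNge leq_bump2.
case: (unliftP i j) => [x|] ->; case: (unliftP i j') => [y|] -> lt cc.
- rewrite !lift_perm_lift /= /bump !add1n ltnS; apply: Hs => //.
  by move: lt; rewrite /= !ltnNge leq_bump2.
- by have /implyP/(_ lt) := Hi (lift i x); rewrite cc eqxx.
- by rewrite lift_perm_id lift_perm_lift.
- by rewrite ltnn in lt.
Qed.

Definition block3 (m e i : nat) : nat := if (i < m)%N then 0 else if (i < m + e)%N then 1 else 2.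

Lemma block3_start m e n k (i : 'I_k.+1) : k.+1 = (m + e + n)%N ->
  [forall j : 'I_k.+1, (j < i)%N ==> (block3 m e j != block3 m e i)] =
  [|| (0 < m)%N && (i == 0 :> nat)%N, (0 < e)%N && (i == m :> nat) |
      (0 < n)%N && (i == m + e :> nat)%N].
Proof.
move=> kE; have lt_i := ltn_ord i.
apply/forallP/idP => [H|].
  have [i0|i_gt0] := posnP i.
    rewrite i0; lia.
  have lt1 : (i.-1 < k.+1)%N by lia.
  have := H (Ordinal lt1); rewrite /= prednK // leqnn /= /block3.
  by do ![case: ifP => ?]; lia.
by move=> H j; apply/implyP => ji; rewrite /block3; do ![case: ifP => ?]; lia.
Qed.

Lemma sum_pred1_if (V : zmodType) k (b : bool) (j : nat) (X : 'I_k.+1 -> V) : (j <= k)%N || ~~ b ->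
  \sum_(i < k.+1) (if b && (i == j :> nat) then X i else 0) = if b then X (inord j) else 0.
Proof.
case: b => /= [|_]; last by rewrite big1.
rewrite orbF => le_j; rewrite -big_mkcond (big_pred1 (inord j)) // => i.
by rewrite /= -val_eqE /= inordK.
Qed.

Section Split3.
Variables (F : fieldType) (V : lmodType F) (X : Type).
Implicit Type T : seq X -> seq X -> seq X -> V.

Definition split3 T : seq X -> V := splitsum (fun a => splitsum (T a)).

Lemma split3_cons T x s : split3 T (x :: s) =
  split3 (fun a => T (x :: a)) s + split3 (fun a b c => (-1) ^+ size a *: T a (x :: b) c) s +
  split3 (fun a b c => (-1) ^+ (size a + size b) *: T a b (x :: c)) s.
Proof.
rewrite /split3 /= -addrA; congr (_ + _); rewrite -splitsumD.
apply: eq_splitsum => a d _; rewrite scalerDr -!splitsumZ; congr (_ + _).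
by apply: eq_splitsum => b c _; rewrite scalerA exprD.
Qed.

Definition supported3 m e n T := forall a b c,
  ~~ [&& size a == m, size b == e & size c == n] -> T a b c = 0.

Lemma eq_split3 T T' s : (forall a b c, T a b c = T' a b c) -> split3 T s = split3 T' s.
Proof. by move=> E; apply: eq_splitsum => a d _; apply: eq_splitsum => b c _. Qed.

Lemma split3Z T k s : split3 (fun a b c => k *: T a b c) s = k *: split3 T s.
Proof. by rewrite -splitsumZ; apply: eq_splitsum => a d _; exact: splitsumZ. Qed.

Lemma split3_0 T s : (forall a b c, T a b c = 0) -> split3 T s = 0.
Proof. by move=> T0; apply: splitsum0 => a d; exact: splitsum0. Qed.

(** Both sides satisfy the same recursion: the first argument is in front of one
    of the three blocks, and its original place is reached by jumping over the
    blocks before that one. *)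
Lemma unshuffle_sum m e n k (u : 'I_k -> X) T : k = (m + e + n)%N -> supported3 m e n T ->
  \sum_(s : 'S_k | blockwise (block3 m e) s) (-1) ^+ odd_perm s *:
    T (take m (permlist u s)) (take e (drop m (permlist u s))) (drop (m + e) (permlist u s)) =
  split3 T [seq u i | i <- enum 'I_k].
Proof.
elim: k m e n u T => [|k IHk] m e n u T kE Ts.
  have [-> -> _] : [/\ m = 0, e = 0 & n = 0]%N by split; lia.
  rewrite (big_pred1 1%g) => [|s]; last first.
    have -> : s = 1%g by apply/permP => -[].
    by rewrite /= eqxx; apply/blockwiseP => -[].
  rewrite odd_perm1 expr0 scale1r.
  have -> : permlist u 1 = [::] by rewrite /permlist enum_ord0.
  by rewrite enum_ord0.
rewrite sum_perm_lift; pose v j := u (lift ord0 j); pose x := u ord0.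
pose L s i := take i (permlist v s) ++ x :: drop i (permlist v s).
pose Y (i : 'I_k.+1) := \sum_(s : 'S_k | blockwise (fun j => block3 m e (bump i j)) s)
  (-1) ^+ (i + odd_perm s) *: T (take m (L s i)) (take e (drop m (L s i))) (drop (m + e) (L s i)).
transitivity (\sum_(i < k.+1) (if (0 < m)%N && (i == 0 :> nat)%N then Y i else 0) +
  \sum_(i < k.+1) (if (0 < e)%N && (i == m :> nat)%N then Y i else 0) +
  \sum_(i < k.+1) (if (0 < n)%N && (i == m + e :> nat)%N then Y i else 0)).
  rewrite -!big_split; apply: eq_bigr => i _ /=.
  have -> : \sum_(s : 'S_k | blockwise (block3 m e) (lift_perm i ord0 s))
      (-1) ^+ odd_perm (lift_perm i ord0 s) *:
      T (take m (permlist u (lift_perm i ord0 s)))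
        (take e (drop m (permlist u (lift_perm i ord0 s))))
        (drop (m + e) (permlist u (lift_perm i ord0 s))) =
    if [|| (0 < m)%N && (i == 0 :> nat)%N, (0 < e)%N && (i == m :> nat) |
      (0 < n)%N && (i == m + e :> nat)%N] then Y i else 0.
    under eq_bigl => s do rewrite blockwise_lift (@block3_start m e n k i kE).
    case: ifP => _ /=; last exact: big_pred0.
    apply: eq_bigr => s _; rewrite permlist_lift; congr (_ *: _).
    by apply: sign_eq; rewrite odd_lift_perm oddD /= addbF !oddb.
  move: (Y i) => y; case: ifP => H; do ![case: ifP => ?]; rewrite ?addr0 ?add0r //; lia.
rewrite !sum_pred1_if ?orbT //; try lia.
have szL s : size (permlist v s) = k by exact: size_permlist.
have -> : [seq u i | i <- enum 'I_k.+1] = x :: [seq v i | i <- enum 'I_k].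
  by rewrite enum_ordSl /= -map_comp.
rewrite split3_cons; congr (_ + _ + _).
- case: m => [|m] in kE Ts Y *.
    by rewrite split3_0 // => a b c; exact: Ts.
  rewrite -(IHk m e n v) => [||a b c ne]; [|by lia|by apply: Ts; rewrite eqSS].
  rewrite /Y inordK //; apply: eq_big => [s|s _].
    by apply: eq_blockwise => j; rewrite /block3 /bump /=; do ![case: ifP => ?]; lia.
  by rewrite /L take0 drop0 add0n.
- case: e => [|e] in kE Ts Y *.
    by rewrite split3_0 // => a b c; rewrite Ts ?scaler0 // andbF.
  rewrite (@eq_split3 _ (fun a b c => (-1) ^+ m *: T a (x :: b) c)); last first.
    move=> a b c; have [->//|ne] := eqVneq (size a) m.
    by rewrite Ts ?scaler0 // (negPf ne).
  rewrite split3Z -(IHk m e n v) => [||a b c ne]; [|by lia|by apply: Ts; rewrite eqSS].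
  rewrite /Y inordK; last by lia.
  rewrite scaler_sumr; apply: eq_big => [s|s _].
    by apply: eq_blockwise => j; rewrite /block3 /bump /=; do ![case: ifP => ?]; lia.
  have sm : size (take m (permlist v s)) = m by rewrite size_takel // szL; lia.
  rewrite scalerA -exprD /L take_size_cat // drop_size_cat // addnS.
  rewrite drop_cat sm ifN; last by lia.
  rewrite (_ : ((m + e).+1 - m = e.+1)%N); last by lia.
  by rewrite /= drop_drop [(e + m)%N]addnC.
- case: n => [|n] in kE Ts Y *.
    by rewrite split3_0 // => a b c; rewrite Ts ?scaler0 // !andbF.
  rewrite (@eq_split3 _ (fun a b c => (-1) ^+ (m + e) *: T a b (x :: c))); last first.
    move=> a b c; have [sab|ne] := boolP ((size a == m) && (size b == e)).
      by case/andP: sab => /eqP-> /eqP->.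
    by rewrite Ts ?scaler0 // andbA (negPf ne).
  rewrite split3Z -(IHk m e n v) => [||a b c ne]; [|by lia|by apply: Ts; rewrite eqSS].
  rewrite /Y inordK; last by lia.
  rewrite scaler_sumr; apply: eq_big => [s|s _].
    by apply: eq_blockwise => j; rewrite /block3 /bump /=; do ![case: ifP => ?]; lia.
  have sm : size (take (m + e) (permlist v s)) = (m + e)%N by rewrite size_takel // szL; lia.
  rewrite scalerA -exprD /L; congr (_ *: T _ _ _).
  + by rewrite takel_cat ?sm ?leq_addr // take_takel // leq_addr.
  + rewrite drop_cat sm; case: ltnP => [lt|le].
      rewrite -[in RHS](cat_take_drop (m + e) (permlist v s)) [in RHS]drop_cat sm lt.
      rewrite !takel_cat //; rewrite size_drop sm; lia.
    have -> : e = 0%N by lia.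
    by rewrite !take0.
  + by rewrite drop_size_cat.
Qed.

Lemma splitsum_nilR (T : seq X -> V) s :
  splitsum (fun a b => if b is [::] then T a else 0) s = T s.
Proof.
rewrite splitsumC -[RHS](splitsum_nilL T); apply: eq_splitsum => -[|x a] b _.
  by rewrite mul0n expr0 scale1r.
by rewrite scaler0.
Qed.

End Split3.

Lemma unshuffle3E m e n k (s : 'S_k) : k = (m + e + n)%N ->
  unshuffle [:: m; e; n] s = blockwise (block3 m e) s.
Proof.
move=> kE; apply: eq_forallb => i; apply: eq_forallb => j.
have E (x : 'I_k) : reshape_index [:: m; e; n] x = block3 m e x.
  have := ltn_ord x; rewrite /reshape_index /block3 /= => ltx.
  by do ![case: ifP => ?]; lia.
by rewrite !E.
Qed.

Lemma unshuffle2E m n k (s : 'S_k) : k = (m + n)%N ->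
  unshuffle [:: m; n] s = blockwise (block3 m n) s.
Proof.
move=> kE; apply: eq_forallb => i; apply: eq_forallb => j.
have E (x : 'I_k) : reshape_index [:: m; n] x = block3 m n x.
  have := ltn_ord x; rewrite /reshape_index /block3 /= => ltx.
  by do ![case: ifP => ?]; lia.
by rewrite !E.
Qed.

Lemma unshuffle2_sum (F : fieldType) (V : lmodType F) (X : Type) m n k (u : 'I_k -> X)
    (T : seq X -> seq X -> V) : k = (m + n)%N ->
    (forall a b, ~~ ((size a == m) && (size b == n)) -> T a b = 0) ->
  \sum_(s : 'S_k | unshuffle [:: m; n] s) (-1) ^+ odd_perm s *:
    T (take m (permlist u s)) (drop m (permlist u s)) =
  splitsum T [seq u i | i <- enum 'I_k].
Proof.
move=> kE Ts.
transitivity (split3 (fun a b c => if c is [::] then T a b else 0) [seq u i | i <- enum 'I_k]).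
  rewrite -(@unshuffle_sum _ _ _ m n 0) ?addn0 // => [|a b [|c ?]]; last by [].
    apply: eq_big => [s|s _]; first exact: unshuffle2E.
    rewrite [drop (m + n) _]drop_oversize ?size_permlist ?kE //.
    by rewrite [take n _]take_oversize // size_drop size_permlist kE addKn.
  by rewrite andbT; exact: Ts.
by apply: eq_splitsum => a b _; exact: splitsum_nilR.
Qed.
End Unshuffles.

(** * The bracket of cochains in terms of lists *)

Section BlockLists.
Variables (X : Type) (m n k : nat) (e : (m + n = k)%N) (u : 'I_k -> X) (s : 'S_k).

Lemma permlist_blocks : permlist u s =
  [seq u (sfst e s i) | i <- enum 'I_m] ++ [seq u (ssnd e s i) | i <- enum 'I_n].
Proof.
rewrite /permlist; have -> : enum 'I_k = [seq cast_ord e (lshift n i) | i <- enum 'I_m] ++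
    [seq cast_ord e (rshift m i) | i <- enum 'I_n].
  apply: (inj_map val_inj); rewrite map_cat val_enum_ord.
  rewrite -[X in _ = X ++ _]map_comp -[X in _ = _ ++ X]map_comp -{1}e iotaD.
  congr (_ ++ _); first by rewrite -val_enum_ord; exact: eq_map.
  by rewrite add0n -[X in iota X]addn0 iotaDl -val_enum_ord -map_comp; exact: eq_map.
by rewrite map_cat -[X in X ++ _ = _]map_comp -[X in _ ++ X = _]map_comp.
Qed.

Lemma take_permlist : take m (permlist u s) = [seq u (sfst e s i) | i <- enum 'I_m].
Proof. by rewrite permlist_blocks take_size_cat // size_map size_enum_ord. Qed.

Lemma drop_permlist : drop m (permlist u s) = [seq u (ssnd e s i) | i <- enum 'I_n].
Proof. by rewrite permlist_blocks drop_size_cat // size_map size_enum_ord. Qed.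

End BlockLists.

Section Matching.
Variables (F : fieldType) (A B : derModType F).
Variables (brA : lieConformal A) (rho : lcRep brA B) (n k : nat).
Local Notation S := (polyLie rho n).
Local Notation label := {ffun 'I_n -> F}.

Lemma flat_map (M N : derModType F) l (f : {ffun 'I_l -> M} -> lpoly l.-1 N)
    (c : 'I_l -> label) (x : 'I_l -> M) :
  flat f [seq (c i, x i) | i <- enum 'I_l] =
  leval (butlast (fun i => lop (c i))) lconst (f [ffun i => x i]).
Proof.
rewrite flatE 1?size_map ?size_enum_ord //.
have E (i : 'I_l) : nth 0 [seq (c i, x i) | i <- enum 'I_l] i = (c i, x i).
  by rewrite (nth_map i) ?size_enum_ord // nth_ord_enum.
have -> : arg l [seq (c i, x i) | i <- enum 'I_l] = [ffun i => x i].
  by apply/ffunP => i; rewrite !ffunE E.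
by apply: eq_leval => // j w; rewrite /butlast /lab E.
Qed.

Definition warg (c : 'I_k -> label) (x : 'I_k -> B) (i : 'I_k) : label * lpoly n B :=
  (c i, lconst (x i)).

Variables (c : 'I_k -> label) (x : {ffun 'I_k -> B}).

Definition specialize (N : derModType F) (P : lpoly k N) : lpoly n N :=
  leval (fun i => lop (c i)) lconst P.

Lemma specialize_linear (N : derModType F) : linear (@specialize N).
Proof. by apply: leval_linear => [i|]; [exact: lop_linear|exact: lconst_lin]. Qed.

Lemma specialize_lvar (N : derModType F) i (P : lpoly k N) :
  specialize (lvar i P) = lop (c i) (specialize P).
Proof.
rewrite /specialize leval_lvar // => [j||*]; [exact: lop_linear|exact: lconst_lin|exact: lopC].
Qed.

Lemma specialize_lconst (N : derModType F) (y : N) : specialize (lconst y) = lconst y.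
Proof.
by rewrite /specialize leval_lconst // => [j|]; [exact: lop_linear|exact: lconst_lin].
Qed.

Lemma weight_warg (I : Type) (r : seq I) (g : I -> 'I_k) :
  weight [seq warg c x (g i) | i <- r] = \sum_(i <- r) c (g i).
Proof. by rewrite /weight big_map. Qed.

Lemma hat_warg l (f : cochain B A l) (g : 'I_l -> 'I_k) :
  hat f [seq warg c x (g i) | i <- enum 'I_l] =
  leval (butlast (fun i => lop (c (g i)))) lconst (f [ffun i => x (g i)]).
Proof.
rewrite -(flat_map f (c \o g) (x \o g)) -hat_pure; congr (hat f _).
by rewrite /pure -[RHS]map_comp.
Qed.

Lemma specialize_lfst m l (e : (m + l = k)%N) s (N : derModType F) (P : lpoly k N) :
  specialize (lfst e s P) = lop (\sum_(i <- enum 'I_m) c (sfst e s i)) (specialize P).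
Proof.
rewrite /lfst (lin_sum (@specialize_linear N)) lop_sum big_enum.
by apply: eq_bigr => i _; exact: specialize_lvar.
Qed.

Section Terms.
Variables (m l : nat).

(** Both sides are evaluations of the values of [f] and [g]: the products on
    polynomials are compatible with evaluation, as they are polynomial-linear. *)
Lemma specialize_bracket (e : (m + l = k)%N) (f : cochain B A m) (g : cochain B A l) s :
  specialize (bracket_term brA e f g x s) =
  wbr S (weight (take m (permlist (warg c x) s))) (hat f (take m (permlist (warg c x) s)))
    (hat g (drop m (permlist (warg c x) s))).
Proof.
rewrite (take_permlist e) (drop_permlist e) weight_warg /=.
set W := \sum_(i <- _) _; set b := [seq _ | i <- enum 'I_l].
have vl := sprod_vl (lbr_linearl brA) W (hat g b).
rewrite hat_warg (leval_morph (T' := butlast (fun i => lop (c (sfst e s i)))) _ _ vl.1); last first.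
  by move=> i w; exact: (vlinear_lop _ w vl).
rewrite /bracket_term /at_fst.
rewrite (leval_morph (T' := butlast (fun i => lop (c (sfst e s i)))) _ _ (@specialize_linear A)); last first.
  by move=> i w; exact: specialize_lvar.
apply: eq_leval => // y /=.
have vr := sprod_vr (lbr_linearr brA) W (lconst y).
rewrite /b hat_warg (leval_morph (T' := butlast (fun i => lop (c (ssnd e s i)))) _ _ vr.1); last first.
  by move=> i w; exact: (vlinear_lop _ w vr).
rewrite /at_snd.
rewrite (leval_morph (T' := butlast (fun i => lop (c (ssnd e s i)))) _ _ (@specialize_linear A)); last first.
  by move=> i w; exact: specialize_lvar.
apply: eq_leval => // z /=.
rewrite (sprodE (lbr_linearl brA) (lbr_linearr brA)) /lat.
rewrite (leval_morph (T' := fun=> lop W) _ _ (@specialize_linear A)); last first.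
  by move=> _ w; rewrite specialize_lfst.
by apply: eq_leval => // w /=; exact: specialize_lconst.
Qed.

Lemma specialize_insert (e : (m + l.+1 = k)%N) (f : cochain B A l.+1) (g : cochain B A m) s :
  specialize (insert_term rho e f g x s) =
  hat f (actat S (weight (take m (permlist (warg c x) s))) (hat g (take m (permlist (warg c x) s)))
     (warg c x (ssnd e s ord0)) :: [seq warg c x (ssnd e s (lift ord0 j)) | j <- enum 'I_l]).
Proof.
rewrite (take_permlist e) weight_warg /actat /=.
set W := \sum_(i <- _) _; set t := [seq _ | j <- enum 'I_l].
set y0 := x (ssnd e s ord0).
have hv := hat_vlinear f [::] (W + c (ssnd e s ord0)) t.
have vl := sprod_vl (lact_linearl rho) W (lconst y0).
have kv := vlinear_comp vl hv.
rewrite hat_warg.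
rewrite (leval_morph (T' := butlast (fun i => lop (c (sfst e s i)))) _ _ kv.1); last first.
  by move=> i w; exact: (vlinear_lop _ w kv).
rewrite /insert_term /at_fst.
rewrite (leval_morph (T' := butlast (fun i => lop (c (sfst e s i)))) _ _ (@specialize_linear A)); last first.
  by move=> i w; exact: specialize_lvar.
apply: eq_leval => // v /=.
rewrite (sprodE (lact_linearl rho) (lact_linearr rho)) /subst.
rewrite (leval_morph (T' := fun=> lop W) _ _ (@specialize_linear A)); last first.
  by move=> _ w; rewrite specialize_lfst.
rewrite (leval_morph (T' := fun=> lop W) _ _ hv.1); last first.
  by move=> _ w; exact: (vlinear_lop _ w hv).
apply: eq_leval => // y /=.
pose c' (i : 'I_l.+1) := if i == ord0 then W + c (ssnd e s ord0) else c (ssnd e s i).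
pose x' (i : 'I_l.+1) := if i == ord0 then y else x (ssnd e s i).
transitivity (flat f [seq (c' i, x' i) | i <- enum 'I_l.+1]); last first.
  rewrite -hat_pure enum_ordSl /t; move: (enum 'I_l) => r.
  rewrite /pure /= -!map_comp; congr (hat f (_ :: _)).
rewrite flat_map.
rewrite (leval_morph (T' := butlast (fun i => lop (c' i))) _ _ (@specialize_linear A)); last first.
  move=> i w; rewrite /butlast /c'; case: ifP => _; last exact: specialize_lvar.
  by rewrite (linD (@specialize_linear A)) specialize_lfst specialize_lvar lopD.
have -> : [ffun i => if i == ord0 then y else x (ssnd e s i)] = [ffun i => x' i] by [].
by apply: eq_leval => // w /=; exact: specialize_lconst.
Qed.

End Terms.
End Matching.

(** * Generic arguments *)

Section DaggerFacts.
Variables (F : fieldType) (k : nat) (N : derModType F).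

Lemma partial_ldag (i : 'I_k) (P : lpoly k.-1 N) : partial (ldag i P) = ldag i (partial P).
Proof.
rewrite /ldag; case: insub => [j|]; first exact: partial_lvar.
have pl : linear (partial : lpoly k.-1 N -> _) by exact: linearP.
rewrite [LHS](linB pl) [X in X - _ = _](linN pl) [X in - X - _ = _](lin_sum pl).
congr (- _ - _).
by apply: eq_bigr => j _; exact: partial_lvar.
Qed.

Lemma lvar_ldag i (j : 'I_k) (P : lpoly k.-1 N) : lvar i (ldag j P) = ldag j (lvar i P).
Proof.
rewrite /ldag; case: insub => [l|]; first exact: lvarC.
have vl := @lvar_lin F k.-1 N i.
rewrite [LHS](linB vl) [X in X - _ = _](linN vl).
rewrite (partial_lvar i P).
have -> : lvar i (\sum_(l < k.-1) lvar l P) = \sum_(l < k.-1) lvar l (lvar i P).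
  rewrite (lin_sum vl). apply: eq_bigr => l _.
  exact: lvarC.
by [].
Qed.

Lemma ldagC (i j : 'I_k) (P : lpoly k.-1 N) : ldag i (ldag j P) = ldag j (ldag i P).
Proof.
rewrite [in LHS]/ldag [in X in _ = ldag j X]/ldag.
case: insub => [l|]; first exact: lvar_ldag.
have dl := @ldag_linear F k N j.
rewrite (linB dl) (linN dl) (lin_sum dl) partial_ldag; congr (- _ - _).
by apply: eq_bigr => l _; exact: lvar_ldag.
Qed.

Lemma dagger_lvar i (P : lpoly k N) : dagger (lvar i P) = ldag i (dagger P).
Proof.
rewrite /dagger leval_lvar // => *; [exact: ldag_linear|exact: lconst_lin|exact: ldagC].
Qed.

Lemma dagger_partial (P : lpoly k N) : dagger (partial P) = partial (dagger P).
Proof.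
apply: leval_partial => *; [exact: ldag_linear|exact: ldagC|by rewrite partial_ldag].
Qed.

(** The weights of generic arguments: the i-th one is attached to the i-th
    variable. *)
Definition gen_weight (i : 'I_k) : {ffun 'I_k -> F} := [ffun j => (j == i)%:R].

Lemma lop_gen_weight i (W : lmodType F) (P : lpoly k W) : lop (gen_weight i) P = lvar i P.
Proof.
rewrite /lop (bigD1 i) //= ffunE eqxx scale1r big1 ?addr0 // => j ji.
by rewrite ffunE (negPf ji) scale0r.
Qed.

(** The variables and the eliminated one add up to [- partial], so that [dagger]
    kills the null submodule of the total weight. *)
Lemma dagger_nullp (P : lpoly k N) : (0 < k)%N -> nullp (\sum_i gen_weight i) P -> dagger P = 0.
Proof.
move=> k0 [Q ->]; have dl := @dagger_linear F k N.
rewrite (linD dl) dagger_partial lop_sum (lin_sum dl).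
under eq_bigr => i _ do rewrite lop_gen_weight dagger_lvar.
move: (dagger Q) => {Q} w; case: k k0 w => // k' _ w.
rewrite big_ord_recr /= {2}/ldag insubN /=; last by rewrite ltnn.
have -> : \sum_(i < k') ldag (widen_ord (leqnSn k') i) w = \sum_(i < k') lvar i w.
  apply: eq_bigr => i _; rewrite /ldag insubT /=; first exact: ltn_ord.
  by move=> lt; congr (lvar _ w); exact: val_inj.
set X := \sum_(i < k') lvar i w; lincomb F (lpoly k' N).
Qed.

End DaggerFacts.

Section PermMultimap.
Variables (F : fieldType) (L : nmodType) (Va Vb : lmodType F) (I : Type).
Variables (S : weightedLie L Va Vb I) (p : nat) (f : seq (L * Vb) -> Va).
Hypothesis fm : multimap S p f.

Lemma weight_permlist k (u : 'I_k -> L * Vb) (s : 'S_k) :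
  weight (permlist u s) = \sum_i (u i).1.
Proof.
rewrite /weight big_map big_enum /= [RHS](reindex_inj (@perm_inj _ s)).
by [].
Qed.

Lemma multimap_move t0 t1 x t2 : eqmod S (weight (t0 ++ t1 ++ x :: t2))
  (f (t0 ++ t1 ++ x :: t2)) ((-1) ^+ size t1 *: f (t0 ++ x :: t1 ++ t2)).
Proof.
elim: t1 t0 => [|y t1 IHt] t0 /=; first by rewrite expr0 scale1r; exact: eqmod_refl.
have E := IHt (rcons t0 y); rewrite !cat_rcons in E.
apply: eqmod_trans E _; rewrite exprS mulN1r scaleNr -scalerN; apply: eqmodZ.
have -> : weight (t0 ++ y :: t1 ++ x :: t2) = weight (t0 ++ y :: x :: t1 ++ t2).
  by rewrite !(weight_cat, weight_cons); congr (_ + (_ + _)); exact: addrCA.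
exact: (mm_swap fm).
Qed.

(** Alternation for all permutations follows from that for adjacent swaps: the
    least value is first moved to the head of the list. *)
Lemma multimap_permlist k (u : 'I_k -> L * Vb) (s : 'S_k) t0 :
  eqmod S (weight (t0 ++ permlist u s)) (f (t0 ++ permlist u s))
    ((-1) ^+ odd_perm s *: f (t0 ++ [seq u i | i <- enum 'I_k])).
Proof.
elim: k u s t0 => [|k IHk] u s t0.
  have -> : s = 1%g by apply/permP => -[].
  by rewrite odd_perm1 expr0 scale1r /permlist !enum_ord0; exact: eqmod_refl.
have [h _ hK] := lift_perm_bij k.
rewrite -[s]hK; case: (h s) => i s' /= {h hK s}.
rewrite permlist_lift enum_ordSl /= -map_comp.
set r := permlist _ s'; have := multimap_move t0 (take i r) (u ord0) (drop i r).
rewrite size_takel; last by rewrite size_permlist -ltnS.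
rewrite cat_take_drop => E.
apply: eqmod_trans E _; rewrite odd_lift_perm addbF.
have -> : (-1) ^+ (odd i (+) odd_perm s') = (-1) ^+ i * (-1) ^+ odd_perm s' :> F.
  by rewrite signr_addb signr_odd.
rewrite -scalerA; apply: eqmodZ.
have := IHk (fun j => u (lift ord0 j)) s' (rcons t0 (u ord0)); rewrite !cat_rcons -/r.
have -> // : weight (t0 ++ take i r ++ u ord0 :: drop i r) = weight (t0 ++ u ord0 :: r).
rewrite !(weight_cat, weight_cons) -[r in RHS](cat_take_drop i) weight_cat.
by congr (_ + _); exact: addrCA.
Qed.

End PermMultimap.

Section Specialization.
Variables (F : fieldType) (A B : derModType F).
Variables (brA : lieConformal A) (rho : lcRep brA B) (n : nat).
Local Notation S := (polyLie rho n).
Local Notation label := {ffun 'I_n -> F}.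

Section Sums.
Variables (k : nat) (c : 'I_k -> label) (x : {ffun 'I_k -> B}).
Local Notation es := [seq warg c x i | i <- enum 'I_k].

Lemma sum_insert m l (e : (m + l.+1 = k)%N) (f : cochain B A l.+1) (g : cochain B A m) :
  \sum_(s : 'S_k | unshuffle [:: m; 1; l]%N s) (-1) ^+ odd_perm s *:
    specialize c (insert_term rho e f g x s) = ins S (hat f) (hat g) es.
Proof.
have fm := hat_multimap rho n f; have gm := hat_multimap rho n g.
pose T a b d := if b is [:: y] then hat f (actat S (weight a) (hat g a) y :: d) else 0.
transitivity (split3 T es); last by [].
have kE : k = (m + 1 + l)%N by rewrite -e addnS addn1.
rewrite -(@unshuffle_sum _ _ _ m 1 l k) // => [|a b d].
  apply: eq_big => [s|s _]; first exact: unshuffle3E.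
  congr (_ *: _); rewrite specialize_insert.
  have -> : drop (m + 1) (permlist (warg c x) s) = drop 1 (drop m (permlist (warg c x) s)).
    by rewrite drop_drop addnC.
  rewrite (drop_permlist e) enum_ordSl; move: (enum 'I_l) => r.
  by rewrite /= take0 drop0 -map_comp.
rewrite /T; case: b => [|y [|? ?]] //=; rewrite negb_and => /orP[ne|ne].
  rewrite (mm_size gm) //; exact: (lin0 (mm_actat _ y d fm)).
by rewrite (mm_size fm).
Qed.

Lemma sum_bracket m l (e : (m + l = k)%N) (f : cochain B A m) (g : cochain B A l) :
  \sum_(s : 'S_k | unshuffle [:: m; l]%N s) (-1) ^+ odd_perm s *:
    specialize c (bracket_term brA e f g x s) = brk S (hat f) (hat g) es.
Proof.
have fm := hat_multimap rho n f; have gm := hat_multimap rho n g.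
rewrite /brk -(@unshuffle2_sum _ _ _ m l k) // => [|a b].
  by apply: eq_bigr => s _; rewrite (specialize_bracket rho).
rewrite negb_and => /orP[ne|ne].
  by rewrite (mm_size fm) // (lin0 (wbr_linl S _ _)).
by rewrite (mm_size gm) // (lin0 (wbr_linr S _ _)).
Qed.

End Sums.

Section Bracket.
Variables (p' q' : nat).
Let p := p'.+1.
Let q := q'.+1.
Variables (f1 : cochain B A p) (f2 : cochain B A q).
Implicit Type u : {ffun 'I_(p + q) -> B}.

(** The terms of the bracket before [dagger] is applied, which can be specialized
    at arguments of any weights. *)
Definition prebracket u : lpoly (p + q) A :=
  - (\sum_(s : 'S_(p + q) | unshuffle [:: q; 1; p.-1]%N s)
       (-1) ^+ odd_perm s *: insert_term rho (addnC q p) f1 f2 u s)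
  + (-1) ^+ (p * q) *:
    (\sum_(s : 'S_(p + q) | unshuffle [:: p; 1; q.-1]%N s)
       (-1) ^+ odd_perm s *: insert_term rho (erefl (p + q)%N) f2 f1 u s)
  - (-1) ^+ (p * q) *:
    (\sum_(s : 'S_(p + q) | unshuffle [:: p; q] s)
       (-1) ^+ odd_perm s *: bracket_term brA (erefl (p + q)%N) f1 f2 u s).

Lemma controlling_bracketE u : controlling_bracket rho f1 f2 u = dagger (prebracket u).
Proof.
have dl := @dagger_linear F (p + q) A.
have ds (P : pred 'S_(p + q)) (G : 'S_(p + q) -> lpoly (p + q) A) :
    dagger (\sum_(s | P s) (-1) ^+ odd_perm s *: G s) =
    \sum_(s | P s) (-1) ^+ odd_perm s *: dagger (G s).
  by rewrite (lin_sum dl); apply: eq_bigr => s _; rewrite (linZ dl).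
by rewrite /prebracket (linB dl) (linD dl) (linN dl) !(linZ dl) !ds.
Qed.

Lemma specialize_prebracket c u : specialize c (prebracket u) =
  ctl S p q (hat f1) (hat f2) [seq warg c u i | i <- enum 'I_(p + q)].
Proof.
have sl := @specialize_linear F n (p + q) c A.
have ss (P : pred 'S_(p + q)) (G : 'S_(p + q) -> lpoly (p + q) A) :
    specialize c (\sum_(s | P s) (-1) ^+ odd_perm s *: G s) =
    \sum_(s | P s) (-1) ^+ odd_perm s *: specialize c (G s).
  by rewrite (lin_sum sl); apply: eq_bigr => s _; rewrite (linZ sl).
rewrite /prebracket (linB sl) (linD sl) (linN sl) !(linZ sl) !ss.
by rewrite !sum_insert sum_bracket.
Qed.

(** The bracket of the theorem, as a cochain evaluated at arguments of arbitrary
    weights, is the bracket of the extended cochains. *)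
Lemma controlling_bracket_ctl c u : nullp (\sum_i c i)
  (ctl S p q (hat f1) (hat f2) [seq warg c u i | i <- enum 'I_(p + q)] -
   leval (butlast (fun i => lop (c i))) lconst (controlling_bracket rho f1 f2 u)).
Proof. by rewrite controlling_bracketE -specialize_prebracket; exact: dagger_null. Qed.

End Bracket.
End Specialization.

Section Generic.
Variables (F : fieldType) (A B : derModType F).
Variables (brA : lieConformal A) (rho : lcRep brA B).
Variables (p' q' : nat).
Let p := p'.+1.
Let q := q'.+1.
Let k := (p + q)%N.
Local Notation S := (polyLie rho k).
Variables (f1 : cochain B A p) (f2 : cochain B A q).
Implicit Type u : {ffun 'I_k -> B}.
Local Notation es u := [seq warg (@gen_weight F k) u i | i <- enum 'I_k].
Local Notation phi := (ctl S p q (hat f1) (hat f2)).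

Let phi_mm : multimap S k phi.
Proof. exact: multimap_ctl (hat_multimap rho k f1) (hat_multimap rho k f2). Qed.

Lemma controlling_bracket_generic u : controlling_bracket rho f1 f2 u = dagger (phi (es u)).
Proof.
rewrite controlling_bracketE -specialize_prebracket; congr dagger.
rewrite -{1}[prebracket _ _ _ _]leval_id; apply: eq_leval => // i P.
by rewrite lop_gen_weight.
Qed.

Lemma generic_args_upd u (i : 'I_k) y :
  es (upd u i y) = take i (es u) ++ (gen_weight F i, lconst y) :: drop i.+1 (es u).
Proof.
have szi v : size (es v) = k by rewrite size_map size_enum_ord.
have lt_i := ltn_ord i.
apply: (@eq_from_nth _ 0).
  rewrite szi size_cat /= size_takel; last by rewrite szi ltnW.
  by rewrite size_drop szi addnS -addSn subnKC.
move=> j; rewrite szi => lt_j.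
rewrite (nth_map (Ordinal lt_j)) ?size_enum_ord // nth_cat size_takel ?szi; last exact: ltnW.
have -> : nth (Ordinal lt_j) (enum 'I_k) j = Ordinal lt_j.
  by apply: val_inj; rewrite /= nth_enum_ord.
have esj : nth 0 (es u) j = warg (@gen_weight F k) u (Ordinal lt_j).
  rewrite (nth_map (Ordinal lt_j)) ?size_enum_ord //; congr warg.
  by apply: val_inj; rewrite /= nth_enum_ord.
rewrite /warg ffunE -val_eqE /=; case: (ltngtP j i) => ji.
- by rewrite nth_take // esj.
- by rewrite -(subnSK ji) /= nth_drop subnKC // esj.
- have -> : (j - i = 0)%N by rewrite ji subnn.
  by rewrite /=; congr (gen_weight _ _, _); exact: val_inj.
Qed.

Lemma weight_generic_args u : weight (es u) = \sum_i gen_weight F i.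
Proof. by rewrite weight_warg big_enum. Qed.

(** Linearity and sesquilinearity are inherited from [ctl] through generic
    arguments.  For the symmetry under [s], the cochain condition specializes the
    i-th variable to the variable [s i]; by [controlling_bracket_ctl] this is the
    value of [ctl] on the permuted list of generic arguments. *)
Lemma controlling_bracket_is_cochain : is_cochain (controlling_bracket rho f1 f2).
Proof.
have dl := @dagger_linear F k A.
have k0 : (0 < k)%N by [].
split=> [i u d x y|i u|s u].
- rewrite !controlling_bracket_generic !generic_args_upd -dl; congr dagger.
  by rewrite (@lconst_lin F k B) (mm_linear phi_mm).
- apply/eqP; rewrite -addr_eq0; apply/eqP.
  rewrite !controlling_bracket_generic -dagger_lvar -(linD dl) generic_args_upd.
  set s1 := take i _; set s2 := drop _ _.
  have E : es u = s1 ++ (gen_weight F i, lconst (u i)) :: s2.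
    rewrite -generic_args_upd; congr map; apply/boolp.funext => j; rewrite /warg ffunE.
    by case: eqP => [->|].
  apply: dagger_nullp k0 _; rewrite E -[lvar i _](mm_mul phi_mm) /= -partial_lconst.
  have := mm_linear phi_mm s1 (gen_weight F i) s2 1 (partial (lconst (u i))) (lvar i (lconst (u i))).
  rewrite !scale1r => <-; rewrite -(weight_generic_args u) E.
  have -> : weight (s1 ++ (gen_weight F i, lconst (u i)) :: s2) =
    weight (s1 ++ (gen_weight F i, partial (lconst (u i)) + lvar i (lconst (u i))) :: s2).
    by rewrite !weight_cat !weight_cons.
  apply: (mm_null phi_mm); exists (lconst (u i)); by rewrite lop_gen_weight.
- pose c i := gen_weight F (s i); pose v := [ffun i => u (s i)].
  have cE : \sum_i c i = \sum_i gen_weight F i by rewrite [RHS](reindex_inj (@perm_inj _ s)).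
  have vE : [seq warg c v i | i <- enum 'I_k] = permlist (warg (@gen_weight F k) u) s.
    by apply: eq_map => i; rewrite /warg ffunE.
  have N1 := controlling_bracket_ctl rho f1 f2 c v; rewrite cE vE in N1.
  have N2 := multimap_permlist phi_mm (warg (@gen_weight F k) u) s [::].
  rewrite /= weight_permlist /= in N2.
  have D1 := dagger_nullp k0 N1; have D2 := dagger_nullp k0 N2.
  rewrite (linB dl) in D1; rewrite (linB dl) (linZ dl) in D2.
  move/eqP: D1; rewrite subr_eq0 => /eqP D1; move/eqP: D2; rewrite subr_eq0 => /eqP D2.
  rewrite controlling_bracket_generic -[LHS](signrZK (odd_perm s)) -D2 D1.
  congr (_ *: dagger _); apply: eq_leval => // i P.
  by rewrite /butlast lop_gen_weight.
Qed.

End Generic.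

(** * The graded Lie algebra of cochains *)

Section GradedLie.
Variables (F : fieldType) (A B : derModType F).
Variables (brA : lieConformal A) (rho : lcRep brA B).
Local Notation S n := (polyLie rho n).

Lemma controlling_bracket_in p q (f1 : cochain B A p.+1) (f2 : cochain B A q.+1) :
  controlling_bracket rho f1 f2 \in @cochain_pred F B A (p.+1 + q.+1).
Proof. exact/asboolP/controlling_bracket_is_cochain. Qed.

Definition bracket_cochain p q (f1 : cochain B A p.+1) (f2 : cochain B A q.+1) :
  cochain B A (p.+1 + q.+1)%N := Cochain (controlling_bracket_in f1 f2).

(** Degree zero is outside of the graded Lie algebra and gets a default value. *)
Definition cochain_bracket (p q : nat) : cochain B A p -> cochain B A q -> cochain B A (p + q)%N :=
  match p, q with
  | p'.+1, q'.+1 => @bracket_cochain p' q'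
  | _, _ => fun _ _ => 0
  end.

Lemma hat_linear n k c (f g : cochain B A k) s :
  hat (n := n) (c *: f + g) s = c *: hat f s + hat g s.
Proof.
rewrite /hat -mlextP; apply: eq_mlext => t _; rewrite /flat.
case: eqP => _; last by rewrite scaler0 addr0.
exact: leval_butlast_linear.
Qed.

Lemma hat_ecast n k l (e : k = l) (f : cochain B A k) s :
  hat (n := n) (ecast n (cochain B A n) e f) s = hat f s.
Proof. by case: l / e. Qed.

(** Both sides are polynomial-linear in each argument, so it is enough to compare
    them at constant arguments. *)
Lemma hat_cochain_bracket n p q (f : cochain B A p) (g : cochain B A q) s : (0 < p)%N -> (0 < q)%N ->
  eqmod (S n) (weight s) (hat (cochain_bracket f g) s) (ctl (S n) p q (hat f) (hat g) s).
Proof.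
case: p f => // p f; case: q g => // q g _ _.
have cm := multimap_ctl (hat_multimap rho n f) (hat_multimap rho n g).
set h := cochain_bracket f g; pose G s := hat h s - ctl (S n) p.+1 q.+1 (hat f) (hat g) s.
suff: nullp (weight s) (G s) by [].
rewrite (@mlext_unique _ _ _ _ G) => [|s1 c s2]; last first.
  apply: vlinearB; first exact: hat_vlinear.
  by split=> [|i P]; [exact: (mm_linear cm)|exact: (mm_mul cm)].
apply: mlext_null => t ts; rewrite /G hat_pure.
have -> : weight s = \sum_(e <- t) e.1.
  by rewrite /weight -!(big_map fst xpredT id) /= ts.
have [st|ne] := eqVneq (size t) (p.+1 + q.+1)%N; last first.
  rewrite /flat (negPf ne) (mm_size cm) ?subr0; first exact: nullp0.
  by rewrite size_map.
rewrite (flatE _ st) -(sum_lab st).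
have := controlling_bracket_ctl rho f g (lab t) (arg _ t).
have -> : [seq warg (lab t) (arg (p.+1 + q.+1) t) i | i <- enum 'I_(p.+1 + q.+1)] = pure t.
  rewrite /pure -[in RHS](mkseq_nth 0 t) st /mkseq -val_enum_ord -!map_comp.
  by apply: eq_map => i /=; rewrite /warg ffunE.
move=> /(nullpP (-1))/(_ (nullp0 _ _)); rewrite scaleN1r addr0 opprB.
by [].
Qed.

(** A cochain is recovered from its extension at generic arguments, where the
    i-th argument is attached to the i-th variable. *)
Lemma cochain_eq k (f g : cochain B A k) : (0 < k)%N ->
  (forall s, eqmod (S k) (weight s) (hat f s) (hat g s)) -> f = g.
Proof.
move=> k0 fg; apply: val_inj; apply/funext => u.
have E (h : cochain B A k) : h u = dagger (hat h [seq warg (@gen_weight F k) u i | i <- enum 'I_k]).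
  have [_ _ /(_ 1%g u)] := cochainP h; rewrite odd_perm1 expr0 scale1r => ->.
  rewrite hat_warg; congr dagger.
  have -> : [ffun i => u ((1 : 'S_k)%g i)] = [ffun i => u (id i)].
    by apply/ffunP => i; rewrite !ffunE perm1.
  by apply: eq_leval => // i P; rewrite /butlast lop_gen_weight perm1.
rewrite /= !E; apply/eqP; rewrite -subr_eq0 -(linB (@dagger_linear F k A)); apply/eqP.
apply: dagger_nullp k0 _; have := fg [seq warg (@gen_weight F k) u i | i <- enum 'I_k].
by rewrite weight_warg big_enum.
Qed.

Lemma ctl_linearl n p q c (f f' g : seq ({ffun 'I_n -> F} * lpoly n B) -> lpoly n A) s :
    multimap (S n) q g ->
  ctl (S n) p q (fun s => c *: f s + f' s) g s = c *: ctl (S n) p q f g s + ctl (S n) p q f' g s.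
Proof.
move=> gm; rewrite /ctl.
have -> : ins (S n) (fun s => c *: f s + f' s) g s = c *: ins (S n) f g s + ins (S n) f' g s.
  rewrite -splitsum_lin; apply: eq_splitsum => a d _.
  by rewrite -picksumZ -picksumD.
have -> : ins (S n) g (fun s => c *: f s + f' s) s = c *: ins (S n) g f s + ins (S n) g f' s.
  rewrite -splitsum_lin; apply: eq_splitsum => a d _.
  exact: (mm_ins_lin (weight a) id d gm).
have -> : brk (S n) (fun s => c *: f s + f' s) g s = c *: brk (S n) f g s + brk (S n) f' g s.
  by rewrite -splitsum_lin; apply: eq_splitsum => a d _; exact: (wbr_linl (S n)).
lincomb F (lpoly n A).
Qed.

Lemma cochain_bracket_linearl p q (g : cochain B A q) : (0 < p)%N -> (0 < q)%N ->
  linear (fun f : cochain B A p => cochain_bracket f g).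
Proof.
move=> p0 q0 c f f'; apply: cochain_eq => [|s]; first by rewrite addn_gt0 p0.
rewrite hat_linear; apply: eqmod_trans (hat_cochain_bracket _ _ _ p0 q0) _.
apply: eqmod_sym; apply: eqmod_trans (eqmodP c (hat_cochain_bracket f g s p0 q0) (hat_cochain_bracket f' g s p0 q0)) _.
rewrite -(ctl_linearl _ _ _ _ _ (hat_multimap rho _ g)).
apply: (eqmod_ctl (p := p)) => [||s'|s'].
- exact: multimap_lin (hat_multimap rho _ f) (hat_multimap rho _ f').
- exact: hat_multimap.
- by rewrite hat_linear; exact: eqmod_refl.
- exact: eqmod_refl.
Qed.

Lemma cochain_bracket_skew p q (f : cochain B A p) (g : cochain B A q) : (0 < p)%N -> (0 < q)%N ->
  cochain_bracket f g = - ((-1) ^+ (p * q) *: ecast n (cochain B A n) (addnC q p) (cochain_bracket g f)).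
Proof.
move=> p0 q0; apply: cochain_eq => [|s]; first by rewrite addn_gt0 p0.
apply: eqmod_trans (hat_cochain_bracket f g s p0 q0) _.
apply: eqmod_trans (ctl_skew _ s (mm_size (hat_multimap rho (p + q) f))
  (mm_size (hat_multimap rho (p + q) g))) _.
have -> : hat (- ((-1) ^+ (p * q) *: ecast n (cochain B A n) (addnC q p) (cochain_bracket g f))) s =
    - (-1) ^+ (p * q) *: hat (cochain_bracket g f) s.
  have H0 : hat (0 : cochain B A (p + q)) s = 0.
    have := hat_linear (-1) (0 : cochain B A (p + q)) 0 s.
    by rewrite scaler0 addr0 scaleN1r addNr.
  have := hat_linear (- (-1) ^+ (p * q)) (ecast n (cochain B A n) (addnC q p) (cochain_bracket g f)) 0 s.
  by rewrite addr0 scaleNr hat_ecast H0 addr0.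
by rewrite -scaleNr; apply/eqmodZ/eqmod_sym/hat_cochain_bracket.
Qed.

Lemma cochain_bracket_linearr p q (f : cochain B A p) : (0 < p)%N -> (0 < q)%N ->
  linear (@cochain_bracket p q f).
Proof.
move=> p0 q0 c g g'; rewrite [LHS]cochain_bracket_skew // (cochain_bracket_linearl f q0 p0).
have ecl k l (e : k = l) (x y : cochain B A k) :
    ecast n (cochain B A n) e (c *: x + y) =
    c *: ecast n (cochain B A n) e x + ecast n (cochain B A n) e y by case: l / e.
rewrite ecl [cochain_bracket f g]cochain_bracket_skew // [cochain_bracket f g']cochain_bracket_skew //.
by rewrite scalerDr opprD scalerN !scalerA mulrC.
Qed.

Lemma cochain_bracket_jacobi p q r (f : cochain B A p) (g : cochain B A q) (h : cochain B A r) :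
    (0 < p)%N -> (0 < q)%N -> (0 < r)%N ->
  cochain_bracket f (cochain_bracket g h) =
    ecast n (cochain B A n) (esym (addnA p q r)) (cochain_bracket (cochain_bracket f g) h) +
    (-1) ^+ (p * q) *:
      ecast n (cochain B A n) (addnCA q p r) (cochain_bracket g (cochain_bracket f h)).
Proof.
move=> p0 q0 r0; apply: cochain_eq => [|s]; first by rewrite addn_gt0 p0.
have [qr pq pr] : [/\ 0 < q + r, 0 < p + q & 0 < p + r]%N by rewrite !addn_gt0 p0 q0.
have [fm gm hm] := And3 (hat_multimap rho (p + (q + r)) f)
  (hat_multimap rho (p + (q + r)) g) (hat_multimap rho (p + (q + r)) h).
apply: eqmod_trans (hat_cochain_bracket f (cochain_bracket g h) s p0 qr) _.
apply: eqmod_trans (eqmod_ctl s fm (hat_multimap rho _ (cochain_bracket g h))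
  (fun s => eqmod_refl _ _ _) (fun s => hat_cochain_bracket g h s q0 r0)) _.
apply: eqmod_trans (ctl_jacobi s fm gm hm) _.
have hatD (u v : cochain B A (p + (q + r))) k :
    hat (n := p + (q + r)) (u + k *: v) s = k *: hat v s + hat u s.
  by rewrite addrC hat_linear.
rewrite hatD !hat_ecast [X in eqmod _ _ X _]addrC.
apply/eqmod_sym/eqmodP.
  apply: eqmod_trans (hat_cochain_bracket g (cochain_bracket f h) s q0 pr) _.
  exact: (eqmod_ctl s gm (hat_multimap rho _ (cochain_bracket f h))
    (fun s => eqmod_refl _ _ _) (fun s => hat_cochain_bracket f h s p0 r0)).
apply: eqmod_trans (hat_cochain_bracket (cochain_bracket f g) h s pq r0) _.
exact: (eqmod_ctl s (hat_multimap rho _ (cochain_bracket f g)) hm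
  (fun s => hat_cochain_bracket f g s p0 q0) (fun s => eqmod_refl _ _ _)).
Qed.

End GradedLie.

Local Open Scope complex_scope.

Theorem corollary4p19 (R : realType) (a b : derModType R[i])
    (br_a : lieConformal a) (rho : lcRep br_a b)
    (fg_a : finitely_generated a) (fg_b : finitely_generated b) :
  exists br : forall p q : nat,
      cochain b a p -> cochain b a q -> cochain b a (p + q)%N,
    (forall (p q : nat) (f1 : cochain b a p.+1) (f2 : cochain b a q.+1)
            (u : {ffun 'I_(p.+1 + q.+1) -> b}),
        br p.+1 q.+1 f1 f2 u = controlling_bracket rho f1 f2 u) /\
    graded_lie br.
Proof.
exists (cochain_bracket rho); split=> //; split.
- exact: cochain_bracket_linearl.
- exact: cochain_bracket_linearr.
- exact: cochain_bracket_skew.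
- exact: cochain_bracket_jacobi.
Qed.
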